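(* Let $R=\exp(t^{12})\in\hat{\mathcal A}_2$. Consider the equation $$\lambda(a,b)+e^{-b}\lambda(b,c)+e^{a}\lambda(a,c)=\frac{1}{ab}+\frac{e^{-b}}{bc}+\frac{e^{a}}{ac}\qquad(\ast)$$ for a symmetric power series $\lambda$ over $\mathbb Q$ in two commuting variables, where in $(\ast)$ $a,b$ are commuting variables and $c=-(a+b)$. (1) If $\lambda$ is a symmetric power series satisfying $(\ast)$, then $$\Phi(a,b)=1+[a,b]\lambda(a,b)-a[a,b]\,\partial_a\lambda(a,b)-b[a,b]\,\partial_b\lambda(a,b)$$ satisfies, modulo 2FF, the positive hexagon $(\Delta 1)R=\Phi\cdot R^{23}\cdot(\Phi^{-1})^{132}\cdot R^{13}\cdot\Phi^{312}$, the negative hexagon $(\Delta 1)(R^{-1})=\Phi\cdot (R^{-1})^{23}\cdot(\Phi^{-1})^{132}\cdot (R^{-1})^{13}\cdot\Phi^{312}$, and the pentagon $\Phi^{123}\cdot(1\Delta1)\Phi\cdot\Phi^{234}=(\Delta11)\Phi\cdot(11\Delta)\Phi$. (2) Conversely, every $\Phi=\exp(\phi)$, with $\phi\in\hat{\mathcal L}_3$ having only terms of degree at least two, that satisfies $\Phi\cdot\Phi^{321}=1$ and the hexagons and pentagon modulo 2FF is, modulo 2FF, of the form displayed in (1) for some symmetric power series $\lambda$ satisfying $(\ast)$.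
   Context: All algebras are over $\mathbb Q$. For $n\ge 2$, $\mathcal A_n$ is the graded unital associative algebra (horizontal chord diagrams on $n$ strands) generated by degree-one elements $t^{ij}=t^{ji}$ ($1\le i\ne j\le n$) with relations $[t^{ij}+t^{jk},t^{ik}]=0$ for distinct $i,j,k$ and $[t^{ij},t^{kl}]=0$ for distinct $i,j,k,l$; $\hat{\mathcal A}_n$ is its degree completion. $\mathcal L_n$ is the Lie algebra with the same generators and relations (bracket $=$ commutator) and $\hat{\mathcal L}_n\subset\hat{\mathcal A}_n$ its completion. For $n=3$ write $a=t^{12}$, $b=t^{23}$, $c=t^{13}$. 2FF is the (closed) two-sided ideal of $\hat{\mathcal A}_n$ generated by all $u(xy-yx)$ with $x,y\in\hat{\mathcal A}_n$ and $u$ a product of two or more chords (degree $\ge2$). ''Modulo 2FF'' means in $\hat{\mathcal A}_3/2FF$ for the hexagons and symmetry, and in $\hat{\mathcal A}_4/2FF$ for the pentagon. Modulo 2FF all factors following an element of degree $\ge2$ commute, so $[a,b]p(a,b)$, $a[a,b]p(a,b)$, $b[a,b]p(a,b)$ are well defined for a commutative power series $p$. $\partial_a\lambda(a,b)$, $\partial_b\lambda(a,b)$ are the partial derivatives with respect to the first and second arguments. Strand-doubling algebra maps (which descend to the quotients): $(\Delta1):\hat{\mathcal A}_2\to\hat{\mathcal A}_3$, $t^{12}\mapsto t^{13}+t^{23}$; and $\hat{\mathcal A}_3\to\hat{\mathcal A}_4$ given by $(\Delta11)$: $t^{12}\mapsto t^{13}+t^{23}$, $t^{13}\mapsto t^{14}+t^{24}$,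 $t^{23}\mapsto t^{34}$; $(1\Delta1)$: $t^{12}\mapsto t^{12}+t^{13}$, $t^{13}\mapsto t^{14}$, $t^{23}\mapsto t^{24}+t^{34}$; $(11\Delta)$: $t^{12}\mapsto t^{12}$, $t^{13}\mapsto t^{13}+t^{14}$, $t^{23}\mapsto t^{23}+t^{24}$. For a sequence $xy\ldots z$ of distinct strand labels, $D^{xy\ldots z}$ is the image of $D$ under the algebra map relabeling strands $1\mapsto x$, $2\mapsto y$, etc. (so $R^{23}=e^b$, $R^{13}=e^c$; $(\cdot)^{132}$: $a\mapsto c,b\mapsto b,c\mapsto a$; $(\cdot)^{312}$: $a\mapsto c,b\mapsto a,c\mapsto b$; $(\cdot)^{321}$: $a\mapsto b,b\mapsto a,c\mapsto c$; $\Phi^{234}$: $t^{12}\mapsto t^{23}$, $t^{23}\mapsto t^{34}$, $t^{13}\mapsto t^{24}$). The right-hand side of $(\ast)$, with $c=-(a+b)$, is a genuine power series in $a,b$. *)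

(* Defs.v *)
From HB Require Import structures.
From mathcomp Require Import all_boot all_order all_algebra.
From mathcomp Require Import boolp classical_sets.

Set Implicit Arguments.
Unset Strict Implicit.
Unset Printing Implicit Defensive.

Import GRing.Theory.

Local Open Scope ring_scope.

(** * Formal power series in one variable *)

Record fps (R : Type) := Fps { fcoef : nat -> R }.
Coercion fcoef : fps >-> Funclass.

HB.instance Definition _ (R : Type) := gen_eqMixin (fps R).
HB.instance Definition _ (R : Type) := gen_choiceMixin (fps R).

Lemma fpsP (R : Type) (f g : fps R) : (forall n, f n = g n) -> f = g.
Proof. by case: f g => [f] [g] /= /funext ->. Qed.

Section FpsRing.
Variable R : comNzRingType.
Implicit Types f g h : fps R.

Definition fps_zero : fps R := Fps (fun=> 0).
Definition fps_opp f := Fps (fun n => - f n).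
Definition fps_add f g := Fps (fun n => f n + g n).
Definition fps_one : fps R := Fps (fun n => (n == 0%N)%:R).
Definition fps_mul f g := Fps (fun n => \sum_(i < n.+1) f i * g (n - i)%N).

Fact fps_addA : associative fps_add.
Proof. by move=> f g h; apply: fpsP => n /=; rewrite addrA. Qed.
Fact fps_addC : commutative fps_add.
Proof. by move=> f g; apply: fpsP => n /=; rewrite addrC. Qed.
Fact fps_add0 : left_id fps_zero fps_add.
Proof. by move=> f; apply: fpsP => n /=; rewrite add0r. Qed.
Fact fps_addN : left_inverse fps_zero fps_opp fps_add.
Proof. by move=> f; apply: fpsP => n /=; rewrite addNr. Qed.

HB.instance Definition _ :=
  GRing.isZmodule.Build (fps R) fps_addA fps_addC fps_add0 fps_addN.

Let tr N f : {poly R} := \poly_(i < N) f i.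

Let tr_mul N f g n : (n < N)%N -> (tr N f * tr N g)`_n = fps_mul f g n.
Proof.
move=> ltnN; rewrite coefM; apply: eq_bigr => i _; rewrite !coef_poly.
rewrite (leq_ltn_trans (leq_subr _ _) ltnN).
by rewrite (leq_ltn_trans _ ltnN) // -ltnS.
Qed.

Fact fps_mulC : commutative fps_mul.
Proof. by move=> f g; apply: fpsP => n; rewrite -!(@tr_mul n.+1) // mulrC. Qed.

Fact fps_mulA : associative fps_mul.
Proof.
move=> f g h; apply: fpsP => n.
have -> : fps_mul f (fps_mul g h) n
    = (tr n.+1 f * (tr n.+1 g * tr n.+1 h))`_n.
  rewrite coefM; apply: eq_bigr => i _.
  by rewrite tr_mul ?ltnS ?leq_subr // coef_poly ltn_ord.
rewrite mulrA coefM; apply: eq_bigr => i _.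
by rewrite tr_mul ?ltn_ord // coef_poly ltnS leq_subr.
Qed.

Fact fps_mul1 : left_id fps_one fps_mul.
Proof.
move=> f; apply: fpsP => n /=; rewrite big_ord_recl /= mul1r subn0 big1 ?addr0 //.
by move=> i _; rewrite mul0r.
Qed.

Fact fps_mulDl : left_distributive fps_mul fps_add.
Proof.
move=> f g h; apply: fpsP => n /=; rewrite -big_split /=.
by apply: eq_bigr => i _; rewrite mulrDl.
Qed.

Fact fps_one_neq0 : fps_one != 0.
Proof.
by apply/eqP => /(congr1 (fun f : fps R => f 0%N))/eqP; rewrite /= oner_eq0.
Qed.

HB.instance Definition _ := GRing.Zmodule_isComNzRing.Build (fps R)
  fps_mulA fps_mulC fps_mul1 fps_mulDl fps_one_neq0.

(* As usual for ring structures, the inverse of a non-invertible series is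
   the series itself. *)
Definition fps_unit : pred (fps R) := fun f => `[< exists g, g * f = 1 >].
Definition fps_inv f : fps R :=
  if pselect (exists g, g * f = 1) is left e then sval (cid e) else f.

Fact fps_mulV : {in fps_unit, left_inverse 1 fps_inv *%R}.
Proof.
move=> f /asboolP fU; rewrite /fps_inv; case: pselect => // e.
by case: (cid e).
Qed.
Fact fps_unitP f g : g * f = 1 -> fps_unit f.
Proof. by move=> gf; apply/asboolP; exists g. Qed.
Fact fps_inv_out : {in [predC fps_unit], fps_inv =1 id}.
Proof.
move=> f; rewrite inE /= => /asboolP fU; rewrite /fps_inv.
by case: pselect.
Qed.

HB.instance Definition _ := GRing.ComNzRing_hasMulInverse.Build (fps R)
  fps_mulV fps_unitP fps_inv_out.

End FpsRing.

Section FpsDomain.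
Variable R : idomainType.

Fact fps_integral : GRing.integral_domain_axiom (fps R).
Proof.
move=> f g fg0; apply/norP => -[f0 g0].
have ex (h : fps R) : h != 0 -> exists n, h n != 0.
  move=> h0; case: (pselect (exists n, h n != 0)) => // hn0.
  case/eqP: h0; apply: fpsP => n; apply/eqP/negPn/negP => hn.
  by apply: hn0; exists n.
case: (ex_minnP (ex _ f0)) => m fm minf.
case: (ex_minnP (ex _ g0)) => n gn ming.
have := congr1 (fun h : fps R => h (m + n)%N) fg0.
have ltm : (m < (m + n).+1)%N by rewrite ltnS leq_addr.
rewrite /= (bigD1 (Ordinal ltm)) //= addKn big1 ?addr0 => [/eqP|i].
  by rewrite mulf_eq0 (negPf fm) (negPf gn).
rewrite -val_eqE /= neq_ltn => /orP[im|mi].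
  have [->|/minf] := eqVneq (f i) 0; first by rewrite mul0r.
  by rewrite leqNgt im.
have [->|/ming] := eqVneq (g (m + n - i)%N) 0; first by rewrite mulr0.
by move=> /(leq_add mi); rewrite subnKC -1?ltnS // addSn ltnn.
Qed.

HB.instance Definition _ :=
  GRing.ComUnitRing_isIntegral.Build (fps R) fps_integral.

End FpsDomain.

(** * Power series over [rat] in two commuting variables *)

(* [rat[[a]][[b]]], with [f i j] the coefficient of [a ^ i * b ^ j]. *)
Notation fps2 := (fps (fps rat)).

Definition mk2 (F : nat -> nat -> rat) : fps2 := Fps (fun i => Fps (F i)).

Definition varA : fps2 := mk2 (fun i j => ((i == 1%N) && (j == 0%N))%:R).
Definition varB : fps2 := mk2 (fun i j => ((i == 0%N) && (j == 1%N))%:R).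
Definition varC : fps2 := - (varA + varB).

Definition symmetric2 (f : fps2) := forall i j, f i j = f j i.

(* The formal sums over [n], resp. over [i] and [j], in [exp2 p] and
   [subst2 f p q] are truncated at the total degree of the coefficient being
   computed; this is correct for [p], [q] without constant term. *)
Definition exp2 (p : fps2) : fps2 :=
  mk2 (fun k l => \sum_(n < (k + l).+1) (p ^+ n) k l / (n`!)%:R).

Definition subst2 (f p q : fps2) : fps2 :=
  mk2 (fun k l => \sum_(i < (k + l).+1) \sum_(j < (k + l).+1)
                    f i j * (p ^+ i * q ^+ j) k l).

Definition derivA (f : fps2) : fps2 := mk2 (fun i j => f i.+1 j * i.+1%:R).
Definition derivB (f : fps2) : fps2 := mk2 (fun i j => f i j.+1 * j.+1%:R).

(* The equation holds in the field of fractions of [rat[[a, b]]]. *)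
Definition lambda_equation (lam : fps2) : Prop :=
  let a := tofrac varA in
  let b := tofrac varB in
  let c := tofrac varC in
  let exp_b := tofrac (exp2 (- varB)) in
  let expa := tofrac (exp2 varA) in
  tofrac lam + exp_b * tofrac (subst2 lam varB varC)
    + expa * tofrac (subst2 lam varA varC)
  = 1 / (a * b) + exp_b / (b * c) + expa / (a * c).

(** * Noncommutative power series over [rat] *)

(* [f w] is the coefficient of the word [w] in the alphabet [G]. *)
Record ncseries (G : Type) := NCSeries { nccoef : seq G -> rat }.
Coercion nccoef : ncseries >-> Funclass.

HB.instance Definition _ (G : Type) := gen_eqMixin (ncseries G).
HB.instance Definition _ (G : Type) := gen_choiceMixin (ncseries G).

Lemma ncseriesP (G : Type) (f g : ncseries G) : (forall w, f w = g w) -> f = g.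
Proof. by case: f g => [f] [g] /= /funext ->. Qed.

Section NCSeriesRing.
Variable G : Type.
Implicit Types f g h : ncseries G.

Definition nc_zero : ncseries G := NCSeries (fun=> 0).
Definition nc_opp f := NCSeries (fun w => - f w).
Definition nc_add f g := NCSeries (fun w => f w + g w).
Definition nc_scale (x : rat) f := NCSeries (fun w => x * f w).
Definition nc_one : ncseries G := NCSeries (fun w => (size w == 0%N)%:R).
Definition nc_mul f g :=
  NCSeries (fun w => \sum_(k < (size w).+1) f (take k w) * g (drop k w)).

Fact nc_addA : associative nc_add.
Proof. by move=> f g h; apply: ncseriesP => w /=; rewrite addrA. Qed.
Fact nc_addC : commutative nc_add.
Proof. by move=> f g; apply: ncseriesP => w /=; rewrite addrC. Qed.
Fact nc_add0 : left_id nc_zero nc_add.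
Proof. by move=> f; apply: ncseriesP => w /=; rewrite add0r. Qed.
Fact nc_addN : left_inverse nc_zero nc_opp nc_add.
Proof. by move=> f; apply: ncseriesP => w /=; rewrite addNr. Qed.

HB.instance Definition _ :=
  GRing.isZmodule.Build (ncseries G) nc_addA nc_addC nc_add0 nc_addN.

Let shift (x : G) f := NCSeries (fun w => f (x :: w)).

Let nc_mul_nil f g : nc_mul f g [::] = f [::] * g [::].
Proof. by rewrite /= big_ord1. Qed.

Let nc_mul_cons f g x w :
  nc_mul f g (x :: w) = f [::] * g (x :: w) + nc_mul (shift x f) g w.
Proof. by rewrite /= big_ord_recl. Qed.

Fact nc_mulDl : left_distributive nc_mul nc_add.
Proof.
move=> f g h; apply: ncseriesP => w /=; rewrite -big_split /=.
by apply: eq_bigr => i _; rewrite mulrDl.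
Qed.
Fact nc_mulDr : right_distributive nc_mul nc_add.
Proof.
move=> f g h; apply: ncseriesP => w /=; rewrite -big_split /=.
by apply: eq_bigr => i _; rewrite mulrDr.
Qed.

Let nc_mulZl x f g : nc_mul (nc_scale x f) g = nc_scale x (nc_mul f g).
Proof.
apply: ncseriesP => w /=; rewrite mulr_sumr.
by apply: eq_bigr => i _; rewrite mulrA.
Qed.

Fact nc_mulA : associative nc_mul.
Proof.
move=> f g h; apply: ncseriesP => w.
elim: w f g => [|x w IHw] f g; first by rewrite !nc_mul_nil mulrA.
rewrite !nc_mul_cons nc_mul_nil IHw.
have -> : shift x (nc_mul f g)
    = nc_add (nc_scale (f [::]) (shift x g)) (nc_mul (shift x f) g).
  by apply: ncseriesP => v; rewrite [LHS]nc_mul_cons.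
by rewrite nc_mulDl nc_mulZl /= mulrDr mulrA addrA.
Qed.

Fact nc_mul1l : left_id nc_one nc_mul.
Proof.
move=> f; apply: ncseriesP => w /=.
rewrite big_ord_recl /= take0 drop0 mul1r big1 ?addr0 // => i _.
by rewrite size_takel ?ltn_ord // mul0r.
Qed.
Fact nc_mul1r : right_id nc_one nc_mul.
Proof.
move=> f; apply: ncseriesP => w /=.
rewrite big_ord_recr /= take_size drop_size mulr1 big1 ?add0r // => i _.
by rewrite size_drop subn_eq0 leqNgt ltn_ord mulr0.
Qed.

Fact nc_one_neq0 : nc_one != 0.
Proof.
by apply/eqP => /(congr1 (fun f : ncseries G => f [::]))/eqP; rewrite /= oner_eq0.
Qed.

HB.instance Definition _ := GRing.Zmodule_isNzRing.Build (ncseries G)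
  nc_mulA nc_mul1l nc_mul1r nc_mulDl nc_mulDr nc_one_neq0.

Fact nc_scaleA x y f : nc_scale x (nc_scale y f) = nc_scale (x * y) f.
Proof. by apply: ncseriesP => w /=; rewrite mulrA. Qed.
Fact nc_scale1 : left_id 1 nc_scale.
Proof. by move=> f; apply: ncseriesP => w /=; rewrite mul1r. Qed.
Fact nc_scaleDr : right_distributive nc_scale +%R.
Proof. by move=> x f g; apply: ncseriesP => w /=; rewrite mulrDr. Qed.
Fact nc_scaleDl f : {morph nc_scale^~ f : x y / x + y}.
Proof. by move=> x y; apply: ncseriesP => w /=; rewrite mulrDl. Qed.

HB.instance Definition _ := GRing.Zmodule_isLmodule.Build rat (ncseries G)
  nc_scaleA nc_scale1 nc_scaleDr nc_scaleDl.

Fact nc_scaleAl (x : rat) f g : x *: (f * g) = (x *: f) * g.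
Proof. by rewrite -[RHS]/(nc_mul (nc_scale x f) g) nc_mulZl. Qed.
HB.instance Definition _ :=
  GRing.Lmodule_isLalgebra.Build rat (ncseries G) nc_scaleAl.

Fact nc_scaleAr (x : rat) f g : x *: (f * g) = f * (x *: g).
Proof.
apply: ncseriesP => w /=; rewrite mulr_sumr.
by apply: eq_bigr => i _; rewrite mulrCA.
Qed.
HB.instance Definition _ :=
  GRing.Lalgebra_isAlgebra.Build rat (ncseries G) nc_scaleAr.

Definition nc_unit : pred (ncseries G) :=
  fun f => `[< exists g, g * f = 1 /\ f * g = 1 >].
Definition nc_inv f : ncseries G :=
  if pselect (exists g, g * f = 1 /\ f * g = 1) is left e
  then sval (cid e) else f.

Fact nc_mulVr : {in nc_unit, left_inverse 1 nc_inv *%R}.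
Proof.
move=> f /asboolP fU; rewrite /nc_inv; case: pselect => // e.
by case: (cid e) => g [].
Qed.
Fact nc_mulrV : {in nc_unit, right_inverse 1 nc_inv *%R}.
Proof.
move=> f /asboolP fU; rewrite /nc_inv; case: pselect => // e.
by case: (cid e) => g [].
Qed.
Fact nc_unitP f g : g * f = 1 /\ f * g = 1 -> nc_unit f.
Proof. by move=> fg; apply/asboolP; exists g. Qed.
Fact nc_inv_out : {in [predC nc_unit], nc_inv =1 id}.
Proof.
move=> f; rewrite inE /= => /asboolP fU; rewrite /nc_inv.
by case: pselect.
Qed.

HB.instance Definition _ := GRing.NzRing_hasMulInverse.Build (ncseries G)
  nc_mulVr nc_mulrV nc_unitP nc_inv_out.

End NCSeriesRing.

Definition bracket (A : pzRingType) (x y : A) : A := x * y - y * x.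

Definition letter (G : eqType) (x : G) : ncseries G :=
  NCSeries (fun w => (w == [:: x])%:R).

(* The three formal sums below are truncated at the length of the word whose
   coefficient is being computed; this is correct when [f] (in [nc_exp f]),
   [x] and [y] (in [nc_eval p x y]), and all the [h g] (in [nc_subst h f])
   have no constant term. *)
Definition nc_exp (G : Type) (f : ncseries G) : ncseries G :=
  NCSeries (fun w => \sum_(n < (size w).+1) (f ^+ n) w / (n`!)%:R).

(* A commutative power series evaluated at noncommuting arguments, with all
   the [x] factors to the left. *)
Definition nc_eval (G : Type) (p : fps2) (x y : ncseries G) : ncseries G :=
  NCSeries (fun w => \sum_(i < (size w).+1) \sum_(j < (size w).+1)
                       p i j * (x ^+ i * y ^+ j) w).

(* The continuous algebra map sending each letter [g] to [h g]. *)
Definition nc_subst (G : finType) (H : Type) (h : G -> ncseries H)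
    (f : ncseries G) : ncseries H :=
  NCSeries (fun v => \sum_(k < (size v).+1) \sum_(w : k.-tuple G)
                       f w * (\prod_(g <- w) h g) v).

(* The topology is that of the degree completion. *)
Definition nc_closed (G : Type) (J : set (ncseries G)) : Prop :=
  forall f : ncseries G, (forall N, exists2 g : ncseries G, J g &
               forall w, (size w <= N)%N -> f w = g w) -> J f.

Definition closed_ideal (G : Type) (J : set (ncseries G)) : Prop :=
  [/\ J 0,
      forall f g, J f -> J g -> J (f + g),
      forall f g, J g -> J (f * g),
      forall f g, J f -> J (f * g)
    & nc_closed J].

Definition closed_lie_subalgebra (G : Type) (J : set (ncseries G)) : Prop :=
  [/\ J 0,
      forall f g, J f -> J g -> J (f + g),
      forall (x : rat) f, J f -> J (x *: f),
      forall f g, J f -> J g -> J (bracket f g)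
    & nc_closed J].

(** * Horizontal chord diagrams *)

(* Strands are labelled [1, ..., n]; a chord is a pair of labels [i < j]. *)
Definition chord (n : nat) :=
  {p : 'I_n.+1 * 'I_n.+1 | (0 < p.1)%N && (p.1 < p.2)%N}.
HB.instance Definition _ (n : nat) := Finite.on (chord n).

(* The completed free algebra on the chords. An element of the completed
   algebra of horizontal chord diagrams is represented by a series of type
   [freeA n]; two series represent the same element when they are congruent
   modulo the closed ideal generated by [chord_rel n]. *)
Notation freeA n := (ncseries (chord n)).

(* [t i j = t j i], and [t i j = 0] unless [i] and [j] are distinct labels in
   [1, ..., n]. *)
Definition t {n : nat} (i j : nat) : freeA n :=
  \sum_(c : chord n | ((val c).1 == minn i j :> nat) &&
                      ((val c).2 == maxn i j :> nat)) letter c.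

Definition strands (n : nat) (s : seq nat) : bool :=
  uniq s && all (fun i => (0 < i <= n)%N) s.

Definition chord_rel (n : nat) : set (freeA n) :=
  [set f | (exists i j k, strands n [:: i; j; k] /\
              f = bracket (t i j + t j k) (t i k))
        \/ (exists i j k l, strands n [:: i; j; k; l] /\
              f = bracket (t i j) (t k l))].

Arguments chord_rel : clear implicits.

Definition gen_2FF (n : nat) : set (freeA n) :=
  [set f | exists (w : seq (chord n)) (x y : freeA n), (2 <= size w)%N /\
             f = (\prod_(c <- w) letter c) * (x * y - y * x)].

Arguments gen_2FF : clear implicits.

Definition eqA (n : nat) (x y : freeA n) : Prop :=
  smallest (@closed_ideal _) (chord_rel n) (x - y).

Definition eq2FF (n : nat) (x y : freeA n) : Prop :=
  smallest (@closed_ideal _) (chord_rel n `|` gen_2FF n)%classic (x - y).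

(* [x] represents an element of the completed Lie algebra. *)
Definition in_hatL (n : nat) (x : freeA n) : Prop :=
  exists2 y, smallest (@closed_lie_subalgebra _) (range (@letter (chord n))) y
           & eqA x y.

(* The map replacing the strand [i] by the strands in the [i]-th list of [s]:
   it sends [t i j] to the sum of the [t k l], for [k] in the [i]-th list and
   [l] in the [j]-th list. *)
Definition cable {m n : nat} (s : seq (seq nat)) : freeA m -> freeA n :=
  nc_subst (fun c : chord m =>
    \sum_(k <- nth [::] s (val c).1.-1)
      \sum_(l <- nth [::] s (val c).2.-1) t k l).

Definition relabel {m n : nat} (s : seq nat) : freeA m -> freeA n :=
  cable [seq [:: i] | i <- s].

Definition D1 : freeA 2 -> freeA 3 := cable [:: [:: 1%N; 2%N]; [:: 3%N]].
Definition D11 : freeA 3 -> freeA 4 :=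
  cable [:: [:: 1%N; 2%N]; [:: 3%N]; [:: 4%N]].
Definition oneD1 : freeA 3 -> freeA 4 :=
  cable [:: [:: 1%N]; [:: 2%N; 3%N]; [:: 4%N]].
Definition oneoneD : freeA 3 -> freeA 4 :=
  cable [:: [:: 1%N]; [:: 2%N]; [:: 3%N; 4%N]].

Definition Rmat : freeA 2 := nc_exp (t 1 2).

(* The hexagon of sign [+] for [X := Rmat], of sign [-] for [X := Rmat^-1]. *)
Definition hexagon (X : freeA 2) (Phi : freeA 3) : Prop :=
  eq2FF (D1 X)
    (Phi * relabel [:: 2%N; 3%N] X * relabel [:: 1%N; 3%N; 2%N] Phi^-1
      * relabel [:: 1%N; 3%N] X * relabel [:: 3%N; 1%N; 2%N] Phi).

Definition pos_hexagon (Phi : freeA 3) : Prop := hexagon Rmat Phi.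
Definition neg_hexagon (Phi : freeA 3) : Prop := hexagon Rmat^-1 Phi.

Definition pentagon (Phi : freeA 3) : Prop :=
  @eq2FF 4
    (relabel [:: 1%N; 2%N; 3%N] Phi * oneD1 Phi
      * relabel [:: 2%N; 3%N; 4%N] Phi)
    (D11 Phi * oneoneD Phi).

Definition unitarity (Phi : freeA 3) : Prop :=
  eq2FF (Phi * relabel [:: 3%N; 2%N; 1%N] Phi) 1.

Definition Phi_of (lam : fps2) : freeA 3 :=
  let a := t 1 2 in
  let b := t 2 3 in
  1 + bracket a b * nc_eval lam a b
    - a * bracket a b * nc_eval (derivA lam) a b
    - b * bracket a b * nc_eval (derivB lam) a b.

(* Main.v *)
(* Write [T x w = w x - x w]. Modulo 2FF the commutators lie in a class [C] of
   elements killed on the left by everything of degree at least two; on [C] the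
   operators [T x] commute, and the series of the theorem is
   [1 + lam(T a, T b) [a, b]], the derivative terms being the cost of moving a
   chord to the left of [[a, b]].

   Hexagons: [a + b + c] is central, so each factor is a series in [T b] and
   [T c] applied to [[b, c]], while [exp (x + y) - exp x exp y = z + (x + y) z]
   for the series [z] in [T x], [T y] whose coefficients are those of
   [((a + b) e^b - b e^(a + b) - a) / (a b (a + b))], applied to [[x, y]].
   Comparing both sides gives the equation for [lam].

   Pentagon: since [lam] is symmetric it suffices to treat [a^i b^j + a^j b^i],
   where everything telescopes because [t^12] and [t^34], resp. [t^13] and
   [t^24], act equally on the commutators that occur.

   Converse: a Lie series is modulo 2FF the sum of its linear part and of some
   [lam(T a, T b) [a, b]], so [exp phi = 1 + phi]. The Fox derivative with
   abelianized right factors descends to the quotient and sends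
   [lam(T a, T b) [a, b]] to [b lam]; applied to unitarity and to the positive
   hexagon it yields the symmetry of [lam] and the equation. *)

From Stdlib Require Import Ncring Ncring_tac.
From HB Require Import structures.
Require Import Defs.
From mathcomp Require Import all_boot all_order all_algebra ring.
From mathcomp Require Import generic_quotient ring_quotient.
From mathcomp Require Import boolp classical_sets.

Set Implicit Arguments.
Unset Strict Implicit.
Unset Printing Implicit Defensive.

Import GRing.Theory.

Local Open Scope ring_scope.

(** Limits are given by explicit series, so an identity between them is checked modulo each step of
    a separated filtration, where it is a statement about finite sums. The same axioms cover
    commutative series, noncommutative series and the quotient by 2FF; there, separation is the
    closedness of the ideal. The hexagon rests on an asymmetry. An element [w] annihilated on the
    left by degree two tolerates one letter on its left and any number on its right, so
    [exp(-x) w exp(x)] equals [w exp(x) - x w exp(x)]. Right multiplication by an exponential is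
    thus, up to one letter on the left, multiplication of the series by that exponential, and the
    stray letters are exactly those of the summand [(x + y) z] in [exp(x + y) - exp(x) exp(y) = z +
    (x + y) z]. The obstacle is division by [a], [b] and [a + b], which has no meaning for
    operators. The terms of [z] are therefore defined by a recursion without denominators, and are
    compared with the closed formula after multiplication by [a b (a + b)], at the cost of three
    degrees of precision. *)

Section NoncommutativeRingTactic.
Variable A : nzRingType.

#[local] Instance nzRing_ncring_ops :
  @Ring_ops A 0 1 +%R *%R (fun x y => x - y) -%R eq := {}.
#[local] Instance nzRing_ncring : @Ring _ _ _ _ _ _ _ _ nzRing_ncring_ops.
Proof.
constructor; try by move=> ? ? -> ? ? ->.
- exact: RelationClasses.eq_equivalence.
- by move=> ? ? ->.
- exact: add0r.
- exact: addrC.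
- exact: addrA.
- exact: mul1r.
- exact: mulr1.
- exact: mulrA.
- exact: mulrDl.
- by move=> x y z; exact: mulrDr.
- by [].
- exact: subrr.
Qed.

End NoncommutativeRingTactic.
#[local] Existing Instance nzRing_ncring_ops.
#[local] Existing Instance nzRing_ncring.

(** * Filtered algebras *)

(** [fil_all] together with [filM] makes every step a two-sided ideal; [fil_sep] makes limits
    unique. *)
Record filtration (A : algType rat) := Filtration {
  fil :> nat -> A -> Prop;
  fil_all : forall x, fil 0 x;
  fil0 : forall N, fil N 0;
  filD : forall N x y, fil N x -> fil N y -> fil N (x + y);
  filZ : forall N (c : rat) x, fil N x -> fil N (c *: x);
  filM : forall (M N : nat) x y, fil M x -> fil N y -> fil (M + N)%N (x * y);
  fil_le : forall (M N : nat) x, (M <= N)%N -> fil N x -> fil M x;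
  fil_sep : forall x, (forall N, fil N x) -> x = 0 }.

Section Filtered.
Variables (A : algType rat) (F : filtration A).
Implicit Types (x y z w : A) (K M N : nat).

Lemma filN N x : F N x -> F N (- x).
Proof. by move=> ?; rewrite -scaleN1r; apply: filZ. Qed.

Lemma filB N x y : F N x -> F N y -> F N (x - y).
Proof. by move=> ? ?; apply/filD/filN. Qed.

Lemma filMl N x y : F N y -> F N (x * y).
Proof. by move=> Fy; apply: (@filM _ F 0) => //; apply: fil_all. Qed.

Lemma filMr N x y : F N x -> F N (x * y).
Proof. by move=> Fx; rewrite -[N]addn0; apply: filM => //; apply: fil_all. Qed.

Lemma fil_sum N I (r : seq I) (P : pred I) (M : I -> A) :
  (forall i, P i -> F N (M i)) -> F N (\sum_(i <- r | P i) M i).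
Proof.
by move=> FM; elim/big_rec: _ => [|i x Pi Fx]; [apply: fil0|apply/filD/Fx/FM].
Qed.

Lemma filX N x n : F N x -> F (n * N)%N (x ^+ n).
Proof.
move=> Fx; elim: n => [|n IHn]; first exact: fil_all.
by rewrite exprS mulSn; apply: filM.
Qed.

Lemma filX1 x n : F 1 x -> F n (x ^+ n).
Proof. by move=> Fx; rewrite -[X in F X]muln1; apply: filX. Qed.

Definition eqm N x y := F N (x - y).

Lemma eqm_eq N x y : x = y -> eqm N x y.
Proof. by move->; rewrite /eqm subrr; apply: fil0. Qed.

Lemma eqm_sym N x y : eqm N x y -> eqm N y x.
Proof. by move=> /filN; rewrite /eqm opprB. Qed.

Lemma eqm_trans N y x z : eqm N x y -> eqm N y z -> eqm N x z.
Proof. by rewrite /eqm => xy /(filD xy); rewrite addrA subrK. Qed.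

Lemma eqmD N x y x' y' : eqm N x x' -> eqm N y y' -> eqm N (x + y) (x' + y').
Proof. by rewrite /eqm opprD addrACA => ? ?; apply: filD. Qed.

Lemma eqmN N x x' : eqm N x x' -> eqm N (- x) (- x').
Proof. by rewrite /eqm -opprD => ?; apply: filN. Qed.

Lemma eqmB N x y x' y' : eqm N x x' -> eqm N y y' -> eqm N (x - y) (x' - y').
Proof. by move=> ? ?; apply/eqmD/eqmN. Qed.

Lemma eqmZ N c x x' : eqm N x x' -> eqm N (c *: x) (c *: x').
Proof. by rewrite /eqm -scalerBr => ?; apply: filZ. Qed.

Lemma eqmM N x y x' y' : eqm N x x' -> eqm N y y' -> eqm N (x * y) (x' * y').
Proof.
move=> xx yy; rewrite /eqm.
have -> : x * y - x' * y' = (x - x') * y + x' * (y - y').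
  by rewrite mulrBl mulrBr addrA subrK.
by apply: filD; [apply: filMr | apply: filMl].
Qed.

Lemma eqm_sum N I (r : seq I) (P : pred I) (f g : I -> A) :
  (forall i, P i -> eqm N (f i) (g i)) ->
  eqm N (\sum_(i <- r | P i) f i) (\sum_(i <- r | P i) g i).
Proof. by move=> MM; rewrite /eqm -sumrB; apply: fil_sum. Qed.

Lemma eqm_le M N x y : (M <= N)%N -> eqm N x y -> eqm M x y.
Proof. by move=> MN; apply: fil_le. Qed.

Lemma eqm_sep x y : (forall N, eqm N x y) -> x = y.
Proof. by move=> xy; apply/subr0_eq/(@fil_sep _ F). Qed.

Lemma eqm0 N x : eqm N x 0 <-> F N x.
Proof. by rewrite /eqm subr0. Qed.

Lemma eqm_fil N x y : eqm N x y -> F N y -> F N x.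
Proof. by move=> xy Fy; rewrite -[x](subrK y); apply: filD. Qed.

Lemma eqm_sum_tail N L K (M : nat -> A) :
  (forall n, (L <= n)%N -> F N (M n)) -> (L <= K)%N ->
  eqm N (\sum_(n < K) M n) (\sum_(n < L) M n).
Proof.
move=> FM LK; rewrite -(subnKC LK) big_split_ord /= /eqm addrAC subrr add0r.
by apply: fil_sum => i _; apply/FM/leq_addr.
Qed.

Lemma eqm_sum_widen N K (M : nat -> A) :
  (forall n, F n (M n)) -> (N <= K)%N ->
  eqm N (\sum_(n < K) M n) (\sum_(n < N) M n).
Proof.
by move=> FM NK; apply: eqm_sum_tail => // n le_Nn; apply: fil_le (FM n).
Qed.

Lemma eqm_square_widen N K (M : nat -> nat -> A) :
  (forall i j, F (i + j)%N (M i j)) -> (N <= K)%N ->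
  eqm N (\sum_(i < K) \sum_(j < K) M i j) (\sum_(i < N) \sum_(j < N) M i j).
Proof.
move=> FM NK; apply: (@eqm_trans _ (\sum_(i < N) \sum_(j < K) M i j)).
  apply: (@eqm_sum_widen N K (fun i => \sum_(j < K) M i j)) => // n.
  by apply: fil_sum => j _; apply: fil_le (FM _ _); apply: leq_addr.
apply: eqm_sum => i _; apply: eqm_sum_widen => // n.
by apply: fil_le (FM _ _); apply: leq_addl.
Qed.

Lemma sum_square_diagonal N (M : nat -> nat -> A) :
  \sum_(n < N) \sum_(i < n.+1) M i (n - i)%N
    = \sum_(i < N) \sum_(j < N - i) M i j.
Proof.
elim: N => [|N IHN]; first by rewrite !big_ord0.
rewrite big_ord_recr /= IHN [RHS]big_ord_recr /= [X in _ + X]big_ord_recr /=.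
rewrite subSnn big_ord1 subnn addrA; congr (_ + _); rewrite -big_split /=.
apply: eq_bigr => i _; rewrite subSn 1?ltnW // big_ord_recr //.
Qed.

(** The square and the triangle [i + j < N] differ by terms of order at least [N]. This takes the
    place of rearranging an infinite double sum. *)
Lemma eqm_square_diagonal N (M : nat -> nat -> A) :
  (forall i j, F (i + j)%N (M i j)) ->
  eqm N (\sum_(i < N) \sum_(j < N) M i j)
        (\sum_(n < N) \sum_(i < n.+1) M i (n - i)%N).
Proof.
move=> FM; rewrite sum_square_diagonal; apply: eqm_sum => i _.
apply: eqm_sum_tail (leq_subr _ _) => j le_j; apply: fil_le (FM _ _).
by rewrite -leq_subLR.
Qed.

(** * Exponentials *)

Definition is_sum (M : nat -> A) z := forall N, eqm N z (\sum_(n < N) M n).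

Lemma is_sum_uniq (M : nat -> A) z z' : is_sum M z -> is_sum M z' -> z = z'.
Proof.
by move=> Mz Mz'; apply: eqm_sep => N; apply: eqm_trans (Mz N) (eqm_sym (Mz' N)).
Qed.

(** A relation rather than a function, so that exponentials of series can be carried by [chom_exp]
    into any filtered algebra, in particular the quotient by 2FF. *)
Definition is_exp x ex := is_sum (fun n => (n`!%:R)^-1 *: x ^+ n) ex.

(** The expansion of [(x + y) ^+ n] with every [x] forced to the left of every [y]. *)
Definition exp_mul_term x y n : A :=
  \sum_(i < n.+1) (x ^+ i * y ^+ (n - i)) *+ 'C(n, i).

Lemma invf_fact_bin n i : (i <= n)%N ->
  ((i`!)%:R)^-1 * (((n - i)`!)%:R)^-1 = ((n`!)%:R)^-1 * ('C(n, i))%:R :> rat.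
Proof.
move=> le_in; have nz : ('C(n, i))%:R != 0 :> rat.
  by rewrite Num.Theory.pnatr_eq0 -lt0n bin_gt0.
by rewrite -(bin_fact le_in) !natrM !invfM mulrAC mulVf ?mul1r.
Qed.

Lemma is_exp_mul x y ex ey : F 1 x -> F 1 y -> is_exp x ex -> is_exp y ey ->
  is_sum (fun n => (n`!%:R)^-1 *: exp_mul_term x y n) (ex * ey).
Proof.
move=> Fx Fy xe ye N; apply: eqm_trans (eqmM (xe N) (ye N)) _.
rewrite big_distrl /=; under eq_bigr do rewrite big_distrr /=.
pose M i j := ((i`!)%:R^-1 *: x ^+ i) * ((j`!)%:R^-1 *: y ^+ j).
apply: (eqm_trans (@eqm_square_diagonal N M _)) => [i j|].
  by rewrite /M -scalerAl -scalerAr; do 2!apply: filZ; apply: filM; apply: filX1.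
apply: eqm_eq; apply: eq_bigr => n _; rewrite scaler_sumr; apply: eq_bigr => i _.
by rewrite /M -scalerAl -scalerAr !scalerA invf_fact_bin -1?ltnS // -scalerA scaler_nat.
Qed.

Lemma is_expD x y ex ey : F 1 x -> F 1 y -> GRing.comm x y ->
  is_exp x ex -> is_exp y ey -> is_exp (x + y) (ex * ey).
Proof.
move=> Fx Fy cxy xe ye N; apply: eqm_trans (is_exp_mul Fx Fy xe ye N) _.
apply: eqm_eq; apply: eq_bigr => n _; congr (_ *: _); rewrite addrC exprDn_comm //.
by apply: eq_bigr => i _; rewrite (commrX _ (commr_sym (commrX _ cxy))).
Qed.

Lemma is_exp0 : is_exp 0 1.
Proof.
case=> [|N]; first exact: fil_all.
apply: eqm_eq; rewrite big_ord_recl big1 => [|i _]; last by rewrite expr0n scaler0.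
by rewrite expr0 fact0 invr1 scale1r addr0.
Qed.

Lemma is_exp_comm x ex y : GRing.comm x y -> is_exp x ex -> GRing.comm ex y.
Proof.
move=> cxy xe; apply: eqm_sep => N.
apply: eqm_trans (eqmM (xe N) (eqm_eq _ erefl)) _.
apply: eqm_trans _ (eqmM (eqm_eq _ (erefl y)) (eqm_sym (xe N))).
apply: eqm_eq; rewrite mulr_suml mulr_sumr; apply: eq_bigr => n _.
by rewrite -scalerAl -scalerAr (commrX _ (commr_sym cxy)).
Qed.

Lemma is_exp_fil2 x ex : F 1 x -> is_exp x ex -> F 2 (ex - 1 - x).
Proof.
move=> Fx xe; have := xe 2%N; rewrite /eqm !big_ord_recl big_ord0 /= expr0 expr1 invr1.
by rewrite !scale1r addr0 opprD addrA.
Qed.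

(** * Power series in two operators *)

(** Raising the order by one makes power series in [X] converge. *)
Definition raising (X : A -> A) :=
  linear X /\ forall N x, F N x -> F N.+1 (X x).

Section Raising.
Variables (X : A -> A) (RX : raising X).

Lemma raisingD x y : X (x + y) = X x + X y.
Proof. by rewrite -[x in LHS]scale1r (proj1 RX) scale1r. Qed.

Lemma raising0 : X 0 = 0.
Proof. by apply: (addrI (X 0)); rewrite -raisingD !addr0. Qed.

Lemma raisingZ c x : X (c *: x) = c *: X x.
Proof. by rewrite -[c *: x]addr0 (proj1 RX) raising0 addr0. Qed.

Lemma raisingN x : X (- x) = - X x.
Proof. by rewrite -scaleN1r raisingZ scaleN1r. Qed.

Lemma raisingB x y : X (x - y) = X x - X y.
Proof. by rewrite raisingD raisingN. Qed.

Lemma raising_sum I (r : seq I) (P : pred I) (M : I -> A) :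
  X (\sum_(i <- r | P i) M i) = \sum_(i <- r | P i) X (M i).
Proof. by apply: (big_morph X raisingD raising0). Qed.

Lemma raising_eqm N x y : eqm N x y -> eqm N.+1 (X x) (X y).
Proof. by rewrite /eqm -raisingB; apply: (proj2 RX). Qed.

Lemma raising_iter n : linear (iter n X) /\
  forall N x, F N x -> F (n + N)%N (iter n X x).
Proof.
elim: n => [|n [IHl IHf]]; first by split.
split=> [c u v|N x Fx]; first by rewrite !iterS IHl (proj1 RX).
by rewrite iterS addSn; apply/(proj2 RX)/IHf.
Qed.

End Raising.

Lemma raising_mull x : F 1 x -> raising (fun y => x * y).
Proof.
move=> Fx; split=> [c u v|N y Fy]; first by rewrite mulrDr scalerAr.
by rewrite -add1n; apply: filM.
Qed.

Definition monom X Y w (i j : nat) : A := iter i X (iter j Y w).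

(* [z] is the power series [f] in the operators [X] and [Y], applied to [w]. *)
Definition Lev X Y w (f : fps2) z :=
  forall N, eqm N z (\sum_(i < N) \sum_(j < N) f i j *: monom X Y w i j).

Section Lev.
Variables (X Y : A -> A) (w : A).
Hypotheses (RX : raising X) (RY : raising Y).

Lemma fil_monom i j : F (i + j)%N (monom X Y w i j).
Proof.
apply: (proj2 (raising_iter RX i)).
by have := proj2 (raising_iter RY j) _ _ (fil_all F w); rewrite addn0.
Qed.

Lemma Lev_uniq f z z' : Lev X Y w f z -> Lev X Y w f z' -> z = z'.
Proof.
by move=> fz fz'; apply: eqm_sep => N; apply: eqm_trans (fz N) (eqm_sym (fz' N)).
Qed.

Lemma Lev0 : Lev X Y w 0 0.
Proof.
by move=> N; apply: eqm_eq; rewrite big1 // => i _; rewrite big1 // => j _; rewrite scale0r.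
Qed.

Lemma LevD f g y z : Lev X Y w f y -> Lev X Y w g z -> Lev X Y w (f + g) (y + z).
Proof.
move=> fy gz N; apply: eqm_trans (eqmD (fy N) (gz N)) (eqm_eq _ _).
rewrite -big_split /=; apply: eq_bigr => i _; rewrite -big_split /=.
by apply: eq_bigr => j _; rewrite -scalerDl.
Qed.

Lemma LevN f z : Lev X Y w f z -> Lev X Y w (- f) (- z).
Proof.
move=> fz N; apply: eqm_trans (eqmN (fz N)) (eqm_eq _ _).
rewrite -sumrN; apply: eq_bigr => i _; rewrite -sumrN.
by apply: eq_bigr => j _; rewrite -scaleNr.
Qed.

Lemma LevB f g y z : Lev X Y w f y -> Lev X Y w g z -> Lev X Y w (f - g) (y - z).
Proof. by move=> ? ?; apply/LevD/LevN. Qed.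

End Lev.

End Filtered.

Arguments is_exp_mul {A F x y ex ey}.

(** * Power series in two commuting variables *)

Lemma fps2P (f g : fps2) : (forall i j, f i j = g i j) -> f = g.
Proof. by move=> fg; apply: fpsP => i; apply: fpsP. Qed.

Definition scale2 (c : rat) (f : fps2) : fps2 := mk2 (fun i j => c * f i j).

Fact scale2A c d f : scale2 c (scale2 d f) = scale2 (c * d) f.
Proof. by apply: fps2P => i j /=; rewrite mulrA. Qed.
Fact scale21 : left_id 1 scale2.
Proof. by move=> f; apply: fps2P => i j /=; rewrite mul1r. Qed.
Fact scale2Dr : right_distributive scale2 +%R.
Proof. by move=> c f g; apply: fps2P => i j /=; rewrite mulrDr. Qed.
Fact scale2Dl f : {morph scale2^~ f : c d / c + d}.
Proof. by move=> c d; apply: fps2P => i j /=; rewrite mulrDl. Qed.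

HB.instance Definition _ := GRing.Zmodule_isLmodule.Build rat fps2
  scale2A scale21 scale2Dr scale2Dl.

Lemma coef2_sum I (r : seq I) (P : pred I) (M : I -> fps2) i j :
  (\sum_(k <- r | P k) M k) i j = \sum_(k <- r | P k) M k i j.
Proof. exact: (big_morph (fun f : fps2 => f i j)). Qed.

Lemma coef2M (f g : fps2) i j : (f * g) i j =
  \sum_(k < i.+1) \sum_(l < j.+1) f k l * g (i - k)%N (j - l)%N.
Proof.
rewrite [in LHS]/GRing.mul /=.
by rewrite (big_morph (fun h : fps rat => h j) (id1 := 0) (op1 := +%R)).
Qed.

Fact scale2Al c (f g : fps2) : c *: (f * g) = (c *: f) * g.
Proof.
apply: fps2P => i j; rewrite -[LHS]/(c * (f * g) i j) !coef2M mulr_sumr.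
by apply: eq_bigr => k _; rewrite mulr_sumr; apply: eq_bigr => l _; rewrite mulrA.
Qed.
HB.instance Definition _ := GRing.Lmodule_isLalgebra.Build rat fps2 scale2Al.

Fact scale2Ar c (f g : fps2) : c *: (f * g) = f * (c *: g).
Proof. by rewrite mulrC scale2Al mulrC. Qed.
HB.instance Definition _ := GRing.Lalgebra_isAlgebra.Build rat fps2 scale2Ar.

Lemma coef2Z c (f : fps2) i j : (c *: f) i j = c * f i j.
Proof. by []. Qed.

Definition ordge2 N (f : fps2) := forall i j, (i + j < N)%N -> f i j = 0.

Lemma ordge2M M N f g : ordge2 M f -> ordge2 N g -> ordge2 (M + N) (f * g).
Proof.
move=> fM gN i j lt_ij; rewrite coef2M big1 // => k _; rewrite big1 // => l _.
have [/fM->|le_M] := ltnP (k + l) M; first by rewrite mul0r.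
rewrite gN ?mulr0 // -(ltn_add2l (k + l)) addnACA !subnKC -1?ltnS //.
by apply: (leq_trans lt_ij); rewrite leq_add2r.
Qed.

Definition fil2 : filtration fps2.
Proof.
apply: (@Filtration fps2 ordge2) => //.
- by move=> N f g fN gN i j lt_ij; rewrite /= fN ?gN ?addr0.
- by move=> N c f fN i j lt_ij; rewrite coef2Z fN ?mulr0.
- exact: ordge2M.
- by move=> M N f le_MN fN i j lt_ij; apply: fN (leq_trans lt_ij le_MN).
- by move=> f f0; apply: fps2P => i j; apply: (f0 (i + j).+1).
Defined.

Lemma eqm2P N f g : eqm fil2 N f g <-> forall i j, (i + j < N)%N -> f i j = g i j.
Proof.
split=> fg i j lt_ij; first exact/subr0_eq/(fg _ _ lt_ij).
by apply/eqP; rewrite subr_eq0; apply/eqP/fg.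
Qed.

Lemma coef2_1 i j : (1 : fps2) i j = ((i == 0) && (j == 0))%N%:R.
Proof.
rewrite -[LHS]/(((i == 0)%N%:R : fps rat) j).
by case: (i == 0)%N => //=; case: j.
Qed.

Lemma coef2_varAM f i j : (varA * f) i j = if i is i'.+1 then f i' j else 0.
Proof.
rewrite coef2M; case: i => [|i].
  by rewrite big_ord1 big1 // => l _; rewrite /= mul0r.
rewrite 2!big_ord_recl /= big1 ?add0r => [|l _]; last by rewrite mul0r.
rewrite [X in _ + X]big1 ?addr0 => [|k _]; last first.
  by apply: big1 => l _; rewrite mul0r.
rewrite big_ord_recl /= mul1r subn0 subn1 big1 ?addr0 // => l _.
by rewrite mul0r.
Qed.

Lemma coef2_varBM f i j : (varB * f) i j = if j is j'.+1 then f i j' else 0.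
Proof.
rewrite coef2M big_ord_recl /= [X in _ + X]big1 ?addr0 => [|k _]; last first.
  by apply: big1 => l _; rewrite mul0r.
case: j => [|j]; first by rewrite big_ord1 mul0r.
rewrite 2!big_ord_recl /= mul0r add0r mul1r !subn0 subn1 big1 ?addr0 // => l _.
by rewrite mul0r.
Qed.

Lemma fil2_varA : fil2 1 varA. Proof. by case=> [|i] [|j]. Qed.
Lemma fil2_varB : fil2 1 varB. Proof. by case=> [|i] [|j]. Qed.
Lemma fil2_varC : fil2 1 varC.
Proof. exact/filN/filD/fil2_varB/fil2_varA. Qed.

Lemma varA_neq0 : varA != 0.
Proof. by apply/eqP => /(congr1 (fun f : fps2 => f 1%N 0%N)). Qed.
Lemma varB_neq0 : varB != 0.
Proof. by apply/eqP => /(congr1 (fun f : fps2 => f 0%N 1%N)). Qed.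
Lemma varC_neq0 : varC != 0.
Proof. by apply/eqP => /(congr1 (fun f : fps2 => f 1%N 0%N)). Qed.

Lemma fil2_divA N f : fil2 N.+1 (varA * f) -> fil2 N f.
Proof. by move=> fN i j lt_ij; have := fN i.+1 j lt_ij; rewrite coef2_varAM. Qed.

Lemma fil2_divB N f : fil2 N.+1 (varB * f) -> fil2 N f.
Proof.
by move=> fN i j lt_ij; have := fN i j.+1; rewrite addnS coef2_varBM; apply.
Qed.

(** The coefficient at [(i + 1, j + 1)] of [(a + b) f] is [f i (j + 1) + f (i + 1) j], so vanishing
    passes from row [i] to row [i + 1]. *)
Lemma fil2_divD N f : fil2 N.+1 ((varA + varB) * f) -> fil2 N f.
Proof.
move=> fN; elim=> [|i IHi] j lt_ij.
  have := fN 0%N j.+1 lt_ij; rewrite mulrDl.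
  by rewrite -[LHS]/((varA * f) 0%N j.+1 + (varB * f) 0%N j.+1) coef2_varAM coef2_varBM add0r.
have := fN i.+1 j.+1; rewrite addnS mulrDl => /(_ lt_ij).
rewrite -[LHS]/((varA * f) i.+1 j.+1 + (varB * f) i.+1 j.+1) coef2_varAM coef2_varBM.
by rewrite IHi ?add0r // addnS -addSn.
Qed.

Lemma is_exp_exp2 p : fil2 1 p -> is_exp fil2 p (exp2 p).
Proof.
move=> Fp N; apply/eqm2P => k l lt_kl /=.
have FM n : fil2 n (((n`!)%:R)^-1 *: p ^+ n) by apply/filZ/filX1.
have /eqm2P-> := eqm_sum_widen FM lt_kl; rewrite ?ltnSn // coef2_sum.
by apply: eq_bigr => n _; rewrite coef2Z mulrC.
Qed.

Lemma monom_mul (A : algType rat) (x y : A) i j :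
  monom (fun z => x * z) (fun z => y * z) 1 i j = x ^+ i * y ^+ j.
Proof.
rewrite /monom; have -> : iter j (fun z => y * z) 1 = y ^+ j.
  by elim: j => //= j ->; rewrite exprS.
by elim: i => [|i /= ->]; rewrite ?mul1r // exprS mulrA.
Qed.

Lemma Lev_subst2 f p q : fil2 1 p -> fil2 1 q ->
  Lev fil2 (fun z => p * z) (fun z => q * z) 1 f (subst2 f p q).
Proof.
move=> Fp Fq N; apply/eqm2P => k l lt_kl /=.
under [in RHS]eq_bigr do under eq_bigr do rewrite monom_mul.
pose M i j := f i j *: (p ^+ i * q ^+ j).
have FM i j : fil2 (i + j)%N (M i j) by apply/filZ/filM; apply: filX1.
have /eqm2P-> := eqm_square_widen FM lt_kl; rewrite ?ltnSn // coef2_sum.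
by apply: eq_bigr => i _; rewrite coef2_sum; apply: eq_bigr => j _; rewrite coef2Z.
Qed.

(** * Filtration of the noncommutative power series *)

Section NCFiltration.
Variable G : Type.

Definition ncordge N (f : ncseries G) := forall w, (size w < N)%N -> f w = 0.

Definition ncfil : filtration (ncseries G).
Proof.
apply: (@Filtration (ncseries G) ncordge) => //.
- by move=> N f g fN gN w lt_w; rewrite /= fN ?gN ?addr0.
- by move=> N c f fN w lt_w; rewrite /= fN ?mulr0.
- move=> M N f g fM gN w lt_w; rewrite /= big1 // => k _.
  have [lt_kM|le_Mk] := ltnP k M.
    by rewrite fM ?mul0r // size_takel // -ltnS.
  rewrite gN ?mulr0 // size_drop -(ltn_add2l k) subnKC -1?ltnS //.
  by apply: (leq_trans lt_w); rewrite leq_add2r.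
- by move=> M N f le_MN fN w lt_w; apply: fN (leq_trans lt_w le_MN).
- by move=> f f0; apply: ncseriesP => w; apply: (f0 (size w).+1).
Defined.

Lemma eqm_ncP N (f g : ncseries G) :
  eqm ncfil N f g <-> forall w, (size w < N)%N -> f w = g w.
Proof.
split=> fg w lt_w; first exact/subr0_eq/(fg _ lt_w).
by apply/eqP; rewrite subr_eq0; apply/eqP/fg.
Qed.

Lemma nc_sumE I (r : seq I) (P : pred I) (M : I -> ncseries G) w :
  (\sum_(k <- r | P k) M k) w = \sum_(k <- r | P k) M k w.
Proof. exact: (big_morph (fun f : ncseries G => f w)). Qed.

Lemma is_exp_nc_exp f : ncfil 1 f -> is_exp ncfil f (nc_exp f).
Proof.
move=> Ff N; apply/eqm_ncP => w lt_w /=.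
have FM n : ncfil n (((n`!)%:R)^-1 *: f ^+ n) by apply/filZ/filX1.
have /eqm_ncP-> := eqm_sum_widen FM lt_w; rewrite ?ltnSn // nc_sumE.
by apply: eq_bigr => n _; rewrite /= mulrC.
Qed.

Lemma Lev_nc_eval f x y : ncfil 1 x -> ncfil 1 y ->
  Lev ncfil (fun z => x * z) (fun z => y * z) 1 f (nc_eval f x y).
Proof.
move=> Fx Fy N; apply/eqm_ncP => w lt_w /=.
under [in RHS]eq_bigr do under eq_bigr do rewrite monom_mul.
pose M i j := f i j *: (x ^+ i * y ^+ j).
have FM i j : ncfil (i + j)%N (M i j) by apply/filZ/filM; apply: filX1.
have /eqm_ncP-> := eqm_square_widen FM lt_w; rewrite ?ltnSn // nc_sumE.
by apply: eq_bigr => i _; rewrite nc_sumE.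
Qed.

Lemma ncfil1P (f : ncseries G) : ncfil 1 f <-> f [::] = 0.
Proof. by split=> [->//|f0 [|]]. Qed.

End NCFiltration.
Arguments ncfil {G}.

(** * Substitution into power series in two operators *)

Section LevSubst.
Variables (A : algType rat) (F : filtration A) (X Y : A -> A) (w : A).
Hypotheses (RX : raising F X) (RY : raising F Y).
Notation L := (Lev F X Y w).

Lemma LevZ c f z : L f z -> L (c *: f) (c *: z).
Proof.
move=> fz N; apply: eqm_trans (eqmZ c (fz N)) (eqm_eq _ _ _).
rewrite scaler_sumr; apply: eq_bigr => i _; rewrite scaler_sumr.
by apply: eq_bigr => j _; rewrite scalerA.
Qed.

Lemma Lev_cast f g y z : f = g -> y = z -> L f y -> L g z.
Proof. by move=> -> ->. Qed.

Lemma Lev_sum I (r : seq I) (P : pred I) (f : I -> fps2) (z : I -> A) :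
  (forall i, P i -> L (f i) (z i)) ->
  L (\sum_(i <- r | P i) f i) (\sum_(i <- r | P i) z i).
Proof.
move=> fz; elim/big_rec2: _ => [|i y g Pi gy]; first exact: Lev0.
by apply/LevD/gy/fz.
Qed.

Lemma Lev_oppw f z : Lev F X Y (- w) f z -> L f (- z).
Proof.
move=> fz N; apply: eqm_trans (eqmN (fz N)) (eqm_eq _ _ _).
rewrite -sumrN; apply: eq_bigr => i _; rewrite -sumrN; apply: eq_bigr => j _.
have opp_iter U n v : raising F U -> iter n U (- v) = - iter n U v.
  by move=> RU; elim: n => //= n ->; rewrite (raisingN RU).
by rewrite /monom !opp_iter // scalerN opprK.
Qed.

Lemma Lev_fil N f z : L f z -> fil2 N f -> F N z.
Proof.
move=> fz fN; apply: eqm_fil (fz N) _.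
apply: fil_sum => i _; apply: fil_sum => j _.
have [lt_ij|le_N] := ltnP (i + j) N; first by rewrite fN // scale0r; apply: fil0.
by apply/filZ/(fil_le le_N)/fil_monom.
Qed.

Lemma Lev_lim f z :
  (forall N, exists g y, [/\ L g y, eqm fil2 N f g & eqm F N z y]) -> L f z.
Proof.
(* The [N] by [N] square contains monomials of total degree up to [2N - 2], hence the precision
   [N + N]. *)
move=> lim N; case: (lim (N + N)%N) => g [y [gy /eqm2P fg zy]].
apply: eqm_trans (eqm_le (leq_addr _ _) zy) _.
apply: eqm_trans (gy N) (eqm_eq _ _ _); apply: eq_bigr => i _; apply: eq_bigr => j _.
by rewrite fg // -addSn leq_add // ltnW.
Qed.

Lemma Lev1 : L 1 w.
Proof.
case=> [|N]; first exact: fil_all.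
apply: eqm_eq; rewrite big_ord_recl big_ord_recl coef2_1 scale1r.
rewrite big1 ?addr0 => [|j _]; last by rewrite coef2_1 scale0r.
by rewrite big1 ?addr0 // => i _; rewrite big1 // => j _; rewrite coef2_1 scale0r.
Qed.

Lemma Lev_varA f z : L f z -> L (varA * f) (X z).
Proof.
move=> fz [|N]; first exact: fil_all.
apply: eqm_trans (raising_eqm RX (fz N)) _.
rewrite (raising_sum RX) big_ord_recl /= [X in eqm _ _ _ (X + _)]big1 ?add0r.
  apply: eqm_sum => i _; rewrite (raising_sum RX) big_ord_recr /= coef2_varAM.
  rewrite -[X in eqm _ _ X _]addr0; apply: eqmD.
    by apply: eqm_eq; apply: eq_bigr => j _; rewrite (raisingZ RX) coef2_varAM.
  apply/eqm_sym/eqm0/filZ; apply: fil_le (fil_monom w RX RY i.+1 N).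
  by rewrite addSn ltnS leq_addl.
by move=> j _; rewrite coef2_varAM scale0r.
Qed.

(** A monomial applies [Y] before [X], so a further [Y] has to be moved past the powers of [X]; the
    hypothesis asks for this only on the monomials of [w]. *)
Lemma Lev_varB f z : (forall i j, Y (monom X Y w i j) = monom X Y w i j.+1) ->
  L f z -> L (varB * f) (Y z).
Proof.
move=> YM fz [|N]; first exact: fil_all.
apply: eqm_trans (raising_eqm RY (fz N)) _.
rewrite (raising_sum RY) big_ord_recr /= -[X in eqm _ _ X _]addr0; apply: eqmD.
  apply: eqm_eq; apply: eq_bigr => i _; rewrite (raising_sum RY) big_ord_recl.
  rewrite coef2_varBM scale0r add0r; apply: eq_bigr => j _.
  by rewrite (raisingZ RY) coef2_varBM YM.
apply/eqm_sym/eqm0; rewrite big_ord_recl coef2_varBM scale0r add0r.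
apply: fil_sum => j _; apply: filZ; apply: fil_le (fil_monom w RX RY N j.+1).
by rewrite addnS ltnS leq_addr.
Qed.

(** This is how a series in one pair of chords is rewritten in another pair: if [U] and [V] act as
    multiplication by [p] and [q] on the series in [X] and [Y], a change of operators becomes
    [subst2]. *)
Lemma Lev_subst U V p q f z : fil2 1 p -> fil2 1 q ->
  (forall g y, L g y -> L (p * g) (U y)) ->
  (forall g y, L g y -> L (q * g) (V y)) ->
  Lev F U V w f z -> L (subst2 f p q) z.
Proof.
move=> Fp Fq HU HV fz; apply: Lev_lim => N.
have HM i j : L (p ^+ i * q ^+ j) (monom U V w i j).
  have HV' : L (q ^+ j) (iter j V w).
    by elim: j => [|j IHj]; [exact: Lev1|rewrite exprS iterS; apply: HV].
  by elim: i => [|i IHi]; rewrite ?mul1r // exprS -mulrA /monom iterS; apply: HU.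
exists (\sum_(i < N) \sum_(j < N) f i j *: (p ^+ i * q ^+ j)).
exists (\sum_(i < N) \sum_(j < N) f i j *: monom U V w i j); split=> //.
  by apply: Lev_sum => i _; apply: Lev_sum => j _; apply: LevZ.
have := Lev_subst2 f Fp Fq; move=> /(_ N).
by under eq_bigr do under eq_bigr do rewrite monom_mul.
Qed.

End LevSubst.

(** * Continuous algebra maps *)

Record chom (A B : algType rat) (F : filtration A) (H : filtration B)
    (h : A -> B) : Prop := Chom {
  chom_linear : linear h;
  chom1 : h 1 = 1;
  chomM : {morph h : x y / x * y};
  chom_fil : forall N x, F N x -> H N (h x) }.

Section ChomTheory.
Variables (A B : algType rat) (F : filtration A) (H : filtration B).
Variables (h : A -> B) (Ch : chom F H h).

Lemma chomD : {morph h : x y / x + y}.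
Proof. by move=> x y; rewrite -[x]scale1r (chom_linear Ch) !scale1r. Qed.
Lemma chom0 : h 0 = 0.
Proof. by apply: (addrI (h 0)); rewrite -chomD !addr0. Qed.
Lemma chomZ c : {morph h : x / c *: x}.
Proof. by move=> x; rewrite -[c *: x]addr0 (chom_linear Ch) chom0 addr0. Qed.
Lemma chomN : {morph h : x / - x}.
Proof. by move=> x; rewrite -scaleN1r chomZ scaleN1r. Qed.
Lemma chomB : {morph h : x y / x - y}.
Proof. by move=> x y; rewrite chomD chomN. Qed.
Lemma chom_sum I (r : seq I) (P : pred I) (M : I -> A) :
  h (\sum_(i <- r | P i) M i) = \sum_(i <- r | P i) h (M i).
Proof. exact: (big_morph h chomD chom0). Qed.
Lemma chomX n : {morph h : x / x ^+ n}.
Proof.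
move=> x; elim: n => [|n IHn]; first exact: chom1 Ch.
by rewrite !exprS (chomM Ch) IHn.
Qed.
Lemma chom_bracket x y : h (bracket x y) = bracket (h x) (h y).
Proof. by rewrite /bracket chomB !(chomM Ch). Qed.

Lemma chom_eqm N x y : eqm F N x y -> eqm H N (h x) (h y).
Proof. by rewrite /eqm -chomB; apply: chom_fil. Qed.

Lemma chom_exp x ex : is_exp F x ex -> is_exp H (h x) (h ex).
Proof.
move=> xe N; apply: eqm_trans (chom_eqm (xe N)) (eqm_eq _ _ _).
by rewrite chom_sum; apply: eq_bigr => n _; rewrite chomZ chomX.
Qed.

Lemma chom_Lev f x y z :
  Lev F (fun u => x * u) (fun u => y * u) 1 f z ->
  Lev H (fun u => h x * u) (fun u => h y * u) 1 f (h z).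
Proof.
move=> fz N; apply: eqm_trans (chom_eqm (fz N)) (eqm_eq _ _ _).
rewrite chom_sum; apply: eq_bigr => i _; rewrite chom_sum; apply: eq_bigr => j _.
by rewrite chomZ !monom_mul (chomM Ch) !chomX.
Qed.

End ChomTheory.

Lemma chom_comp (A B C : algType rat) (F : filtration A) (H : filtration B)
    (K : filtration C) (g : B -> C) (h : A -> B) :
  chom F H h -> chom H K g -> chom F K (g \o h).
Proof.
move=> Ch Cg; split=> /= [c x y||x y|N x Fx].
- by rewrite /= (chom_linear Ch) (chom_linear Cg).
- by rewrite /= (chom1 Ch) (chom1 Cg).
- by rewrite /= (chomM Ch) (chomM Cg).
- exact/(chom_fil Cg)/(chom_fil Ch).
Qed.

(** * Substitution in commuting power series *)

Lemma coef2_monom i j k l :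
  (varA ^+ i * varB ^+ j) k l = ((k == i) && (l == j))%:R.
Proof.
elim: i k => [|i IHi] k.
  rewrite mul1r; elim: j l => [|j IHj] l; first exact: coef2_1.
  by rewrite exprS coef2_varBM; case: l => [|l]; rewrite ?andbF // IHj.
by rewrite exprS -mulrA coef2_varAM; case: k => [|k] //; rewrite IHi.
Qed.

Lemma Lev_id f : Lev fil2 (fun z => varA * z) (fun z => varB * z) 1 f f.
Proof.
move=> N; apply/eqm2P => k l lt_kl.
have [lt_k lt_l] : (k < N)%N /\ (l < N)%N.
  by split; apply: leq_ltn_trans lt_kl; rewrite ?leq_addr ?leq_addl.
rewrite coef2_sum (bigD1 (Ordinal lt_k)) //= coef2_sum (bigD1 (Ordinal lt_l)) //=.
rewrite monom_mul ?coef2Z coef2_monom !eqxx mulr1 !big1 ?addr0 // => [i ne|j ne].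
  rewrite coef2_sum big1 // => j _; rewrite monom_mul ?coef2Z coef2_monom.
  by rewrite eq_sym [_ == _](negPf ne) mulr0.
by rewrite monom_mul ?coef2Z coef2_monom eqxx eq_sym [_ == _](negPf ne) mulr0.
Qed.

Lemma subst2_id f : subst2 f varA varB = f.
Proof.
exact: Lev_uniq (Lev_subst2 f fil2_varA fil2_varB) (Lev_id f).
Qed.

Section Subst2.
Variables (p q : fps2) (Fp : fil2 1 p) (Fq : fil2 1 q).
Notation L := (Lev fil2 (fun z => p * z) (fun z => q * z) 1).
Let Rp := raising_mull Fp.
Let Rq := raising_mull Fq.
Let Ls f := Lev_subst2 f Fp Fq.

Let LA f z : L f z -> L (varA * f) (p * z).
Proof. exact: Lev_varA. Qed.
Let LB f z : L f z -> L (varB * f) (q * z).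
Proof.
by apply: Lev_varB => // i j; rewrite !monom_mul exprS mulrCA.
Qed.

Let LAX i f z : L f z -> L (varA ^+ i * f) (p ^+ i * z).
Proof.
move=> fz; elim: i => [|i IHi]; first by rewrite expr0 mul1r expr0 mul1r.
by rewrite exprS -mulrA exprS -mulrA; apply: LA.
Qed.
Let LBX j f z : L f z -> L (varB ^+ j * f) (q ^+ j * z).
Proof.
move=> fz; elim: j => [|j IHj]; first by rewrite expr0 mul1r expr0 mul1r.
by rewrite exprS -mulrA exprS -mulrA; apply: LB.
Qed.

Lemma chom_subst2 : chom fil2 fil2 (fun f => subst2 f p q).
Proof.
split=> [c f g||f g|N f].
- by apply: Lev_uniq (Ls _) _; apply/LevD/Ls/LevZ/Ls.
- exact: Lev_uniq (Ls _) (Lev1 _ _ _ _).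
- apply: Lev_uniq (Ls _) _; apply: Lev_lim => N.
  exists (\sum_(i < N) \sum_(j < N) f i j *: (varA ^+ i * varB ^+ j * g)).
  exists (\sum_(i < N) \sum_(j < N) f i j *: (p ^+ i * q ^+ j * subst2 g p q)).
  split.
  + apply: Lev_sum => i _; apply: Lev_sum => j _; apply: LevZ.
    have E1 : varA ^+ i * (varB ^+ j * g) = varA ^+ i * varB ^+ j * g by rewrite mulrA.
    have E2 : p ^+ i * (q ^+ j * subst2 g p q) = p ^+ i * q ^+ j * subst2 g p q.
      by rewrite mulrA.
    by apply: (Lev_cast E1 E2); apply: LAX; apply: LBX; exact: Ls.
  + apply: eqm_trans (eqmM (@Lev_id f N) (eqm_eq _ _ (erefl g))) (eqm_eq _ _ _).
    rewrite mulr_suml; apply: eq_bigr => i _; rewrite mulr_suml; apply: eq_bigr => j _.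
    by rewrite -scalerAl monom_mul.
  + apply: eqm_trans (eqmM (@Ls f N) (eqm_eq _ _ (erefl _))) (eqm_eq _ _ _).
    rewrite mulr_suml; apply: eq_bigr => i _; rewrite mulr_suml; apply: eq_bigr => j _.
    by rewrite -scalerAl monom_mul.
- by move=> fN; apply: (Lev_fil Rp Rq (@Ls f) fN).
Qed.

Lemma subst2_varA : subst2 varA p q = p.
Proof.
apply: Lev_uniq (Ls _) _; rewrite -[X in L X]mulr1 -[X in L _ X]mulr1.
by apply: LA; apply: Lev1.
Qed.

Lemma subst2_varB : subst2 varB p q = q.
Proof.
apply: Lev_uniq (Ls _) _; rewrite -[X in L X]mulr1 -[X in L _ X]mulr1.
by apply: LB; apply: Lev1.
Qed.

Lemma subst2_varC : subst2 varC p q = - (p + q).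
Proof.
by rewrite (chomN chom_subst2) (chomD chom_subst2) subst2_varA subst2_varB.
Qed.

Lemma subst2_exp2 r : fil2 1 r -> subst2 (exp2 r) p q = exp2 (subst2 r p q).
Proof.
move=> Fr; have Fs := chom_fil chom_subst2 Fr.
exact: is_sum_uniq (chom_exp chom_subst2 (is_exp_exp2 Fr)) (is_exp_exp2 Fs).
Qed.

Lemma subst2_subst2 f u v : fil2 1 u -> fil2 1 v ->
  subst2 (subst2 f u v) p q = subst2 f (subst2 u p q) (subst2 v p q).
Proof.
move=> Fu Fv; have [Fu' Fv'] := (chom_fil chom_subst2 Fu, chom_fil chom_subst2 Fv).
exact: Lev_uniq (chom_Lev chom_subst2 (Lev_subst2 f Fu Fv)) (Lev_subst2 f Fu' Fv').
Qed.

End Subst2.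

Lemma exp2D p q : fil2 1 p -> fil2 1 q -> exp2 (p + q) = exp2 p * exp2 q.
Proof.
move=> Fp Fq; apply: is_sum_uniq (is_exp_exp2 (filD Fp Fq)) _.
by apply: is_expD; rewrite /GRing.comm 1?mulrC //; apply: is_exp_exp2.
Qed.

Lemma exp2_0 : exp2 0 = 1.
Proof. exact: is_sum_uniq (is_exp_exp2 (fil0 _ _)) (is_exp0 _). Qed.

Lemma exp2N p : fil2 1 p -> exp2 p * exp2 (- p) = 1.
Proof. by move=> Fp; rewrite -exp2D ?subrr ?exp2_0 //; apply: filN. Qed.

(** * Substitution in noncommutative power series *)

Definition shift (G : Type) (x : G) (f : ncseries G) : ncseries G :=
  NCSeries (fun w => f (x :: w)).

Lemma ncM_nil (G : Type) (f g : ncseries G) : (f * g) [::] = f [::] * g [::].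
Proof. by rewrite [in LHS]/GRing.mul /= big_ord1. Qed.

Lemma shift_mul (G : Type) (x : G) (f g : ncseries G) :
  shift x (f * g) = f [::] *: shift x g + shift x f * g.
Proof.
by apply: ncseriesP => w; rewrite [in LHS]/GRing.mul /= big_ord_recl.
Qed.

Lemma shift_linear (G : Type) (x : G) : linear (@shift G x).
Proof. by move=> c f g; apply: ncseriesP. Qed.

Lemma shift_fil (G : Type) (x : G) N (f : ncseries G) :
  ncfil N.+1 f -> ncfil N (shift x f).
Proof. by move=> fN w lt_w; apply: fN. Qed.

Lemma shift_letter (G : eqType) (x y : G) :
  shift x (letter y) = (x == y)%:R *: 1.
Proof.
apply: ncseriesP => w; rewrite /= eqseq_cons -mulnb natrM.
by case: w => [|z w] //=; rewrite !mulr0.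
Qed.

Section WordSum.
Variables (G : finType) (A : algType rat) (F : filtration A) (h : G -> A).
Hypothesis Fh : forall x, F 1 (h x).
Implicit Types f g : ncseries G.

(** Horner form of the sum over the words of length less than [N]: stripping first letters allows
    induction, and [wtr_tuple] recovers the sum over words. The target is any filtered algebra, so
    that substitution and abelianization are both instances. *)
Fixpoint wtr N f : A :=
  if N is N'.+1 then f [::] *: 1 + \sum_x h x * wtr N' (shift x f) else 0.

Definition is_wsum f z := forall N, eqm F N z (wtr N f).

Lemma wtrS N f :
  wtr N.+1 f = f [::] *: 1 + \sum_x h x * wtr N (shift x f).
Proof. by []. Qed.

Lemma wtr_linear N : linear (wtr N).
Proof.
elim: N => [|N IHN] c f g /=; first by rewrite scaler0 addr0.
rewrite scalerDl scalerDr -scalerA addrACA; congr (_ + _).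
rewrite scaler_sumr -big_split /=; apply: eq_bigr => x _.
by rewrite shift_linear IHN mulrDr scalerAr.
Qed.

Lemma wtr0 N : wtr N 0 = 0.
Proof.
by have := wtr_linear N (-1) 0 0; rewrite scaler0 addr0 scaleN1r addNr.
Qed.

Lemma wtr_widen N f : eqm F N (wtr N f) (wtr N.+1 f).
Proof.
elim: N f => [|N IHN] f; first exact: fil_all.
apply: eqmD; first exact: eqm_eq.
apply: eqm_sum => x _; rewrite /eqm -mulrBr -add1n.
by apply: filM; [apply: Fh | apply: IHN].
Qed.

Lemma wtr_fil M N f : ncfil M f -> F M (wtr N f).
Proof.
elim: N M f => [|N IHN] M f fM; first exact: fil0.
case: M => [|M] in fM *; first exact: fil_all.
rewrite /= fM // scale0r add0r; apply: fil_sum => x _; rewrite -add1n.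
by apply: filM; [apply: Fh | apply/IHN/shift_fil].
Qed.

(** Only a congruence: the product of two truncations also contains words of length [N] and more. *)
Lemma wtr_mul N f g : eqm F N (wtr N (f * g)) (wtr N f * wtr N g).
Proof.
elim: N f => [|N IHN] f; first exact: fil_all.
rewrite !wtrS ncM_nil; under eq_bigr do rewrite shift_mul wtr_linear mulrDr -scalerAr.
rewrite big_split /= addrA -scaler_sumr -scalerA -scalerDr.
rewrite mulrDl -scalerAl mul1r; apply: eqmD; first exact: eqm_eq.
rewrite mulr_suml; apply: eqm_sum => x _; rewrite -mulrA /eqm -mulrBr -add1n.
apply: filM; first exact: Fh.
apply: eqm_trans (IHN _) _; apply: eqmM; first exact: eqm_eq.
exact: wtr_widen.
Qed.

Lemma wtr1 N : (0 < N)%N -> wtr N 1 = 1.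
Proof.
case: N => // N _ /=; rewrite scale1r big1 ?addr0 // => x _.
have -> : shift x 1 = 0 :> ncseries G by apply: ncseriesP.
by rewrite wtr0 mulr0.
Qed.

Lemma wtr_widen_le N K f : (N <= K)%N -> eqm F N (wtr N f) (wtr K f).
Proof.
move=> le_NK; rewrite -(subnKC le_NK); elim: (K - N)%N => [|k IHk].
  by rewrite addn0; apply: eqm_eq.
rewrite addnS; apply: eqm_trans IHk _.
by apply: eqm_le (wtr_widen _ _); apply: leq_addr.
Qed.

Lemma wtr_tuple N f : wtr N f =
  \sum_(n < N) \sum_(w : n.-tuple G) f w *: \prod_(x <- w) h x.
Proof.
elim: N f => [|N IHN] f; first by rewrite big_ord0.
rewrite wtrS big_ord_recl; congr (_ + _).
  rewrite (big_pred1 [tuple]) ?big_nil // => w.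
  exact/esym/eqP/tuple0.
under eq_bigr do rewrite IHN mulr_sumr.
rewrite exchange_big; apply: eq_bigr => n _.
under eq_bigr do rewrite mulr_sumr.
rewrite pair_big /=.
pose cons_t (p : G * n.-tuple G) : n.+1.-tuple G := [tuple of p.1 :: p.2].
pose uncons_t (w : n.+1.-tuple G) := (thead w, [tuple of behead w]).
rewrite [RHS](reindex cons_t) /=; last first.
  exists uncons_t => [[x w] _|w _]; last by rewrite /cons_t /= -tuple_eta.
  by rewrite /uncons_t /= theadE; congr (_, _); apply: val_inj.
by apply: eq_bigr => -[x w] _ /=; rewrite big_cons -scalerAr.
Qed.

Section WordSumMap.
Variables (H : ncseries G -> A) (HP : forall f, is_wsum f (H f)).

Lemma chom_wsum : chom ncfil F H.
Proof.
split=> [c f g||f g|N f fN].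
- apply: eqm_sep => N; apply: eqm_trans (HP _ N) _; rewrite wtr_linear.
  by apply: eqm_sym; apply: eqmD; [apply: eqmZ|]; apply: HP.
- apply: eqm_sep => -[|N]; first exact: fil_all.
  by apply: eqm_trans (HP _ _) _; apply: eqm_eq; rewrite wtr1.
- apply: eqm_sep => N; apply: eqm_trans (HP _ N) _; apply: eqm_trans (wtr_mul _ _ _) _.
  by apply: eqm_sym; apply: eqmM; apply: HP.
- by apply: eqm_fil (HP f N) _; apply: wtr_fil.
Qed.

Lemma wsum_letter x : H (letter x) = h x.
Proof.
apply: eqm_sep => -[|[|N]]; first exact: fil_all.
  apply: filB; last exact: Fh.
  by apply: (chom_fil chom_wsum); apply/ncfil1P.
apply: eqm_trans (HP _ _) _; apply: eqm_eq; rewrite wtrS [letter x [::]]/= scale0r.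
rewrite add0r (bigD1 x) // big1 => [|y ne_yx].
  by rewrite shift_letter eqxx scale1r wtr1 ?mulr1 //; apply: addr0.
rewrite shift_letter [y == x](negPf ne_yx) scale0r.
by rewrite wtr0 mulr0.
Qed.

End WordSumMap.

End WordSum.

Lemma is_wsum_nc_subst (G : finType) (H : Type) (h : G -> ncseries H) f :
  (forall x, ncfil 1 (h x)) -> is_wsum ncfil h f (nc_subst h f).
Proof.
move=> Fh N; apply/eqm_ncP => v lt_v.
have /eqm_ncP<- := wtr_widen_le Fh f lt_v; rewrite ?ltnSn //.
rewrite wtr_tuple nc_sumE; apply: eq_bigr => n _; rewrite nc_sumE.
by apply: eq_bigr.
Qed.

Lemma chom_nc_subst (G : finType) (H : Type) (h : G -> ncseries H) :
  (forall x, ncfil 1 (h x)) -> chom ncfil ncfil (nc_subst h).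
Proof. by move=> Fh; apply: (chom_wsum Fh) => f; apply: is_wsum_nc_subst. Qed.

Lemma nc_subst_letter (G : finType) (H : Type) (h : G -> ncseries H) x :
  (forall x, ncfil 1 (h x)) -> nc_subst h (letter x) = h x.
Proof. by move=> Fh; apply: (wsum_letter Fh) => f; apply: is_wsum_nc_subst. Qed.

Lemma mk2E (M : nat -> nat -> rat) i j : mk2 M i j = M i j.
Proof. by []. Qed.

Section Abelianize.
Variables (G : finType) (v : G -> fps2).
Hypothesis Fv : forall x, fil2 1 (v x).

Definition abel (f : ncseries G) : fps2 := mk2 (fun k l => wtr v (k + l).+1 f k l).

Lemma is_wsum_abel f : is_wsum fil2 v f (abel f).
Proof.
move=> N; apply/eqm2P => k l lt_kl.
have /eqm2P E := wtr_widen_le Fv f lt_kl.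
by rewrite /abel mk2E E.
Qed.

Lemma chom_abel : chom ncfil fil2 abel.
Proof. by apply: (chom_wsum Fv) => f; apply: is_wsum_abel. Qed.

Lemma abel_letter x : abel (letter x) = v x.
Proof. by apply: (wsum_letter Fv) => f; apply: is_wsum_abel. Qed.

End Abelianize.

(** * The quotient by the ideal 2FF *)

Lemma smallest_closed_ideal (G : Type) (S : set (ncseries G)) :
  closed_ideal (smallest (@closed_ideal G) S).
Proof.
split=> [J [[]]//|f g If Ig J JS|f g Ig J JS|f g If J JS|f If J JS].
- by case: (JS) => -[_ JD _ _ _] _; apply: JD; [apply: If|apply: Ig].
- by case: (JS) => -[_ _ Jl _ _] _; apply: Jl; apply: Ig.
- by case: (JS) => -[_ _ _ Jr _] _; apply: (Jr); apply: If.
- case: (JS) => -[_ _ _ _ Jc] _; apply: Jc => N.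
  by have [g Ig fg] := If N; exists g => //; apply: Ig.
Qed.

Section ChordQuotient.
Variable n : nat.

Definition rel2FF : set (freeA n) := (chord_rel n `|` gen_2FF n)%classic.
Definition ideal2FF : {pred freeA n} :=
  fun f => `[< smallest (@closed_ideal _) rel2FF f >].

Lemma ideal2FF_closed : closed_ideal (fun f => f \in ideal2FF).
Proof.
have [I0 ID Il Ir Ic] := smallest_closed_ideal rel2FF.
split=> [|f g /asboolP If /asboolP Ig|f g /asboolP Ig|f g /asboolP If|f If].
- exact/asboolP.
- by apply/asboolP; apply: ID.
- by apply/asboolP; apply: Il.
- by apply/asboolP; apply: Ir.
- by apply/asboolP; apply: Ic => N; have [g /asboolP Ig fg] := If N; exists g.
Qed.

Lemma ideal2FF_zmod : zmod_closed ideal2FF.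
Proof.
have [I0 ID Il _ _] := ideal2FF_closed; split=> // f g If Ig.
by apply: ID => //; rewrite -mulN1r; apply: Il.
Qed.
HB.instance Definition _ := GRing.isZmodClosed.Build (freeA n) ideal2FF ideal2FF_zmod.

Lemma ideal2FF_sub (J : set (freeA n)) : closed_ideal J ->
  (forall f, rel2FF f -> J f) -> forall f, f \in ideal2FF -> J f.
Proof. by move=> cJ JS f /asboolP; apply. Qed.

Lemma t_fil i j : @ncfil (chord n) 1 (t i j).
Proof. by apply: fil_sum => c _; apply/ncfil1P. Qed.

Lemma bracket_fil (f g : freeA n) :
  ncfil 1 f -> ncfil 1 g -> ncfil 2 (bracket f g).
Proof. by move=> Ff Fg; apply: filB; apply: (@filM _ ncfil 1 1). Qed.

(** All generators start in degree two. Hence the quotient is nonzero and congruent series have the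
    same constant and linear terms. *)
Lemma ideal2FF_fil f : f \in ideal2FF -> ncfil 2 f.
Proof.
apply: ideal2FF_sub => [|{}f].
  split=> [|g h|g h|g h|g Ig]; try by [exact: fil0|exact: filD|exact: filMl|exact: filMr].
  by move=> w lt_w; have [h Fh ->] := Ig 2%N; [apply: Fh|apply: ltnW].
case=> [[[i [j [k [_ ->]]]]|[i [j [k [l [_ ->]]]]]]|[w [x [y [le_w ->]]]]].
- by apply: bracket_fil; rewrite ?filD //; do ?apply: filD; apply: t_fil.
- by apply: bracket_fil; apply: t_fil.
apply: (fil_le le_w); apply: filMr; elim: w {le_w} => [|c w IHw].
  exact: fil_all.
by rewrite big_cons; apply: (@filM _ ncfil 1) => //; apply/ncfil1P.
Qed.

Definition chordQ := Quotient.quot ideal2FF.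
HB.instance Definition _ := GRing.Zmodule.on chordQ.

Definition pr (f : freeA n) : chordQ := (\pi_(Quotient.quot ideal2FF) f)%qT.

Lemma prP f g : pr f = pr g <-> f - g \in ideal2FF.
Proof. by rewrite Quotient.idealrBE; split=> [/eqP|/eqP]. Qed.

Lemma eq2FFP f g : eq2FF f g <-> pr f = pr g.
Proof. by rewrite prP; split=> [If|/asboolP//]; apply/asboolP. Qed.

Lemma pr_repr x : pr (repr x) = x.
Proof. exact: reprK. Qed.

Lemma prD f g : pr (f + g) = pr f + pr g.
Proof. by rewrite /pr Quotient.pi_add. Qed.

Lemma pr0 : pr 0 = 0.
Proof. by apply: (addrI (pr 0)); rewrite -prD !addr0. Qed.

(** [Quotient.quot] supplies the additive group; product and scaling go through representatives, and
    [prM] and [prZ] show that their choice does not matter. *)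
Definition qmul (x y : chordQ) : chordQ := pr (repr x * repr y).
Definition qone : chordQ := pr 1.
Definition qscale (c : rat) (x : chordQ) : chordQ := pr (c *: repr x).

Lemma prM f g : pr (f * g) = qmul (pr f) (pr g).
Proof.
have [_ ID Il Ir _] := ideal2FF_closed.
have := pr_repr (pr f); have := pr_repr (pr g); rewrite /qmul.
move: (repr (pr f)) (repr (pr g)) => f' g' /prP gg /prP ff; apply/esym/prP.
have -> : f' * g' - f * g = (f' - f) * g' + f * (g' - g) by non_commutative_ring.
by apply: ID; [apply: Ir|apply: Il].
Qed.

Lemma prZ c f : pr (c *: f) = qscale c (pr f).
Proof.
have [_ ID Il Ir _] := ideal2FF_closed.
have := pr_repr (pr f); rewrite /qscale; move: (repr (pr f)) => f' /prP ff.
by apply/esym/prP; rewrite -scalerBr -[_ - _]mul1r scalerAl; apply: Il.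
Qed.

Fact qmulA : associative qmul.
Proof. by move=> x y z; rewrite -[x]pr_repr -[y]pr_repr -[z]pr_repr -!prM mulrA. Qed.
Fact qmul1l : left_id qone qmul.
Proof. by move=> x; rewrite -[x]pr_repr -prM mul1r. Qed.
Fact qmul1r : right_id qone qmul.
Proof. by move=> x; rewrite -[x]pr_repr -prM mulr1. Qed.
Fact qmulDl : left_distributive qmul +%R.
Proof.
by move=> x y z; rewrite -[x]pr_repr -[y]pr_repr -[z]pr_repr -!(prM, prD) mulrDl.
Qed.
Fact qmulDr : right_distributive qmul +%R.
Proof.
by move=> x y z; rewrite -[x]pr_repr -[y]pr_repr -[z]pr_repr -!(prM, prD) mulrDr.
Qed.
Fact qone_neq0 : qone != 0.
Proof.
apply/eqP; rewrite -[0](pr_repr 0) => /prP/ideal2FF_fil F1.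
have /prP/ideal2FF_fil F0 : pr (repr (0 : chordQ)) = pr 0.
  by rewrite pr_repr pr0.
have /(_ [::] isT) : @ncfil (chord n) 2 1.
  by rewrite -[X in ncfil 2 X](subrK (repr (0 : chordQ))); apply: filD => //; rewrite -[repr _]subr0.
by move/eqP; rewrite oner_eq0.
Qed.

HB.instance Definition _ := GRing.Zmodule_isNzRing.Build chordQ
  qmulA qmul1l qmul1r qmulDl qmulDr qone_neq0.

Fact qscaleA c d x : qscale c (qscale d x) = qscale (c * d) x.
Proof. by rewrite -[x]pr_repr -!prZ scalerA. Qed.
Fact qscale1 : left_id 1 qscale.
Proof. by move=> x; rewrite -[x]pr_repr -!prZ scale1r. Qed.
Fact qscaleDr : right_distributive qscale +%R.
Proof.
by move=> c x y; rewrite -[x]pr_repr -[y]pr_repr -!(prD, prZ) scalerDr.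
Qed.
Fact qscaleDl x : {morph qscale^~ x : c d / c + d}.
Proof. by move=> c d; rewrite -[x]pr_repr -!(prD, prZ) scalerDl. Qed.
HB.instance Definition _ := GRing.Zmodule_isLmodule.Build rat chordQ
  qscaleA qscale1 qscaleDr qscaleDl.

Fact qscaleAl (c : rat) (x y : chordQ) : c *: (x * y) = (c *: x) * y.
Proof.
rewrite -[LHS]/(qscale c (qmul x y)) -[RHS]/(qmul (qscale c x) y).
by rewrite -[x]pr_repr -[y]pr_repr -!(prM, prZ) -scalerAl.
Qed.
HB.instance Definition _ := GRing.Lmodule_isLalgebra.Build rat chordQ qscaleAl.

Fact qscaleAr (c : rat) (x y : chordQ) : c *: (x * y) = x * (c *: y).
Proof.
rewrite -[LHS]/(qscale c (qmul x y)) -[RHS]/(qmul x (qscale c y)).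
by rewrite -[x]pr_repr -[y]pr_repr -!(prM, prZ) -scalerAr.
Qed.
HB.instance Definition _ := GRing.Lalgebra_isAlgebra.Build rat chordQ qscaleAr.

Definition qfil : filtration chordQ.
Proof.
apply: (@Filtration chordQ (fun N x => exists2 f, ncfil N f & x = pr f)).
- by move=> x; exists (repr x); [apply: fil_all|rewrite pr_repr].
- move=> N; exists 0; first exact: fil0.
  by rewrite pr0.
- by move=> N _ _ [f Ff ->] [g Fg ->]; exists (f + g); [apply: filD|rewrite prD].
- by move=> N c _ [f Ff ->]; exists (c *: f); [apply: filZ|rewrite prZ].
- by move=> M N _ _ [f Ff ->] [g Fg ->]; exists (f * g); [apply: filM|rewrite prM].
- by move=> M N _ le_MN [f Ff ->]; exists f => //; apply: fil_le Ff.
(* The representative of a class lying in every step is approximated by the ideal to every order, so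
   closedness puts it in the ideal. *)
- move=> x Fx; have [_ _ _ _ Ic] := ideal2FF_closed.
  have <- : pr 0 = 0 by rewrite pr0.
  rewrite -[x]pr_repr; apply/prP; rewrite subr0; apply: Ic => N.
  have [g Fg] := Fx N.+1; rewrite -[x]pr_repr => /prP Ig.
  exists (repr x - g); first by [].
  by move=> w le_w; rewrite pr_repr -[RHS]/(repr x w - g w) Fg ?subr0.
Defined.

Lemma chom_pr : chom ncfil qfil pr.
Proof.
split=> [c f g||f g|N f Ff]; first by rewrite prD prZ.
- by [].
- by rewrite prM.
- by exists f.
Qed.

End ChordQuotient.
Arguments ideal2FF : clear implicits.

(** * Calculus modulo 2FF *)

Section TwoFF.
Variables (A : algType rat) (F : filtration A).
Hypothesis F2comm : forall u x y, F 2 u -> u * (x * y) = u * (y * x).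
Implicit Types (u w x y z : A).

(* [T x] is minus the adjoint action of [x]. *)
Definition T x w := w * x - x * w.

(* Modulo 2FF this class contains the commutators. *)
Definition C w := F 2 w /\ forall u, F 2 u -> u * w = 0.

Lemma F1M x y : F 1 x -> F 1 y -> F 2 (x * y).
Proof. exact: (@filM _ F 1 1). Qed.

Lemma raising_T x : F 1 x -> raising F (T x).
Proof.
move=> Fx; split=> [c u v|N u Fu].
  by rewrite /T mulrDl mulrDr scalerBr -scalerAl -scalerAr opprD addrACA.
by apply: filB; [rewrite -addn1|rewrite -add1n]; apply: filM.
Qed.

Lemma TDl x y w : T (x + y) w = T x w + T y w.
Proof. by rewrite /T; non_commutative_ring. Qed.
Lemma TDr x w z : T x (w + z) = T x w + T x z.
Proof. by rewrite /T; non_commutative_ring. Qed.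
Lemma TNr x w : T x (- w) = - T x w.
Proof. by rewrite /T; non_commutative_ring. Qed.

Lemma C_T x w : C w -> C (T x w).
Proof.
case=> Fw w0; split; first by apply: filB; [apply: filMr|apply: filMl].
move=> u Fu; rewrite mulrBr !mulrA w0 // mul0r sub0r w0 ?oppr0 //.
exact: filMr.
Qed.

Lemma C0 : C 0.
Proof. by split=> [|u _]; [apply: fil0|rewrite mulr0]. Qed.
Lemma CD w z : C w -> C z -> C (w + z).
Proof.
move=> [Fw w0] [Fz z0]; split=> [|u Fu]; first exact: filD.
by rewrite mulrDr w0 ?z0 ?addr0.
Qed.
Lemma CZ c w : C w -> C (c *: w).
Proof.
move=> [Fw w0]; split=> [|u Fu]; first exact: filZ.
by rewrite -scalerAr w0 ?scaler0.
Qed.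
Lemma CN w : C w -> C (- w).
Proof. by rewrite -scaleN1r; apply: CZ. Qed.
Lemma CB w z : C w -> C z -> C (w - z).
Proof. by move=> ? ?; apply/CD/CN. Qed.
Lemma C_sum I (r : seq I) (P : pred I) (M : I -> A) :
  (forall i, P i -> C (M i)) -> C (\sum_(i <- r | P i) M i).
Proof. by move=> CM; elim/big_ind: _ => //; [apply: C0|apply: CD]. Qed.

Lemma C_lim z : (forall N, exists2 y, C y & eqm F N z y) -> C z.
Proof.
move=> lim; split=> [|u Fu].
  by have [y [Fy _] zy] := lim 2%N; apply: eqm_fil zy Fy.
apply: (eqm_sep (F := F)) => N; have [y [_ y0] zy] := lim N.
by apply: eqm_trans (eqmM (eqm_eq F N (erefl u)) zy) (eqm_eq _ _ (y0 _ _)).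
Qed.

Lemma C_bracket x y : F 1 x -> F 1 y -> C (bracket x y).
Proof.
move=> Fx Fy; split=> [|u Fu]; first by apply: filB; apply: F1M.
by rewrite mulrBr F2comm // subrr.
Qed.

Lemma C_iter n x w : C w -> C (iter n (T x) w).
Proof. by move=> Cw; elim: n => //= n IHn; apply: C_T. Qed.

(** The two sides differ by [w (y x - x y)], zero because [w] has degree two, and by terms with two
    letters on the left of [w], zero because [w] lies in [C]. *)
Lemma T_comm x y w : F 1 x -> F 1 y -> C w -> T x (T y w) = T y (T x w).
Proof.
move=> Fx Fy [Fw w0]; rewrite /T; have wxy := F2comm x y Fw.
have [xyw yxw] : x * (y * w) = 0 /\ y * (x * w) = 0.
  by rewrite !mulrA !w0 //; apply: F1M.
have -> : (w * y - y * w) * x - x * (w * y - y * w)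
    = w * (y * x) - y * w * x - x * w * y + x * (y * w) by non_commutative_ring.
have -> : (w * x - x * w) * y - y * (w * x - x * w)
    = w * (x * y) - x * w * y - y * w * x + y * (x * w) by non_commutative_ring.
by rewrite xyw yxw wxy; non_commutative_ring.
Qed.

Lemma monom_T_comm x y w i j : F 1 x -> F 1 y -> C w ->
  T y (monom (T x) (T y) w i j) = monom (T x) (T y) w i j.+1.
Proof.
move=> Fx Fy Cw; elim: i => [//|i IHi]; rewrite /monom !iterS.
rewrite T_comm //; last exact/C_iter/C_iter.
by congr (T x _); apply: IHi.
Qed.

(** Each application multiplies by [x] on the right or by [- x] on the left, and the second can be
    chosen at most once. *)
Lemma iter_T x w n : F 1 x -> C w ->
  iter n (T x) w = w * x ^+ n - (x * w * x ^+ n.-1) *+ n.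
Proof.
move=> Fx [Fw w0]; elim: n => [|n IHn]; first by rewrite mulr1 mulr0n subr0.
have xxw v : x * (x * w * v) = 0.
  by rewrite !mulrA w0 ?mul0r //; apply: F1M.
rewrite iterS IHn /T mulrBl mulrBr mulrnAl mulrnAr xxw mul0rn subr0.
rewrite -(mulrA w) -exprSr mulrA; case: n {IHn} => [|n].
  by rewrite !mulr0n subr0 mulr1n.
by rewrite -(mulrA (x * w)) -exprSr -addrA -opprD -mulrSr.
Qed.

(** The limit is [exp(-x) w exp(x)], whose left factor reduces to [1 - x] because degree two
    annihilates [w]. *)
Lemma is_sum_exp_T x ex w : F 1 x -> C w -> is_exp F x ex ->
  is_sum F (fun n => (n`!%:R)^-1 *: iter n (T x) w) (w * ex - x * w * ex).
Proof.
move=> Fx Cw xe [|N]; first exact: fil_all.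
under eq_bigr do rewrite iter_T // scalerBr.
rewrite sumrB; apply: eqmB.
  apply: eqm_trans (eqmM (eqm_eq F _ (erefl w)) (xe _)) (eqm_eq _ _ _).
  by rewrite mulr_sumr; apply: eq_bigr => n _; rewrite scalerAr.
rewrite big_ord_recl mulr0n scaler0 add0r.
have Fxw : F 1 (x * w) by apply: filMr.
apply: (@eqm_trans _ F _ (x * w * \sum_(n < N) (n`!%:R)^-1 *: x ^+ n)).
  by rewrite /eqm -mulrBr -add1n; apply: filM => //; apply: xe.
apply: eqm_eq; rewrite mulr_sumr; apply: eq_bigr => n _.
rewrite /= -scaler_nat scalerA -scalerAr /bump leq0n add1n factS natrM invfM.
by rewrite [in RHS]mulrAC mulVf ?mul1r // Num.Theory.pnatr_eq0.
Qed.

Section LevT.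
Variables (x y w : A).
Hypotheses (Fx : F 1 x) (Fy : F 1 y) (Cw : C w).
Notation L := (Lev F (T x) (T y) w).
Let RX := raising_T Fx.
Let RY := raising_T Fy.

Lemma LevT_C f z : L f z -> C z.
Proof.
move=> fz; apply: C_lim => N; eexists; last exact: fz.
by apply: C_sum => i _; apply: C_sum => j _; apply/CZ/C_iter/C_iter.
Qed.

Lemma LevT_varA f z : L f z -> L (varA * f) (T x z).
Proof. exact: Lev_varA. Qed.

Lemma LevT_varB f z : L f z -> L (varB * f) (T y z).
Proof. by apply: Lev_varB => // i j; apply: monom_T_comm. Qed.

Lemma LevT_AB f z : L f z -> L ((varA + varB) * f) (T (x + y) z).
Proof.
move=> fz; apply: (Lev_cast (esym (mulrDl varA varB f)) (esym (TDl x y z))).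
by apply: LevD; [apply: LevT_varA|apply: LevT_varB].
Qed.

Lemma LevT_exp p u eu : fil2 1 p -> F 1 u -> is_exp F u eu ->
  (forall g z, L g z -> L (p * g) (T u z)) ->
  forall f z, L f z -> L (exp2 p * f) (z * eu - u * z * eu).
Proof.
move=> Fp Fu ue Hp f z fz; apply: Lev_lim => N.
exists (\sum_(n < N) ((n`!)%:R)^-1 *: (p ^+ n * f)).
exists (\sum_(n < N) ((n`!)%:R)^-1 *: iter n (T u) z); split.
- apply: Lev_sum => n _; apply: LevZ; elim: (nat_of_ord n) => [|k IHk].
    by rewrite expr0 mul1r.
  by rewrite exprS -mulrA iterS; apply: Hp.
- apply: eqm_trans (eqmM (@is_exp_exp2 p Fp N) (eqm_eq _ _ (erefl f))) (eqm_eq _ _ _).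
  by rewrite mulr_suml; apply: eq_bigr => n _; rewrite -scalerAl.
- exact: (is_sum_exp_T Fu (LevT_C fz) ue).
Qed.

End LevT.

Lemma monom_TE x y w i j : F 1 x -> F 1 y -> C w ->
  monom (T x) (T y) w i j = w * (x ^+ i * y ^+ j)
    - (x * w * (x ^+ i.-1 * y ^+ j)) *+ i - (y * w * (x ^+ i * y ^+ j.-1)) *+ j.
Proof.
move=> Fx Fy Cw; rewrite /monom iter_T //; last exact: C_iter.
have [Fw w0] := Cw; rewrite iter_T //.
rewrite !mulrBr !mulrBl mulrnAl mulrnAr mulrnAl.
have -> : x * (y * w * y ^+ j.-1) = 0.
  by rewrite !mulrA w0 ?mul0r //; apply: F1M.
rewrite mul0r mul0rn subr0 -!mulrA (F2comm _ _ Fw).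
rewrite ![x * (w * _)]mulrA ![y * (w * _)]mulrA.
have Fxw : F 2 (x * w) by apply: filMl.
have Fyw : F 2 (y * w) by apply: filMl.
by rewrite (F2comm (y ^+ j) _ Fxw) (F2comm (y ^+ j.-1) _ Fyw) addrAC.
Qed.

(* The derivatives appear when the letters [x] and [y] are moved to the left of
   [w], at most one of them surviving there. *)
Lemma LevT_derivative x y w f E0 E1 E2 : F 1 x -> F 1 y -> C w ->
  Lev F (fun z => x * z) (fun z => y * z) 1 f E0 ->
  Lev F (fun z => x * z) (fun z => y * z) 1 (derivA f) E1 ->
  Lev F (fun z => x * z) (fun z => y * z) 1 (Defs.derivB f) E2 ->
  Lev F (T x) (T y) w f (w * E0 - x * w * E1 - y * w * E2).
Proof.
move=> Fx Fy Cw f0 f1 f2 [|N]; first exact: fil_all.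
under eq_bigr do under eq_bigr do rewrite monom_TE // !scalerBr.
under eq_bigr do rewrite !sumrB.
rewrite !sumrB; apply: eqmB; first apply: eqmB.
- apply: eqm_trans (eqmM (eqm_eq F _ (erefl w)) (f0 _)) (eqm_eq _ _ _).
  rewrite mulr_sumr; apply: eq_bigr => i _; rewrite mulr_sumr; apply: eq_bigr => j _.
  by rewrite -scalerAr monom_mul.
- apply: eqm_trans (eqmM (eqm_eq F _ (erefl (x * w))) (f1 _)) _.
  (* On the right the term [i = 0] carries the factor 0; the other terms are those of the derivative
     without its top one, which has order [N + 1] once multiplied by [x * w]. *)
  rewrite big_ord_recr /= [X in eqm _ _ _ X]big_ord_recl /=.
  rewrite [X in eqm _ _ _ (X + _)]big1 => [|j _]; last by rewrite mulr0n scaler0.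
  rewrite mulrDr addrC; apply: eqmD.
    apply/eqm0; apply: (@filM _ F 1 N); first exact: filMr.
    apply: fil_sum => j _; apply/filZ; rewrite monom_mul; apply: filMr.
    exact: filX1.
  apply: eqm_eq; rewrite mulr_sumr; apply: eq_bigr => i _.
  rewrite mulr_sumr; apply: eq_bigr => j _.
  by rewrite monom_mul -scalerAr -scaler_nat scalerA.
- apply: eqm_trans (eqmM (eqm_eq F _ (erefl (y * w))) (f2 _)) _.
  rewrite mulr_sumr; apply: eqm_sum => i _.
  rewrite big_ord_recr /= [X in eqm _ _ _ X]big_ord_recl /= mulr0n scaler0 add0r.
  rewrite mulrDr -[X in eqm _ _ _ X]addr0; apply: eqmD.
    apply: eqm_eq; rewrite mulr_sumr; apply: eq_bigr => j _.
    by rewrite monom_mul -scalerAr -scaler_nat scalerA.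
  apply/eqm0; apply: (@filM _ F 1 N); first exact: filMr.
  by apply/filZ; rewrite monom_mul; apply/filMl/filX1.
Qed.

End TwoFF.

(** * The hexagon modulo 2FF *)

(** For [n >= 1] this is [(b^(n-1) - (a+b)^(n-1)) / a], given by a recursion without division that
    can be copied for the operators [T y] and [T (x + y)]. *)
Fixpoint dexp_poly (R : nzRingType) (a b : R) n : R :=
  if n is m.+1 then
    b * dexp_poly a b m - (if m is k.+1 then (a + b) ^+ k else 0)
  else 0.

Lemma mul_dexp_poly (R : comNzRingType) (a b : R) n :
  a * dexp_poly a b n.+1 = b ^+ n - (a + b) ^+ n.
Proof.
elim: n => [|n IHn]; first by rewrite /= mulr0 subr0 mulr0 !expr0 subrr.
rewrite -[dexp_poly a b n.+2]/(b * dexp_poly a b n.+1 - (a + b) ^+ n).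
by rewrite mulrBr mulrCA IHn !exprS; ring.
Qed.

Lemma mul3_dexp_poly (R : comNzRingType) (a b : R) n :
  a * b * (a + b) * dexp_poly a b n.+1 = (a + b) * b ^+ n.+1 - b * (a + b) ^+ n.+1.
Proof.
have -> : a * b * (a + b) * dexp_poly a b n.+1
  = b * (a + b) * (a * dexp_poly a b n.+1) by ring.
by rewrite mul_dexp_poly !exprS; ring.
Qed.

(** Cancelling [a], [b] and [a + b] costs one degree each, whence the bound [N + 3]. *)
Lemma sum_dexp_poly N (G : fps2) :
  varA * varB * (varA + varB) * G
    = (varA + varB) * exp2 varB - varB * exp2 (varA + varB) - varA ->
  eqm fil2 N G (\sum_(n < N.+3) ((n`!)%:R)^-1 *: dexp_poly varA varB n).
Proof.
move=> HG; set S := \sum_(n < _) _.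
pose E (u : fps2) := \sum_(n < N.+3) ((n`!)%:R)^-1 *: u ^+ n.
have HS : varA * varB * (varA + varB) * S
    = (varA + varB) * E varB - varB * E (varA + varB) - varA.
  have : forall (R : comAlgType rat) (a b : R),
      a * b * (a + b) * (\sum_(n < N.+3) ((n`!)%:R)^-1 *: dexp_poly a b n)
      = (a + b) * (\sum_(n < N.+3) ((n`!)%:R)^-1 *: b ^+ n)
       - b * (\sum_(n < N.+3) ((n`!)%:R)^-1 *: (a + b) ^+ n) - a.
    move=> R a b; rewrite ![\sum_(n < N.+3) _]big_ord_recl.
    rewrite (_ : dexp_poly a b _ = 0) // scaler0 add0r !expr0 fact0 invr1 !scale1r !mulrDr !mulr1 opprD.
    (* The constant terms of the two exponentials contribute [(a + b) - b], which is what the final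
       [- a] cancels. *)
    have -> (u v : R) : a + b + u + (- b + v) - a = u + v.
      by ring.
    rewrite !mulr_sumr -sumrB; apply: eq_bigr => n _.
    by rewrite lift0 -!scalerAr -scalerBr -(mulrDr (a * b)) mul3_dexp_poly.
  by move=> /(_ fps2); apply.
have : fil2 N.+3 (varA * varB * (varA + varB) * (G - S)).
  rewrite mulrBr HG HS.
  have : forall (R : comNzRingType) (t a b e1 e2 f1 f2 : R),
      t * e1 - b * e2 - a - (t * f1 - b * f2 - a) = t * (e1 - f1) - b * (e2 - f2).
    by move=> *; ring.
  move=> ->; apply: filB; apply: filMl.
    exact: is_exp_exp2 fil2_varB _.
  exact: is_exp_exp2 (filD fil2_varA fil2_varB) _.
rewrite -!mulrA => /fil2_divA/fil2_divB/fil2_divD; exact.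
Qed.

Section ExpMulTerm.
Variable A : algType rat.
Implicit Types x y : A.

Lemma exp_mul_termS x y n :
  exp_mul_term x y n.+1 = x * exp_mul_term x y n + exp_mul_term x y n * y.
Proof.
rewrite /exp_mul_term big_ord_recl bin0 mulr1n expr0 mul1r subn0.
under eq_bigr => i _ do rewrite lift0 binS mulrnDr subSS.
rewrite big_split /= addrA [RHS]addrC; congr (_ + _).
  rewrite mulr_suml [RHS]big_ord_recl bin0 mulr1n expr0 mul1r subn0 -exprSr.
  congr (_ + _); rewrite big_ord_recr /= bin_small // mulr0n addr0; apply: eq_bigr => i _.
  by rewrite /= /bump leq0n add1n mulrnAl -mulrA -exprSr subnSK.
by rewrite mulr_sumr; apply: eq_bigr => i _; rewrite mulrnAr mulrA -exprS.
Qed.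

End ExpMulTerm.

Section Hexagon.
Variables (A : algType rat) (F : filtration A).
Hypothesis F2comm : forall u x y : A, F 2 u -> u * (x * y) = u * (y * x).
Variables x y : A.
Hypotheses (Fx : F 1 x) (Fy : F 1 y).
Let t := x + y.
Let e := bracket x y.
Notation L := (Lev F (T x) (T y) e).

Let Ft : F 1 t. Proof. exact: filD. Qed.
Let Ce : C F e. Proof. exact: C_bracket. Qed.

(** [dexp_poly] in the operators [T y] and [T t], applied to [e]. Divided by [n!], these are the
    terms of the series [z] with [exp t - exp x exp y = z + t z]. *)
Fixpoint dexp_term n : A :=
  if n is m.+1 then
    T y (dexp_term m) - (if m is k.+1 then iter k (T t) e else 0)
  else 0.
Notation P := dexp_term.

Lemma dexp_termSS n : P n.+2 = T y (P n.+1) - iter n (T t) e.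
Proof. by []. Qed.

Let C_P n : C F (P n).
Proof.
elim: n => [|n IHn]; first exact: C0.
apply: CB; first exact: C_T.
by case: n {IHn} => [|n]; [apply: C0|apply: C_iter].
Qed.

Let fil_P n : F n (P n).
Proof.
have Fe : F 2 e by case: Ce.
elim: n => [|n IHn]; first exact: fil0.
apply: filB; first exact: (proj2 (raising_T Fy)).
case: n {IHn} => [|n]; first exact: fil0.
by have := proj2 (raising_iter (raising_T Ft) n) _ _ Fe; rewrite addn2.
Qed.

Lemma Lev_dexp_term n : L (dexp_poly varA varB n) (P n).
Proof.
elim: n => [|n IHn]; first exact: Lev0.
apply: LevB; first exact: LevT_varB.
case: n {IHn} => [|n]; first exact: Lev0.
elim: n => [|n IHn]; first exact: Lev1.
by rewrite exprS iterS; apply: LevT_AB.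
Qed.

(** The commutator of [t ^+ n.+1] with [y] is the sum of the products [t^i e t^(n-i)], of which only
    [i = 0] and [i = 1] survive. *)
Let comm_power n : t ^+ n.+1 * y = y * t ^+ n.+1 + e * t ^+ n
  + (if n is m.+1 then t * e * t ^+ m else 0).
Proof.
have ty : t * y = y * t + e by rewrite /t /e /bracket; non_commutative_ring.
have [Fe e0] := Ce.
elim: n => [|n IHn]; first by rewrite expr1 expr0 mulr1 addr0.
have tyu u : t * (y * u) = y * (t * u) + e * u by rewrite mulrA ty mulrDl mulrA.
have -> : t ^+ n.+2 * y = t * (t ^+ n.+1 * y) by rewrite exprS mulrA.
rewrite IHn 2!mulrDr tyu -exprS.
have -> : t * (if n is m.+1 then t * e * t ^+ m else 0) = 0.
  case: n {IHn} => [|n]; first by rewrite mulr0.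
  by rewrite !mulrA e0 ?mul0r //; apply: F1M.
by rewrite addr0 (mulrA t e).
Qed.

(** The multiplicity [n + 1] is what turns [t P_n / (n+1)!] into [t P_n / n!], so that the second
    summands add up to [t z]. *)
Lemma exp_defect n : t ^+ n.+1 - exp_mul_term x y n.+1
  = P n.+1 + (t * P n) *+ n.+1.
Proof.
have tt n' : t * (y * P n') = 0 /\ x * (t * P n') = 0.
  by rewrite !mulrA !(proj2 (C_P n')) //; apply: F1M.
elim: n => [|n IHn].
  rewrite exp_mul_termS /exp_mul_term big_ord1 bin0 mulr1n !expr0 !mulr1 mul1r.
  by rewrite subrr /= /T mul0r !mulr0 mul0rn subr0 subr0 addr0.
(* [exp_mul_term] grows by an [x] on the left or a [y] on the right, a power of [t] by a letter on
   the left; the correction moves [y] across the power. *)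
have -> : t ^+ n.+2 - exp_mul_term x y n.+2
  = x * (t ^+ n.+1 - exp_mul_term x y n.+1) + (t ^+ n.+1 - exp_mul_term x y n.+1) * y
    - (t ^+ n.+1 * y - y * t ^+ n.+1).
  rewrite [exp_mul_term _ _ n.+2]exp_mul_termS (exprS t n.+1) {1}/t.
  by non_commutative_ring.
rewrite IHn comm_power mulrDr mulrnAr (proj2 (tt n)) mul0rn addr0.
case: n {IHn} => [|n].
  by rewrite /= /T /t !(mul0r, mulr0, subr0, addr0, mul0rn); non_commutative_ring.
set p := P n.+2; set q := P n.+1; set r := t * e * t ^+ n.
have tp : t * p = t * q * y - r.
  rewrite /p dexp_termSS (iter_T _ Ft Ce) (mulrBr t (T y q)) (mulrBr t (q * y)).
  rewrite (proj1 (tt n.+1)) subr0 (mulrBr t (e * t ^+ n)) mulrnAr.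
  have -> : t * (t * e * t ^+ n.-1) = 0.
    by rewrite !mulrA (proj2 Ce) ?mul0r //; apply: F1M.
  by rewrite mul0rn subr0 /r !mulrA.
rewrite dexp_termSS -/p /T (iter_T _ Ft Ce) -/r.
rewrite [X in _ = _ + X]mulrSr mulrDl mulrnAl.
have -> : t * q * y = t * p + r by rewrite tp subrK.
rewrite mulrnDl [r *+ n.+2]mulrSr; move: (t * p *+ n.+2) => k.
have -> : t * p = x * p + y * p by rewrite /t mulrDl.
by non_commutative_ring.
Qed.

Lemma exp_defect_sum z ex ey et :
  is_exp F x ex -> is_exp F y ey -> is_exp F t et ->
  is_sum F (fun n => (n`!%:R)^-1 *: P n) z -> et - ex * ey = z + t * z.
Proof.
move=> xe ye te Pz; apply: (eqm_sep (F := F)) => -[|N]; first exact: fil_all.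
apply: eqm_trans (eqmB (te _) (is_exp_mul Fx Fy xe ye _)) _.
apply: eqm_trans _ (eqm_sym (eqmD (Pz _) (eqmM (eqm_eq _ _ (erefl t)) (Pz _)))).
rewrite -sumrB; under eq_bigr do rewrite -scalerBr.
rewrite big_ord_recl /exp_mul_term big_ord1 bin0 mulr1n !expr0 mulr1 subrr.
rewrite scaler0 add0r [X in eqm _ _ _ (X + _)]big_ord_recl scaler0 add0r.
under eq_bigr => n _ do rewrite lift0 exp_defect scalerDr.
rewrite big_split /=; apply: eqmD; first exact: eqm_eq.
rewrite big_ord_recr /= mulrDr -[X in eqm _ _ X _]addr0; apply: eqmD.
  apply: eqm_eq; rewrite mulr_sumr; apply: eq_bigr => n _.
  rewrite /= -scaler_nat scalerA -scalerAr factS natrM invfM.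
  by rewrite [in LHS]mulrAC mulVf ?mul1r // Num.Theory.pnatr_eq0.
apply/eqm_sym/eqm0; rewrite -scalerAr; apply/filZ.
exact: (filM Ft (fil_P N)).
Qed.

Variables (ex ey et : A).
Hypotheses (xe : is_exp F x ex) (ye : is_exp F y ey) (te : is_exp F t et).

Lemma Lev_exp_defect G z : L G z ->
  varA * varB * (varA + varB) * G
    = (varA + varB) * exp2 varB - varB * exp2 (varA + varB) - varA ->
  et - ex * ey = z + t * z.
Proof.
move=> Gz HG; apply: exp_defect_sum => // N.
apply: (@eqm_trans _ _ _ (\sum_(n < N.+3) (n`!%:R)^-1 *: P n)).
  apply: (Lev_fil (raising_T Fx) (raising_T Fy)) (sum_dexp_poly (N := N) HG).
  apply: LevB => //; apply: Lev_sum => n _; apply: LevZ; exact: Lev_dexp_term.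
apply: (@eqm_sum_widen _ F N N.+3 (fun n => (n`!%:R)^-1 *: P n)) => [n|].
  exact/filZ/fil_P.
by rewrite -addn3 leq_addr.
Qed.

(** Products of two of the [p]'s vanish. Exponentials to the right of a [p] multiply its series, as
    [G] records; those to its left leave one letter, and these letters are the ones occurring in
    [z + t z]. *)
Lemma hexagon_2FF g1 g2 g3 p1 p2 p3 :
  L g1 p1 -> L g2 p2 -> L g3 p3 ->
  (let G := exp2 (varA + varB) * g1 + exp2 varB * g2 + g3 in
   varA * varB * (varA + varB) * G
    = (varA + varB) * exp2 varB - varB * exp2 (varA + varB) - varA) ->
  et = (1 + p1) * ex * (1 + p2) * ey * (1 + p3).
Proof.
move=> Lp1 Lp2 Lp3 HG.
have [F1p p10] := LevT_C Ce Lp1; have [F2p p20] := LevT_C Ce Lp2.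
have [F3p p30] := LevT_C Ce Lp3.
have Lz : L (exp2 (varA + varB) * g1 + exp2 varB * g2 + g3)
    ((p1 * et - t * p1 * et) + (p2 * ey - y * p2 * ey) + p3).
  apply: LevD => //; apply: LevD.
    apply: (LevT_exp Ce (filD fil2_varA fil2_varB) Ft te) Lp1.
    by move=> g z; apply: (LevT_AB F2comm Fx Fy Ce).
  apply: (LevT_exp Ce fil2_varB Fy ye) Lp2.
  by move=> g z; apply: (LevT_varB F2comm Fx Fy Ce).
set z := _ + p3 in Lz; have [Fz z0] := LevT_C Ce Lz.
have defect := Lev_exp_defect Lz HG.
have ev_mul v ev w : F 1 v -> is_exp F v ev -> C F w -> ev * w = w + v * w.
  move=> Fv ve [_ w0]; have F2v := is_exp_fil2 Fv ve.
  have -> : ev = (ev - 1 - v) + (1 + v) by non_commutative_ring.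
  by rewrite mulrDl w0 // add0r mulrDl mul1r.
(* Behind [p1] the exponentials multiply as if [x] and [y] commuted: [p1] has degree two and so
   annihilates the defect [z + t z]. *)
have p1e : p1 * ex * ey = p1 * et.
  apply/eqP; rewrite -mulrA -subr_eq0 -mulrBr -opprB defect mulrN mulrDr.
  by rewrite (z0 _ F1p) mulrA z0 ?add0r ?oppr0 //; apply: filMr.
have xp2 : ex * p2 = p2 + x * p2 by apply: ev_mul.
have exyp3 : ex * (ey * p3) = p3 + t * p3.
  have Cyp : C F (y * p3).
    by split=> [|u Fu]; [apply: filMl|rewrite mulrA p30 //; apply: filMr].
  rewrite (ev_mul y ey p3) // mulrDr (ev_mul x ex p3) // (ev_mul x ex (y * p3)) //.
  by rewrite [x * (y * p3)]mulrA (p30 _ (F1M Fx Fy)) /t; non_commutative_ring.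
have [Fxe Fye] : F 2 (p1 * ex) /\ F 2 (p1 * et) by split; apply: filMr.
have -> : (1 + p1) * ex * (1 + p2) * ey * (1 + p3)
  = ex * ey + p1 * ex * ey + ex * p2 * ey + ex * (ey * p3)
    + (p1 * ex * p2) * (ey * (1 + p3)) + (p1 * ex * ey) * p3 + (ex * p2 * ey) * p3.
  by non_commutative_ring.
rewrite p1e xp2 exyp3 (p20 _ Fxe) mul0r (p30 _ Fye).
have /p30-> : F 2 ((p2 + x * p2) * ey) by apply/filMr/filD => //; apply: filMl.
rewrite -[et in LHS](subrK (ex * ey)) defect /z.
have tt w : C F w -> forall v v', F 1 v -> F 1 v' -> v * (v' * w) = 0.
  by move=> [_ w0] v v' Fv Fv'; rewrite mulrA w0 //; apply: F1M.
have -> : t * (p1 * et - t * p1 * et + (p2 * ey - y * p2 * ey) + p3)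
  = t * p1 * et - t * (t * p1) * et + (t * p2 * ey - t * (y * p2) * ey) + t * p3.
  by non_commutative_ring.
rewrite !tt // !mul0r /t; non_commutative_ring.
Qed.

End Hexagon.

(** * The pentagon modulo 2FF *)

Lemma bracketC (A : pzRingType) (x y : A) : bracket y x = - bracket x y.
Proof. by rewrite /bracket opprB. Qed.

Lemma bracketDl (A : nzRingType) (x y z : A) :
  bracket (x + y) z = bracket x z + bracket y z.
Proof. by rewrite /bracket; non_commutative_ring. Qed.

Lemma bracketDr (A : nzRingType) (x y z : A) :
  bracket x (y + z) = bracket x y + bracket x z.
Proof. by rewrite /bracket; non_commutative_ring. Qed.

Lemma bracketN (A : nzRingType) (x y : A) :
  bracket (- x) y = - bracket x y /\ bracket x (- y) = - bracket x y.
Proof. by rewrite /bracket; split; non_commutative_ring. Qed.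

Section Jacobi.
Variable A : algType rat.
Implicit Types x y z w : A.

Lemma T_bracket x w : T x w = bracket w x. Proof. by []. Qed.

(** [T x] is a derivation; the lemmas after it treat the cases where [x] commutes with one or both
    entries. *)
Lemma T_jacobi x y z :
  T x (bracket y z) = bracket (bracket y x) z + bracket y (bracket z x).
Proof. by rewrite /T /bracket; non_commutative_ring. Qed.

Lemma T_bracketl x y z : bracket x z = 0 ->
  T x (bracket y z) = bracket (bracket y x) z.
Proof.
by move=> xz; rewrite T_jacobi (bracketC x z) xz oppr0 /bracket mulr0 mul0r subrr addr0.
Qed.

Lemma T_bracketr x y z : bracket x z = 0 ->
  T x (bracket z y) = bracket z (bracket y x).
Proof.
by move=> xz; rewrite T_jacobi (bracketC x z) xz oppr0 /bracket mulr0 mul0r subrr add0r.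
Qed.

Lemma T_bracket0 x y z : bracket x y = 0 -> bracket x z = 0 -> T x (bracket y z) = 0.
Proof.
by move=> xy xz; rewrite T_bracketl // (bracketC x y) xy oppr0 /bracket mulr0 mul0r subrr.
Qed.

End Jacobi.

(** [T s] annihilates the bracket by the Jacobi identity and commutes with [T x] and [T y] on [C],
    so it annihilates every monomial. *)
Lemma LevT_central (A : algType rat) (F : filtration A) :
  (forall u x y : A, F 2 u -> u * (x * y) = u * (y * x)) ->
  forall (x y s : A) f z, F 1 x -> F 1 y -> F 1 s ->
  bracket s x = 0 -> bracket s y = 0 ->
  Lev F (T x) (T y) (bracket x y) f z -> T s z = 0.
Proof.
move=> F2comm x y s f z Fx Fy Fs sx sy fz.
have Ce : C F (bracket x y) by apply: C_bracket.
have iter0 u n w : F 1 u -> C F w -> T s w = 0 -> T s (iter n (T u) w) = 0.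
  move=> Fu Cw sw; elim: n => //= n IHn.
  rewrite (T_comm F2comm Fs Fu); last exact: C_iter.
  by rewrite IHn /T mul0r mulr0 subrr.
have sM i j : T s (monom (T x) (T y) (bracket x y) i j) = 0.
  apply: (iter0 x i) => //; first exact: C_iter.
  by apply: (iter0 y j) => //; apply: T_bracket0.
apply: (eqm_sep (F := F)) => N; apply: eqm_le (leqnSn N) _.
apply: eqm_trans (raising_eqm (raising_T Fs) (fz N)) (eqm_eq _ _ _).
rewrite (raising_sum (raising_T Fs)) big1 // => i _.
rewrite (raising_sum (raising_T Fs)) big1 // => j _.
by rewrite (raisingZ (raising_T Fs)) sM scaler0.
Qed.

(* The four-term relation for the chords [x = t^ij], [y = t^jk], [z = t^ik]. *)
Definition four_term (A : pzRingType) (x y z : A) :=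
  [/\ bracket (x + y) z = 0, bracket (y + z) x = 0 & bracket (z + x) y = 0].

Lemma four_termP (A : nzRingType) (x y z : A) : four_term x y z ->
  bracket y z = bracket x y /\ bracket z x = bracket x y.
Proof.
case=> _; rewrite !bracketDl (bracketC x y) (bracketC y z) => yzx zxy.
by split; [apply/esym|]; apply/subr0_eq; rewrite addrC.
Qed.

Section Pentagon.
Variables (A : algType rat) (F : filtration A).
Hypothesis F2comm : forall u x y : A, F 2 u -> u * (x * y) = u * (y * x).
Variables t12 t13 t14 t23 t24 t34 : A.
Hypotheses (F12 : F 1 t12) (F13 : F 1 t13) (F14 : F 1 t14)
           (F23 : F 1 t23) (F24 : F 1 t24) (F34 : F 1 t34).
Hypotheses (H1234 : bracket t12 t34 = 0) (H1324 : bracket t13 t24 = 0)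
           (H1423 : bracket t14 t23 = 0).
Hypotheses (H123 : four_term t12 t23 t13) (H124 : four_term t12 t24 t14)
           (H134 : four_term t13 t34 t14) (H234 : four_term t23 t34 t24).

Let e123 := bracket t12 t23.
Let e124 := bracket t12 t24.
Let e134 := bracket t13 t34.
Let e234 := bracket t23 t34.

Let C123 : C F e123. Proof. exact: C_bracket. Qed.
Let C124 : C F e124. Proof. exact: C_bracket. Qed.
Let C134 : C F e134. Proof. exact: C_bracket. Qed.
Let C234 : C F e234. Proof. exact: C_bracket. Qed.

(** [s2] and [s3] collect the chords ending on strand 2, resp. 3, and commute with the chords
    avoiding that strand; [s1] is central among the strands 1, 2, 3. Their differences are the
    wanted ones: [s1 - s3] is [t12 - t34] and [s1 - s2] is [t13 - t24]. *)
Let s1 := t12 + t23 + t13.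
Let s2 := t12 + t23 + t24.
Let s3 := t13 + t23 + t34.
Let Fs1 : F 1 s1. Proof. by do 2?apply: filD. Qed.
Let Fs2 : F 1 s2. Proof. by do 2?apply: filD. Qed.
Let Fs3 : F 1 s3. Proof. by do 2?apply: filD. Qed.

(* The submodule of commutators on which opposite chords act equally. *)
Let N w := [/\ C F w, T s1 w = 0, T s2 w = 0 & T s3 w = 0].

Let T0 u : T u 0 = 0 :> A. Proof. by rewrite /T mul0r mulr0 subrr. Qed.

Let N_T u w : F 1 u -> N w -> N (T u w).
Proof.
move=> Fu [Cw w1 w2 w3]; split; first exact: C_T.
- by rewrite (T_comm F2comm) // w1 T0.
- by rewrite (T_comm F2comm) // w2 T0.
- by rewrite (T_comm F2comm) // w3 T0.
Qed.

Let N_iter u n w : F 1 u -> N w -> N (iter n (T u) w).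
Proof. by move=> Fu Nw; elim: n => //= n IHn; apply: N_T. Qed.

Let NN w : N w -> N (- w).
Proof.
by case=> Cw w1 w2 w3; split; rewrite ?TNr ?w1 ?w2 ?w3 ?oppr0; first exact: CN.
Qed.
Let ND w z : N w -> N z -> N (w + z).
Proof.
move=> [Cw w1 w2 w3] [Cz z1 z2 z3].
by split; rewrite ?TDr ?w1 ?w2 ?w3 ?z1 ?z2 ?z3 ?addr0; first exact: CD.
Qed.

Let N_eq w : N w -> T t12 w = T t34 w /\ T t13 w = T t24 w.
Proof.
case=> _; rewrite /s1 /s2 /s3 !TDl => w1 w2 w3; split; apply: subr0_eq.
  have -> : T t12 w - T t34 w = T t12 w + T t23 w + T t13 w - (T t13 w + T t23 w + T t34 w).
    by non_commutative_ring.
  by rewrite w1 w3 subr0.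
have -> : T t13 w - T t24 w = T t12 w + T t23 w + T t13 w - (T t12 w + T t23 w + T t24 w).
  by non_commutative_ring.
by rewrite w1 w2 subr0.
Qed.

(** Each of these three double commutators is, up to sign, a chord acting on [e123], on [e124] and
    on [e134]. These are annihilated by [s1], [s3] and [s2] respectively, which places all three in
    [N]. *)
Let X := T t34 e124.
Let Z := T t23 e124.
Let W := T t24 e123.

Let T13_e234 : T t13 e234 = - W.
Proof.
rewrite /e234 -(proj2 (four_termP H234)) T_bracketr // (proj1 (four_termP H123)).
by rewrite /W T_bracket bracketC.
Qed.

Let T13_e124 : T t13 e124 = - W.
Proof.
rewrite T_bracketl // (bracketC t13 t12) (proj2 (four_termP H123)).
by rewrite (proj1 (bracketN _ _)) /W T_bracket.
Qed.

Let T24_e134 : T t24 e134 = W.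
Proof.
rewrite T_bracketr; last by rewrite bracketC H1324 oppr0.
by rewrite (proj1 (four_termP H234)) bracketC -T_bracket T13_e234 opprK.
Qed.

Let T12_e134 : T t12 e134 = - X.
Proof.
rewrite /X /e124 -(proj2 (four_termP H124)) (@T_bracketl _ t34 t14); last first.
  by rewrite bracketC H1234 oppr0.
by rewrite (bracketC t34 t14) (proj1 (four_termP H134)) (proj1 (bracketN _ _)) opprK.
Qed.

Let Z_e123 : Z = - T t14 e123.
Proof.
rewrite /Z /e124 -(proj2 (four_termP H124)) (@T_bracketr _ t23 t12); last first.
  by rewrite bracketC H1423 oppr0.
by rewrite T_bracket -bracketC.
Qed.

Let T23_e134 : T t23 e134 = - Z.
Proof.
rewrite Z_e123 opprK /e134 -(proj2 (four_termP H134)) (@T_bracketr _ t23 t13); last first.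
  by rewrite bracketC H1423 oppr0.
by rewrite (bracketC t23 t13) (proj1 (four_termP H123)) (proj2 (bracketN _ _)) -bracketC.
Qed.

Let X_e123 : X = - T t34 e123.
Proof.
have H3412 : bracket t34 t12 = 0 by rewrite bracketC H1234 oppr0.
rewrite /X T_bracketr // T_bracketr // (bracketC t34 t24) (proj1 (four_termP H234)).
by rewrite (proj2 (bracketN _ _)).
Qed.

Let s1_e123 : T s1 e123 = 0.
Proof.
have [_ r2 r3] := H123; apply: T_bracket0; rewrite /s1.
  by rewrite -addrA bracketDl r2 /bracket subrr addr0.
by rewrite addrAC [t12 + _]addrC bracketDl r3 /bracket subrr addr0.
Qed.

Let s3_e124 : T s3 e124 = 0.
Proof.
have [_ r2 _] := H123; have [r1 _ _] := H234; apply: T_bracket0; rewrite /s3.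
  by rewrite [t13 + _]addrC bracketDl r2 bracketC H1234 oppr0 addr0.
by rewrite -addrA bracketDl r1 H1324 addr0.
Qed.

Let s2_e134 : T s2 e134 = 0.
Proof.
have [r1 _ _] := H123; have [_ _ r3] := H234; apply: T_bracket0; rewrite /s2.
  by rewrite bracketDl r1 bracketC H1324 oppr0 addr0.
by rewrite -addrA [t23 + _]addrC bracketDl r3 H1234 addr0.
Qed.

Let T_T0 s u e : F 1 s -> F 1 u -> C F e -> T s e = 0 -> T s (T u e) = 0.
Proof. by move=> Fs Fu Ce e0; rewrite (T_comm F2comm) // e0 T0. Qed.

Let N_W : N W.
Proof.
split; first exact: C_T.
- exact: T_T0.
- by rewrite -T24_e134; apply: T_T0.
- by rewrite -[W]opprK -T13_e124 TNr T_T0 ?oppr0.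
Qed.

Let N_X : N X.
Proof.
split; first exact: C_T.
- by rewrite X_e123 TNr T_T0 ?oppr0.
- by rewrite -[X]opprK -T12_e134 TNr T_T0 ?oppr0.
- exact: T_T0.
Qed.

Let N_Z : N Z.
Proof.
split; first exact: C_T.
- by rewrite Z_e123 TNr T_T0 ?oppr0.
- by rewrite -[Z]opprK -T23_e134 TNr T_T0 ?oppr0.
- exact: T_T0.
Qed.

Let iterD u n v v' : iter n (T u) (v + v') = iter n (T u) v + iter n (T u) v' :> A.
Proof. by elim: n => //= n ->; rewrite TDr. Qed.

Let iterN u n v : iter n (T u) (- v) = - iter n (T u) v :> A.
Proof. by elim: n => //= n ->; rewrite TNr. Qed.

Let iterB u n v v' : iter n (T u) (v - v') = iter n (T u) v - iter n (T u) v' :> A.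
Proof. by rewrite iterD iterN. Qed.

(** Factor [S^j - s^j] through [S - s]: once [S - s] has brought [e] into [N], the remaining
    operators can be exchanged for their primed partners, which gives the same expression in [f]. *)
Let geometric e f S s S' s' : C F e -> C F f -> F 1 S -> F 1 s -> F 1 S' -> F 1 s' ->
  (forall w, N w -> T S w = T S' w) -> (forall w, N w -> T s w = T s' w) ->
  N (T S e - T s e) -> T S e - T s e = - (T S' f - T s' f) ->
  forall j, N (iter j (T S) e - iter j (T s) e) /\
    iter j (T S) e - iter j (T s) e = - (iter j (T S') f - iter j (T s') f).
Proof.
move=> Ce Cf FS Fs FS' Fs' SS ss NSe eSf.
have iter_comm u v n w : F 1 u -> F 1 v -> C F w -> T u (iter n (T v) w) = iter n (T v) (T u w).
  move=> Fu Fv Cw; elim: n => //= n IHn; rewrite (T_comm F2comm) ?IHn //.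
  exact: C_iter.
have Nss n w : N w -> iter n (T s) w = iter n (T s') w.
  move=> Nw; elim: n => //= n <-; apply: ss; exact: N_iter.
have step e' U u n : C F e' -> F 1 U -> F 1 u ->
    iter n.+1 (T U) e' - iter n.+1 (T u) e'
    = T U (iter n (T U) e' - iter n (T u) e') + iter n (T u) (T U e' - T u e').
  move=> Ce' FU Fu; rewrite (raisingB (raising_T FU)) !iterS.
  rewrite iterB; rewrite -!iter_comm // addrA subrK.
  by [].
elim=> [|j [Nd df]].
  rewrite /= !subrr oppr0; split=> //; split; [exact: C0|exact: T0..].
rewrite (step e) // (step f) //; split.
  by apply: ND; [apply: N_T|apply: N_iter].
by rewrite SS // (Nss j _ NSe) df eSf TNr iterN [RHS]opprD.
Qed.

Let iter_swap u v m n w : F 1 u -> F 1 v -> C F w ->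
  iter m (T u) (iter n (T v) w) = iter n (T v) (iter m (T u) w).
Proof.
move=> Fu Fv Cw; have swap1 k z : C F z -> T u (iter k (T v) z) = iter k (T v) (T u z).
  by move=> Cz; elim: k => //= k <-; rewrite (T_comm F2comm) //; apply: C_iter.
by elim: m => //= m ->; rewrite swap1 //; apply: C_iter.
Qed.

Let iter_N u v n w : (forall z, N z -> T u z = T v z) -> F 1 u -> F 1 v -> N w ->
  iter n (T u) w = iter n (T v) w.
Proof. by move=> uv Fu Fv Nw; elim: n => //= n <-; apply/uv/N_iter. Qed.

Let F1213 : F 1 (t12 + t13). Proof. exact: filD. Qed.
Let F2434 : F 1 (t24 + t34). Proof. exact: filD. Qed.
Let F1323 : F 1 (t13 + t23). Proof. exact: filD. Qed.
Let F2324 : F 1 (t23 + t24). Proof. exact: filD. Qed.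

Let N1234 z : N z -> T t12 z = T t34 z. Proof. by case/N_eq. Qed.
Let N1324 z : N z -> T t13 z = T t24 z. Proof. by case/N_eq. Qed.

Notation M x y w := (monom (T x) (T y) w).

(** The terms on [e123] with exponents [(i, j)] cancel against those on [e234] with exponents
    [(j, i)]; this exchange is where the symmetry of [lam] enters. *)
Let pentagon_outer i j :
  (M t12 t23 e123 i j - M t12 (t23 + t24) e123 i j)
  + (M t23 t34 e234 j i - M (t13 + t23) t34 e234 j i) = 0.
Proof.
have NS z : N z -> T (t23 + t24) z = T (t13 + t23) z.
  by move=> /N1324; rewrite !TDl => ->; rewrite addrC.
have [] := @geometric e123 e234 (t23 + t24) t23 (t13 + t23) t23 _ _ _ _ _ _ NS _ _ _ j => //.
- by rewrite TDl addrAC subrr add0r.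
- by rewrite !TDl addrAC subrr add0r addrK T13_e234 opprK.
move=> Nd df; rewrite /monom -!iterB.
have -> : iter j (T t23) e123 - iter j (T (t23 + t24)) e123
  = - (iter j (T (t23 + t24)) e123 - iter j (T t23) e123) by rewrite opprB.
rewrite iterN (iter_N i N1234) // df !iterN opprK.
rewrite (iter_swap j i F23 F34 C234) (iter_swap j i F1323 F34 C234) -iterB.
by rewrite -[X in _ + iter i _ X]opprB iterN subrr.
Qed.

(** Both operators of a monomial change here. Each difference is split at an intermediate monomial
    where only one has changed, and [geometric] is applied to each half. *)
Let pentagon_inner i j :
  (M (t12 + t13) (t24 + t34) e124 i j - M t12 (t23 + t24) e124 i j)
  + (M (t12 + t13) (t24 + t34) e134 j i - M (t13 + t23) t34 e134 j i) = 0.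
Proof.
have NS z : N z -> T (t12 + t13) z = T (t24 + t34) z.
  by case/N_eq; rewrite !TDl => -> ->; rewrite addrC.
have Ns z : N z -> T (t23 + t24) z = T (t13 + t23) z.
  by move=> /N1324; rewrite !TDl => ->; rewrite addrC.
have [] := @geometric e124 e134 (t12 + t13) t12 (t24 + t34) t34 _ _ _ _ _ _ NS N1234 _ _ i => //.
- by rewrite TDl addrAC subrr add0r T13_e124; apply: NN.
- by rewrite !TDl addrAC subrr add0r addrK T13_e124 T24_e134.
move=> Nd df.
have E124 : T (t24 + t34) e124 - T (t23 + t24) e124 = X - Z.
  by rewrite !TDl -/X -/Z; non_commutative_ring.
have E134 : T (t12 + t13) e134 - T (t13 + t23) e134 = - (X - Z).
  by rewrite !TDl T12_e134 T23_e134; non_commutative_ring.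
have [] := @geometric e124 e134 (t24 + t34) (t23 + t24) (t12 + t13) (t13 + t23)
  _ _ _ _ _ _ (fun z Nz => esym (NS z Nz)) Ns _ _ j => //.
- by rewrite E124; exact/ND/NN.
- by rewrite E124 E134 opprK.
move=> Nd2 df2; rewrite /monom.
set a := t12 + t13 in NS Nd df Nd2 df2 *; set b := t24 + t34 in NS Nd df Nd2 df2 *.
have -> : iter i (T a) (iter j (T b) e124) - iter i (T t12) (iter j (T (t23 + t24)) e124)
  = iter j (T b) (iter i (T a) e124 - iter i (T t12) e124)
    + iter i (T t12) (iter j (T b) e124 - iter j (T (t23 + t24)) e124).
  rewrite (iterB b j (iter i (T a) e124)) (iterB t12 i (iter j (T b) e124)).
  rewrite (iter_swap i j (F1213 : F 1 a) (F2434 : F 1 b) C124)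
    (iter_swap i j F12 (F2434 : F 1 b) C124).
  by rewrite addrA subrK.
have -> : iter j (T a) (iter i (T b) e134) - iter j (T (t13 + t23)) (iter i (T t34) e134)
  = iter j (T a) (iter i (T b) e134 - iter i (T t34) e134)
    + iter i (T t34) (iter j (T a) e134 - iter j (T (t13 + t23)) e134).
  rewrite (iterB a j (iter i (T b) e134)) (iterB t34 i (iter j (T a) e134)).
  rewrite (iter_swap i j F34 (F1213 : F 1 a) C134) (iter_swap i j F34 F1323 C134).
  by rewrite addrA subrK.
rewrite -(iter_N j NS F1213 F2434 Nd) (iter_N i N1234 F12 F34 Nd2) df df2 !iterN.
by rewrite addrACA !addNr addr0.
Qed.

Lemma pentagon_monom i j :
  let S i j := M t12 t23 e123 i j + M (t12 + t13) (t24 + t34) (e124 + e134) i j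
    + M t23 t34 e234 i j - M (t13 + t23) t34 (e134 + e234) i j
    - M t12 (t23 + t24) (e123 + e124) i j in
  S i j + S j i = 0.
Proof.
have monomD (x y w z : A) k l : M x y (w + z) k l = M x y w k l + M x y z k l.
  by rewrite /monom iterD iterD.
rewrite /= !(monomD _ _ e124 e134) !(monomD _ _ e134 e234) !(monomD _ _ e123 e124).
transitivity ((M t12 t23 e123 i j - M t12 (t23 + t24) e123 i j
  + (M t23 t34 e234 j i - M (t13 + t23) t34 e234 j i))
  + (M t12 t23 e123 j i - M t12 (t23 + t24) e123 j i
  + (M t23 t34 e234 i j - M (t13 + t23) t34 e234 i j))
  + (M (t12 + t13) (t24 + t34) e124 i j - M t12 (t23 + t24) e124 i j
  + (M (t12 + t13) (t24 + t34) e134 j i - M (t13 + t23) t34 e134 j i))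
  + (M (t12 + t13) (t24 + t34) e124 j i - M t12 (t23 + t24) e124 j i
  + (M (t12 + t13) (t24 + t34) e134 i j - M (t13 + t23) t34 e134 i j))).
  by non_commutative_ring.
by rewrite !pentagon_outer !pentagon_inner !addr0.
Qed.

Lemma pentagon_2FF lam p1 p2 p3 q1 q2 : symmetric2 lam ->
  Lev F (T t12) (T t23) e123 lam p1 ->
  Lev F (T (t12 + t13)) (T (t24 + t34)) (bracket (t12 + t13) (t24 + t34)) lam p2 ->
  Lev F (T t23) (T t34) e234 lam p3 ->
  Lev F (T (t13 + t23)) (T t34) (bracket (t13 + t23) t34) lam q1 ->
  Lev F (T t12) (T (t23 + t24)) (bracket t12 (t23 + t24)) lam q2 ->
  (1 + p1) * (1 + p2) * (1 + p3) = (1 + q1) * (1 + q2).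
Proof.
have -> : bracket (t12 + t13) (t24 + t34) = e124 + e134.
  by rewrite !bracketDl !bracketDr H1234 H1324 addr0 add0r.
have -> : bracket (t13 + t23) t34 = e134 + e234 by rewrite bracketDl.
have -> : bracket t12 (t23 + t24) = e123 + e124 by rewrite bracketDr.
move=> sym L1 L2 L3 L4 L5.
have [C1 C2 C3] : [/\ C F p1, C F p2 & C F p3].
  split; [exact: (LevT_C C123 L1)| |exact: (LevT_C C234 L3)].
  by apply: (LevT_C _ L2); apply: CD.
have [C4 C5] : C F q1 /\ C F q2.
  by split; [apply: (LevT_C _ L4)|apply: (LevT_C _ L5)]; apply: CD.
have linear0 : p1 + p2 + p3 - q1 - q2 = 0.
  (* Doubling lets the symmetry of [lam] pair [S i j] with [S j i] term by term; 2 is invertible. *)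
  set d := _ - q2; suff : d + d = 0.
    rewrite -mulr2n -scaler_nat => /(congr1 (fun z => (2%:R : rat)^-1 *: z)).
    by rewrite scalerA mulVf // scale1r scaler0.
  apply: (eqm_sep (F := F)) => K.
  pose S i j := M t12 t23 e123 i j + M (t12 + t13) (t24 + t34) (e124 + e134) i j
    + M t23 t34 e234 i j - M (t13 + t23) t34 (e134 + e234) i j
    - M t12 (t23 + t24) (e123 + e124) i j.
  have dS : eqm F K d (\sum_(i < K) \sum_(j < K) lam i j *: S i j).
    rewrite /S; under eq_bigr do under eq_bigr do rewrite !scalerBr !scalerDr.
    under eq_bigr do rewrite !sumrB !big_split /=.
    rewrite !sumrB !big_split /=; apply: eqmB (L5 K); apply: eqmB (L4 K).
    by apply: eqmD (L3 K); apply: eqmD (L2 K); apply: L1.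
  apply: eqm_trans (eqmD dS dS) (eqm_eq _ _ _).
  rewrite [X in _ + X]exchange_big /= -big_split big1 //= => i _.
  rewrite -big_split big1 //= => j _.
  by rewrite [lam j i]sym -scalerDr [_ + _]pentagon_monom scaler0.
have [F1' c1] := C1; have [F2' c2] := C2; have [_ c3] := C3; have [_ c5] := C5.
have [F4' _] := C4.
have -> : (1 + p1) * (1 + p2) * (1 + p3)
  = (1 + p1 + p2 + p3) + (p1 * p2 + p1 * p3 + p2 * p3 + p1 * p2 * p3).
  by non_commutative_ring.
have -> : (1 + q1) * (1 + q2) = 1 + q1 + q2 + q1 * q2 by non_commutative_ring.
rewrite (c2 _ F1') (c3 _ F1') (c3 _ F2') (c5 _ F4') mul0r !addr0.
apply: subr0_eq; rewrite -[RHS]linear0; non_commutative_ring.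
Qed.

End Pentagon.

(** * Horizontal chord diagrams modulo 2FF *)

Lemma nc_expand (G : finType) (f : ncseries G) :
  f = f [::] *: 1 + \sum_x letter x * shift x f.
Proof.
apply: ncseriesP => -[|y w].
  rewrite -[RHS]/((f [::] * 1) + (\sum_x letter x * shift x f) [::]) nc_sumE mulr1.
  by rewrite big1 ?addr0 // => x _; rewrite ncM_nil mul0r.
rewrite -[RHS]/((f [::] * 0) + (\sum_x letter x * shift x f) (y :: w)) nc_sumE.
rewrite mulr0 add0r (bigD1 y) // big1 => [|x ne_xy].
  apply: etrans _ (esym (addr0 _)).
  rewrite -[RHS]/(shift y (letter y * shift y f) w) shift_mul shift_letter.
  by rewrite scale0r add0r eqxx scale1r mul1r.
rewrite -[LHS]/(shift y (letter x * shift x f) w) shift_mul shift_letter.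
by rewrite scale0r add0r eq_sym [x == y](negPf ne_xy) scale0r mul0r.
Qed.

(** The generators of 2FF have a word in front of the commutator. The identity absorbs an arbitrary
    series [g] standing between the word and the commutator. *)
Lemma mul_commutator (A : nzRingType) (u v g x y : A) :
  u * (v * g) * (x * y - y * x)
    = u * v * (g * x * y - y * (g * x)) + - (u * v * (g * y - y * g)) * x.
Proof. by non_commutative_ring. Qed.

(** A series of order two is a finite sum of terms [letter a * letter b * g], to each of which
    [mul_commutator] applies. *)
Lemma chordQ_comm n (u x y : chordQ n) :
  qfil n 2 u -> u * (x * y) = u * (y * x).
Proof.
have surj (z : chordQ n) : exists z', z = pr z' by exists (repr z); rewrite pr_repr.
case=> f Ff ->; have [[{}x ->] [{}y ->]] := (surj x, surj y).
have E (a b : freeA n) : pr a * pr b = pr (a * b) by exact/esym/(chomM (chom_pr n)).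
rewrite (E x y) (E y x) (E f (x * y)) (E f (y * x)); apply/prP; rewrite -mulrBr => {u}.
have [I0 ID Il Ir _] := ideal2FF_closed n.
have Isum (J : finType) (M : J -> freeA n) :
    (forall i, M i \in ideal2FF n) -> \sum_i M i \in ideal2FF n.
  by move=> IM; elim/big_ind: _ => // *; apply: ID.
have gen a b (v w : freeA n) :
    letter a * letter b * (v * w - w * v) \in ideal2FF n.
  apply/asboolP => J [cJ JS]; apply: JS; right.
  by exists [:: a; b], v, w; split=> //; rewrite big_cons big_seq1.
have sh (g : freeA n) : g [::] = 0 -> g = \sum_x letter x * shift x g.
  by move=> g0; rewrite [LHS]nc_expand g0 scale0r add0r.
rewrite (sh f); last exact: Ff.
rewrite mulr_suml; apply: (Isum (chord n)) => a; rewrite (sh (shift a f)); last exact: Ff.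
rewrite mulr_sumr mulr_suml; apply: (Isum (chord n)) => b; set g := shift b _.
rewrite (mul_commutator (letter a) (letter b) g x y).
apply: ID; first exact: gen.
by apply: Ir; rewrite -mulN1r; apply: Il.
Qed.

Lemma t_sym n i j : t i j = t j i :> freeA n.
Proof. by rewrite /t minnC maxnC. Qed.

Lemma t_letter n (c : chord n) : t (val c).1 (val c).2 = letter c.
Proof.
have /andP[c1 c12] := valP c.
rewrite /t (big_pred1 c) // => d /=.
rewrite (minn_idPl (ltnW c12)) (maxn_idPr (ltnW c12)).
by rewrite -val_eqE -pair_eqE /pair_eq -!val_eqE.
Qed.

Lemma chord_letter n i j : (0 < i)%N -> (i < j)%N -> (j <= n)%N ->
  exists2 c : chord n, t i j = letter c & (val c).1 = i :> nat /\ (val c).2 = j :> nat.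
Proof.
move=> i_gt0 lt_ij le_jn.
have hj : (j < n.+1)%N by rewrite ltnS.
pose p := (Ordinal (ltn_trans lt_ij hj), Ordinal hj).
have hp : (0 < p.1)%N && (p.1 < p.2)%N by rewrite i_gt0.
by exists (Sub p hp); rewrite -?t_letter !SubK.
Qed.

Section Cable.
Variables (m n : nat) (s : seq (seq nat)).

Lemma chom_cable : chom ncfil ncfil (@cable m n s).
Proof.
apply: chom_nc_subst => c.
by apply: fil_sum => k _; apply: fil_sum => l _; apply: t_fil.
Qed.

Lemma cable_t i j : (0 < i <= m)%N -> (0 < j <= m)%N -> i != j ->
  @cable m n s (t i j)
    = \sum_(k <- nth [::] s i.-1) \sum_(l <- nth [::] s j.-1) t k l.
Proof.
wlog lt_ij : i j / (i < j)%N => [IH|].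
  move=> hi hj ne_ij; have [/IH->//|lt_ji|eq_ij] := ltngtP i j; last first.
    by rewrite eq_ij eqxx in ne_ij.
  rewrite t_sym IH // 1?eq_sym // exchange_big; apply: eq_bigr => k _.
  by apply: eq_bigr => l _; rewrite t_sym.
case/andP=> i_gt0 _ /andP[_ le_jm] _.
have [c -> [c1 c2]] := chord_letter i_gt0 lt_ij le_jm.
rewrite /cable nc_subst_letter ?c1 ?c2 // => d.
by apply: fil_sum => k _; apply: fil_sum => l _; apply: t_fil.
Qed.

End Cable.

Lemma chom_relabel m n s : chom ncfil ncfil (@relabel m n s).
Proof. exact: chom_cable. Qed.

Lemma relabel_t m n s i j : (0 < i <= m)%N -> (0 < j <= m)%N -> i != j ->
  (i <= size s)%N -> (j <= size s)%N ->
  @relabel m n s (t i j) = t (nth 0%N s i.-1) (nth 0%N s j.-1).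
Proof.
move=> hi hj ne_ij is_ js; have pred_lt k : (0 < k <= m)%N -> (k <= size s)%N -> (k.-1 < size s)%N.
  by case: k.
rewrite /relabel cable_t // !(nth_map 0%N) ?pred_lt //.
by rewrite !big_seq1.
Qed.

Definition Lam n (lam : fps2) (X Y : freeA n) : freeA n :=
  bracket X Y * nc_eval lam X Y - X * bracket X Y * nc_eval (derivA lam) X Y
    - Y * bracket X Y * nc_eval (Defs.derivB lam) X Y.

Lemma Phi_ofE lam : Phi_of lam = 1 + Lam lam (t 1 2) (t 2 3).
Proof. by rewrite /Phi_of /Lam !addrA. Qed.

Lemma chom_nc_eval m n (h : freeA m -> freeA n) p X Y : chom ncfil ncfil h ->
  ncfil 1 X -> ncfil 1 Y -> h (nc_eval p X Y) = nc_eval p (h X) (h Y).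
Proof.
move=> Ch FX FY; have [FX' FY'] := (chom_fil Ch FX, chom_fil Ch FY).
exact: Lev_uniq (chom_Lev Ch (Lev_nc_eval p FX FY)) (Lev_nc_eval p FX' FY').
Qed.

Lemma chom_Lam m n (h : freeA m -> freeA n) lam X Y : chom ncfil ncfil h ->
  ncfil 1 X -> ncfil 1 Y -> h (Lam lam X Y) = Lam lam (h X) (h Y).
Proof.
move=> Ch FX FY; rewrite /Lam !(chomB Ch) !(chomM Ch) (chom_bracket Ch).
by rewrite !(chom_nc_eval _ Ch).
Qed.

Lemma Lev_Lam n lam (X Y : freeA n) : ncfil 1 X -> ncfil 1 Y ->
  Lev (qfil n) (T (pr X)) (T (pr Y)) (bracket (pr X) (pr Y)) lam (pr (Lam lam X Y)).
Proof.
move=> FX FY; have Ch := chom_pr n.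
have [FX' FY'] := (chom_fil Ch FX, chom_fil Ch FY).
rewrite /Lam !(chomB Ch) !(chomM Ch) (chom_bracket Ch).
apply: LevT_derivative => //.
- exact: chordQ_comm.
- exact: C_bracket (@chordQ_comm n) _ _ _ _.
- exact (chom_Lev Ch (Lev_nc_eval _ FX FY)).
- exact (chom_Lev Ch (Lev_nc_eval _ FX FY)).
- exact (chom_Lev Ch (Lev_nc_eval _ FX FY)).
Qed.

Lemma pr_rel n f : chord_rel n f -> pr f = 0.
Proof.
move=> rf; rewrite -[RHS](chom0 (chom_pr n)); apply/prP; rewrite subr0.
by apply/asboolP => J [cJ JS]; apply: JS; left.
Qed.

Lemma pr_eq0 n f : pr f = 0 <-> f \in ideal2FF n.
Proof. by rewrite -pr0 prP subr0. Qed.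

Notation prt n i j := (@pr n (t i j)).

Lemma prt_four_term n i j k : strands n [:: i; j; k] ->
  four_term (prt n i j) (prt n j k) (prt n i k).
Proof.
have Ch := chom_pr n => sijk.
have rel i' j' k' : strands n [:: i'; j'; k'] ->
    bracket (prt n i' j' + prt n j' k') (prt n i' k') = 0.
  move=> s'; rewrite -(chomD Ch) -(chom_bracket Ch); apply: pr_rel.
  by left; exists i', j', k'.
have perm s : perm_eq [:: i; j; k] s -> strands n s.
  by move=> e; rewrite /strands -(perm_uniq e) -(perm_all _ e).
split; first exact: rel.
  rewrite (t_sym n i k) (t_sym n i j); apply/rel/perm.
  by rewrite perm_sym (perm_rot 1 [:: i; j; k]).
rewrite (t_sym n i k) (t_sym n j k); apply/rel/perm.
by rewrite perm_sym (perm_rot 2 [:: i; j; k]).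
Qed.

Lemma prt_comm n i j k l : strands n [:: i; j; k; l] ->
  bracket (prt n i j) (prt n k l) = 0.
Proof.
move=> s; rewrite -(chom_bracket (chom_pr n)); apply: pr_rel.
by right; exists i, j, k, l.
Qed.

Lemma pr_chom_Phi_of n (h : freeA 3 -> freeA n) lam X Y : chom ncfil ncfil h ->
  h (t 1 2) = X -> h (t 2 3) = Y ->
  pr (h (Phi_of lam)) = 1 + pr (Lam lam X Y).
Proof.
move=> Ch <- <-; have [F12 F23] : ncfil 1 (@t 3 1 2) /\ ncfil 1 (@t 3 2 3).
  by split; apply: t_fil.
rewrite Phi_ofE (chomD Ch) (chom1 Ch) (chom_Lam _ Ch F12 F23).
by rewrite (chomD (chom_pr n)).
Qed.

Lemma pentagon_Phi_of lam : symmetric2 lam -> pentagon (Phi_of lam).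
Proof.
move=> sym; apply/eq2FFP; have Cp := chom_pr 4.
rewrite !(chomM Cp).
rewrite (@pr_chom_Phi_of _ _ _ (t 1 2) (t 2 3) (chom_relabel _ _ _)); try exact: relabel_t.
rewrite (@pr_chom_Phi_of _ _ _ (t 2 3) (t 3 4) (chom_relabel _ _ _)); try exact: relabel_t.
have cable3 s1 s2 s3 : @cable 3 4 [:: s1; s2; s3] (t 1 2)
      = \sum_(k <- s1) \sum_(l <- s2) t k l
    /\ @cable 3 4 [:: s1; s2; s3] (t 2 3) = \sum_(k <- s2) \sum_(l <- s3) t k l.
  by rewrite !cable_t.
have [E1 E1'] := cable3 [:: 1%N] [:: 2%N; 3%N] [:: 4%N].
have [E2 E2'] := cable3 [:: 1%N; 2%N] [:: 3%N] [:: 4%N].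
have [E3 E3'] := cable3 [:: 1%N] [:: 2%N] [:: 3%N; 4%N].
rewrite !(big_cons, big_nil, addr0) in E1 E1' E2 E2' E3 E3'.
rewrite (@pr_chom_Phi_of _ _ _ _ _ (chom_cable _ _ _) E1 E1').
rewrite (@pr_chom_Phi_of _ _ _ _ _ (chom_cable _ _ _) E2 E2').
rewrite (@pr_chom_Phi_of _ _ _ _ _ (chom_cable _ _ _) E3 E3').
have Ft i j : ncfil 1 (@t 4 i j) by apply: t_fil.
have Fp i j : qfil 4 1 (prt 4 i j) by apply: (chom_fil Cp).
apply: (@pentagon_2FF _ (qfil 4) (@chordQ_comm 4)
  (prt 4 1 2) (prt 4 1 3) (prt 4 1 4) (prt 4 2 3) (prt 4 2 4) (prt 4 3 4)
  _ _ _ _ _ _ _ _ _ _ _ _ _ lam) => //;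
  try exact: prt_comm; try exact: prt_four_term.
- exact: Lev_Lam.
- by rewrite -!(chomD Cp); apply: Lev_Lam; apply: filD.
- exact: Lev_Lam.
- by rewrite -!(chomD Cp); apply: Lev_Lam => //; apply: filD.
- by rewrite -!(chomD Cp); apply: Lev_Lam => //; apply: filD.
Qed.

(** * The equation for lambda *)

#[local] Opaque subst2 exp2 varA varB.

Lemma symmetric2_subst2 lam p q : symmetric2 lam -> fil2 1 p -> fil2 1 q ->
  subst2 lam p q = subst2 lam q p.
Proof.
move=> sym Fp Fq; apply: Lev_uniq (Lev_subst2 lam Fp Fq) _ => N.
apply: eqm_trans (@Lev_subst2 lam q p Fq Fp N) (eqm_eq _ _ _).
rewrite exchange_big; apply: eq_bigr => i _; apply: eq_bigr => j _.
by rewrite !monom_mul sym mulrC.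
Qed.

Lemma field_clear_denominators (K : fieldType) (a b c u v x : K) :
  a != 0 -> b != 0 -> c != 0 ->
  x = 1 / (a * b) + u / (b * c) + v / (a * c)
    <-> a * b * c * x = c + a * u + b * v.
Proof.
move=> a0 b0 c0; split=> [->|E]; first by field; rewrite ?a0 ?b0 ?c0.
have abc0 : a * b * c != 0 by rewrite !mulf_neq0.
by apply: (mulfI abc0); rewrite E; field; rewrite ?a0 ?b0 ?c0.
Qed.

Lemma clear_denominators (R : idomainType) (a b c u v l m n : R) :
  a != 0 -> b != 0 -> c != 0 ->
  tofrac l + tofrac u * tofrac m + tofrac v * tofrac n
    = 1 / (tofrac a * tofrac b) + tofrac u / (tofrac b * tofrac c)
      + tofrac v / (tofrac a * tofrac c)
  <-> a * b * c * (l + u * m + v * n) = c + a * u + b * v.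
Proof.
rewrite -(tofrac_eq0 a) -(tofrac_eq0 b) -(tofrac_eq0 c) => a0 b0 c0.
have E : tofrac (a * b * c * (l + u * m + v * n)) = tofrac (c + a * u + b * v)
    <-> a * b * c * (l + u * m + v * n) = c + a * u + b * v.
  by split=> [/eqP|->//]; rewrite tofrac_eq => /eqP.
by rewrite -{}E !(tofracM, tofracD); apply: field_clear_denominators.
Qed.

Definition cleared_equation lam :=
  varA * varB * varC * (lam + exp2 (- varB) * subst2 lam varB varC
    + exp2 varA * subst2 lam varA varC)
  = varC + varA * exp2 (- varB) + varB * exp2 varA.

Lemma lambda_equationP lam : lambda_equation lam <-> cleared_equation lam.
Proof. exact: clear_denominators varA_neq0 varB_neq0 varC_neq0. Qed.

Lemma morph_cleared_equation (R : comNzRingType) (S : R -> R) :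
  {morph S : f g / f + g} -> {morph S : f g / f * g} ->
  forall a b c l m n u v a' b' c' l' m' n' u' v',
  S a = a' -> S b = b' -> S c = c' -> S l = l' -> S m = m' -> S n = n' ->
  S u = u' -> S v = v' ->
  a * b * c * (l + u * m + v * n) = c + a * u + b * v ->
  a' * b' * c' * (l' + u' * m' + v' * n') = c' + a' * u' + b' * v'.
Proof.
move=> SD SM a b c l m n u v ? ? ? ? ? ? ? ? <- <- <- <- <- <- <- <- E.
by rewrite -!(SM, SD) E.
Qed.

(** The forms of the equation that the two hexagons require come from choosing [p] and [q] among the
    variables and their opposites. *)
Lemma cleared_equation_subst lam p q r : fil2 1 p -> fil2 1 q -> r = - (p + q) ->
  cleared_equation lam ->
  p * q * r * (subst2 lam p q + exp2 (- q) * subst2 lam q r + exp2 p * subst2 lam p r)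
    = r + p * exp2 (- q) + q * exp2 p.
Proof.
move=> Fp Fq ->; have Ch := chom_subst2 Fp Fq.
have [FA FB FC] := And3 fil2_varA fil2_varB fil2_varC.
have [EA EB EC] := And3 (subst2_varA Fp Fq) (subst2_varB Fp Fq) (subst2_varC Fp Fq).
pose S f := subst2 f p q.
have SD : {morph S : f g / f + g} by exact: chomD Ch.
have SM : {morph S : f g / f * g} by exact: chomM Ch.
refine (@morph_cleared_equation fps2 S SD SM varA varB varC lam (subst2 lam varB varC)
  (subst2 lam varA varC) (exp2 (- varB)) (exp2 varA) _ _ _ _ _ _ _ _
  EA EB EC erefl _ _ _ _); rewrite /S.
- by rewrite (subst2_subst2 Fp Fq lam FB FC); exact: (congr2 (subst2 lam) EB EC).
- by rewrite (subst2_subst2 Fp Fq lam FA FC); exact: (congr2 (subst2 lam) EA EC).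
- rewrite (subst2_exp2 Fp Fq (filN FB)); congr exp2.
  exact: (etrans (chomN Ch varB) (congr1 -%R EB)).
- by rewrite (subst2_exp2 Fp Fq FA); congr exp2; exact: EA.
Qed.

Lemma hexagon_ring_identity (R : comNzRingType) (a b c g1 g2 g3 et eb ena ec : R) :
  c = - (a + b) -> et * ec = 1 -> et * ena = eb ->
  c * a * b * (g1 + ena * g2 + ec * g3) = b + c * ena + a * ec ->
  a * b * (a + b) * (et * g1 + eb * g2 + g3) = (a + b) * eb - b * et - a.
Proof.
move=> -> etec <- H; apply/eqP; rewrite -subr_eq0.
have -> : a * b * (a + b) * (et * g1 + et * ena * g2 + g3)
    - ((a + b) * (et * ena) - b * et - a)
  = - et * (- (a + b) * a * b * (g1 + ena * g2 + ec * g3) - (b + - (a + b) * ena + a * ec))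
    + (1 - et * ec) * (a * b * (a + b) * g3 + a) by ring.
by rewrite H etec !subrr mulr0 mul0r addr0.
Qed.

(** The equation at [p = c], [q = a], [r = b], multiplied by [- exp(a + b)]. *)
Lemma hexagon_series lam : symmetric2 lam -> cleared_equation lam ->
  let G := exp2 (varA + varB) * subst2 lam varC varA
    + exp2 varB * subst2 lam varB varA + subst2 lam varB varC in
  varA * varB * (varA + varB) * G
    = (varA + varB) * exp2 varB - varB * exp2 (varA + varB) - varA.
Proof.
move=> sym lamE.
have [FA FB FC] := And3 fil2_varA fil2_varB fil2_varC.
have FAB : fil2 1 (varA + varB) by apply: filD.
refine (@hexagon_ring_identity fps2 varA varB varC (subst2 lam varC varA)
  (subst2 lam varB varA) (subst2 lam varB varC) (exp2 (varA + varB)) (exp2 varB)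
  (exp2 (- varA)) (exp2 varC) erefl _ _ _).
- exact: exp2N FAB.
- rewrite -(exp2D FAB (filN FA)); congr exp2.
  by rewrite addrAC subrr add0r.
have EB : varB = - (varC + varA) by rewrite /varC opprD opprK addrAC subrr add0r.
have := cleared_equation_subst FC FA EB lamE.
by rewrite (symmetric2_subst2 sym FA FB) (symmetric2_subst2 sym FC FB).
Qed.

(** The equation at [p = - c = a + b], [q = - b], [r = - a], after reordering. *)
Lemma hexagon_series_opp lam : symmetric2 lam -> cleared_equation lam ->
  let G := exp2 (varA + varB) * subst2 lam (- varC) (- varA)
    + exp2 varB * subst2 lam (- varB) (- varA) + subst2 lam (- varB) (- varC) in
  varA * varB * (varA + varB) * G
    = (varA + varB) * exp2 varB - varB * exp2 (varA + varB) - varA.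
Proof.
move=> sym lamE.
have [FA FB FC] := And3 (filN fil2_varA) (filN fil2_varB) (filN fil2_varC).
have EC : - varC = varA + varB by rewrite /varC opprK.
have EA : - varA = - (- varC + - varB) by rewrite EC addrK.
have := cleared_equation_subst FC FB EA lamE.
rewrite (symmetric2_subst2 sym FC FB) (opprK varB) EC.
have : forall (R : comNzRingType) (a b g1 g2 g3 et eb : R),
    (a + b) * (- b) * (- a) * (g3 + eb * g2 + et * g1) = - a + (a + b) * eb + - b * et ->
    a * b * (a + b) * (et * g1 + eb * g2 + g3) = (a + b) * eb - b * et - a.
  move=> R a b g1 g2 g3 et eb E.
  have -> : (a + b) * eb - b * et - a = - a + (a + b) * eb + - b * et by ring.
  by rewrite -E; ring.
by move=> /(_ fps2) E /E.
Qed.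

(** * Inverses of noncommutative power series *)

Lemma geometric_series (A : algType rat) (F : filtration A) (u g : A) :
  F 1 u -> is_sum F (fun n => u ^+ n) g -> (1 - u) * g = 1 /\ g * (1 - u) = 1.
Proof.
move=> Fu ug; have E N : (1 - u) * (\sum_(n < N) u ^+ n) = 1 - u ^+ N.
  by rewrite -[LHS]opprK -mulNr opprB -subrX1 opprB.
have cu N : GRing.comm (1 - u) (\sum_(n < N) u ^+ n).
  apply: commr_sum => n _; apply/commr_sym/commrB; first exact: commr1.
  exact/commr_sym/commrX.
have tail N : eqm F N (1 - u ^+ N) 1.
  by rewrite /eqm addrAC subrr add0r; apply/filN/filX1.
split; apply: (eqm_sep (F := F)) => N; apply: eqm_trans _ (tail N); rewrite -E.
  by apply: eqmM (ug N); apply: eqm_eq.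
by rewrite cu; apply: eqmM (ug N) _; apply: eqm_eq.
Qed.

Section NCInverse.
Variable G : Type.
Implicit Types f g : ncseries G.

Lemma nc_inv_uniq f g : g * f = 1 -> f * g = 1 -> f^-1 = g.
Proof.
move=> gf fg; have fU : f \is a GRing.unit by apply/unitrP; exists g.
by rewrite -[LHS]mulr1 -fg mulrA mulVr // mul1r.
Qed.

Lemma nc_mulVf f : f [::] = 1 -> f^-1 * f = 1 /\ f * f^-1 = 1.
Proof.
move=> f1; pose u := 1 - f.
have Fu : ncfil 1 u by apply/ncfil1P; rewrite -[LHS]/(1 - f [::]) f1 subrr.
pose g := NCSeries (fun w => \sum_(n < (size w).+1) (u ^+ n) w).
have ug : is_sum ncfil (fun n => u ^+ n) g.
  move=> N; apply/eqm_ncP => w lt_w.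
  have /eqm_ncP E := eqm_sum_widen (fun n => filX1 n Fu) lt_w.
  by rewrite E // nc_sumE.
have [] := geometric_series Fu ug; rewrite /u subKr => fg gf.
by rewrite (nc_inv_uniq gf fg).
Qed.

End NCInverse.

Lemma nc_exp_inv (G : Type) (f : ncseries G) : ncfil 1 f ->
  (nc_exp f)^-1 = nc_exp (- f).
Proof.
move=> Ff; have FNf := filN Ff.
have [E EN] := (is_exp_nc_exp Ff, is_exp_nc_exp FNf).
have cf : GRing.comm f (- f) by apply/commrN.
have E1 : nc_exp f * nc_exp (- f) = 1.
  have := is_expD Ff FNf cf E EN; rewrite subrr => E0.
  exact: is_sum_uniq E0 (is_exp0 _).
have E2 : nc_exp (- f) * nc_exp f = 1.
  have := is_expD FNf Ff (commr_sym cf) EN E; rewrite addNr => E0.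
  exact: is_sum_uniq E0 (is_exp0 _).
exact: nc_inv_uniq E2 E1.
Qed.

Lemma is_exp_Rmat : is_exp ncfil (1 *: t 1 2) Rmat.
Proof. by rewrite scale1r; apply/is_exp_nc_exp/t_fil. Qed.

Lemma is_exp_Rmat_inv : is_exp ncfil ((-1) *: t 1 2) Rmat^-1.
Proof.
rewrite /Rmat nc_exp_inv ?scaleN1r; last exact: t_fil.
by apply/is_exp_nc_exp/filN/t_fil.
Qed.

Lemma Phi_of_nil lam : Phi_of lam [::] = 1.
Proof.
rewrite Phi_ofE; have /(_ [::] isT) : ncfil 1 (Lam lam (@t 3 1 2) (t 2 3)).
  have [F12 F23] : ncfil 1 (@t 3 1 2) /\ ncfil 1 (@t 3 2 3) by split; apply: t_fil.
  apply: fil_le (leqnSn 1) _.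
  by do 2?apply: filB; apply: filMr; do ?apply: filMl; apply: bracket_fil.
by move=> L0; rewrite -[LHS]/(1 + Lam lam (t 1 2) (t 2 3) [::]) L0 addr0.
Qed.

(** * The hexagons for a solution of the equation *)

Section Hexagons.
Variable lam : fps2.
Notation Q := (chordQ 3).
Notation F := (qfil 3).
Let a : Q := pr (t 1 2).
Let b : Q := pr (t 2 3).
Let c : Q := pr (t 1 3).
Let F2comm := @chordQ_comm 3.

Let Fpr i j : F 1 (pr (t i j)).
Proof. by apply: (chom_fil (chom_pr 3)); apply: t_fil. Qed.

Let four_abc : four_term a b c.
Proof. exact: prt_four_term. Qed.

Variables (eps : rat) (R : freeA 2).
Hypotheses (eps2 : eps * eps = 1) (R_exp : is_exp ncfil (eps *: t 1 2) R).
(** Both hexagons at once, [eps] being 1 or -1. In series relative to [L], [varA] stands for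
    [T x = eps T b] and [varB] for [T y = eps T c], so the variables correspond to the chords [b]
    and [c], whereas those of [lam] correspond to [a] and [b]. *)
Let x := eps *: b.
Let y := eps *: c.
Let Fx : F 1 x. Proof. exact/filZ/Fpr. Qed.
Let Fy : F 1 y. Proof. exact/filZ/Fpr. Qed.
Let e := bracket x y.
Notation L := (Lev F (T x) (T y) e).

Let TZ u z v : T (v *: u) z = v *: T u z :> Q.
Proof. by rewrite /T -scalerAr -scalerAl scalerBr. Qed.

Let bx : b = eps *: x. Proof. by rewrite scalerA eps2 scale1r. Qed.
Let cy : c = eps *: y. Proof. by rewrite scalerA eps2 scale1r. Qed.

Let e_bc : e = bracket b c.
Proof.
by rewrite /e /bracket -!scalerAl -!scalerAr !scalerA eps2 !scale1r.
Qed.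

Let Ce : C F e. Proof. exact: C_bracket. Qed.

Let scaleM v (p f : fps2) : v *: (p * f) = (v *: p) * f.
Proof. by rewrite scalerAl. Qed.

Let L_b f z : L f z -> L ((eps *: varA) * f) (T b z).
Proof.
move=> fz; rewrite bx TZ; apply: (Lev_cast (scaleM eps varA f) erefl).
by apply: LevZ; apply: LevT_varA.
Qed.

Let L_c f z : L f z -> L ((eps *: varB) * f) (T c z).
Proof.
move=> fz; rewrite cy TZ; apply: (Lev_cast (scaleM eps varB f) erefl).
by apply: LevZ; apply: LevT_varB.
Qed.

(* The sum of the three chords is central, so [a] acts on commutators as
   [- (b + c)]. *)
Let T_sum z f : L f z -> T (a + b + c) z = 0.
Proof.
have [r1 r2 r3] := four_abc; have bracket_scale u v w : bracket u (w *: v) = w *: bracket u v :> Q.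
  by rewrite /bracket -scalerAr -scalerAl scalerBr.
apply: LevT_central => //; first by do 2?apply: filD; apply: Fpr.
  rewrite bracket_scale addrAC [a + c]addrC bracketDl r3.
  by rewrite /bracket subrr addr0 scaler0.
by rewrite bracket_scale bracketDl r1 /bracket subrr addr0 scaler0.
Qed.

Let L_a f z : L f z -> L ((eps *: varC) * f) (T a z).
Proof.
move=> fz; have Ta : T a z = eps *: - T (x + y) z.
  have Tb : T b z = eps *: T x z by rewrite [in LHS]bx TZ.
  have Tc : T c z = eps *: T y z by rewrite [in LHS]cy TZ.
  have sz := T_sum fz; rewrite -[LHS]subr0 -sz !TDl Tb Tc scalerN (scalerDr eps (T x z)).
  have cancel (p u v : Q) : p - (p + u + v) = - (u + v).
    by rewrite -addrA opprD addrA subrr add0r.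
  exact: cancel.
have E : eps *: (- ((varA + varB) * f)) = (eps *: varC) * f.
  by rewrite -mulNr scalerAl.
apply: (Lev_cast E (esym Ta)); apply: LevZ; apply: LevN.
exact: (LevT_AB F2comm Fx Fy Ce).
Qed.

Let pr_mul5 (f1 f2 f3 f4 f5 : freeA 3) (g1 g3 g5 : Q) :
  pr f1 = g1 -> pr f3 = g3 -> pr f5 = g5 ->
  pr (f1 * f2 * f3 * f4 * f5) = g1 * pr f2 * g3 * pr f4 * g5.
Proof. by move=> <- <- <-; rewrite !(chomM (chom_pr 3)). Qed.

Lemma hexagon_Phi_of_scaled :
  (let G := exp2 (varA + varB) * subst2 lam (eps *: varC) (eps *: varA)
     + exp2 varB * subst2 lam (eps *: varB) (eps *: varA)
     + subst2 lam (eps *: varB) (eps *: varC) in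
   varA * varB * (varA + varB) * G
     = (varA + varB) * exp2 varB - varB * exp2 (varA + varB) - varA) ->
  hexagon R (Phi_of lam).
Proof.
move=> HG; apply/eq2FFP; have Cp := chom_pr 3.
have [yab zab] := four_termP four_abc.
have [FA FB FC] := And3 (filZ eps fil2_varA) (filZ eps fil2_varB) (filZ eps fil2_varC).
have Ft i j : ncfil 1 (@t 3 i j) by apply: t_fil.
have exp_relabel i j : is_exp F (eps *: pr (t i j)) (pr (relabel [:: i; j] R)).
  have Cr := chom_relabel 2 3 [:: i; j].
  have := chom_exp Cp (chom_exp Cr R_exp).
  by rewrite (chomZ Cr) (chomZ Cp) relabel_t.
have exp_D1 : is_exp F (x + y) (pr (D1 R)).
  have Cc := chom_cable 2 3 [:: [:: 1%N; 2%N]; [:: 3%N]].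
  have := chom_exp Cp (chom_exp Cc R_exp).
  rewrite (chomZ Cc) (chomZ Cp) cable_t //= !big_cons !big_nil !addr0 (chomD Cp).
  by rewrite /x /y -scalerDr addrC.
have Lp1 : L (subst2 lam (eps *: varC) (eps *: varA)) (pr (Lam lam (t 1 2) (t 2 3))).
  have := Lev_Lam lam (Ft 1%N 2%N) (Ft 2%N 3%N); rewrite -/a -/b -yab -e_bc => H.
  exact: (Lev_subst FC FA L_a L_b H).
(* The relabeling 132 produces the bracket [[c, b] = - e], and the sign of the inverse turns it back
   into [e]. *)
have Lp2 : L (subst2 lam (eps *: varB) (eps *: varA)) (- pr (Lam lam (t 1 3) (t 2 3))).
  apply: (Lev_subst FB FA L_c L_b).
  have := Lev_Lam lam (Ft 1%N 3%N) (Ft 2%N 3%N); rewrite -/c -/b (bracketC b c) -e_bc.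
  exact: (Lev_oppw (raising_T (Fpr 1%N 3%N)) (raising_T (Fpr 2%N 3%N))).
have Lp3 : L (subst2 lam (eps *: varB) (eps *: varC)) (pr (Lam lam (t 1 3) (t 1 2))).
  have := Lev_Lam lam (Ft 1%N 3%N) (Ft 1%N 2%N); rewrite -/c -/a zab -yab -e_bc => H.
  exact: (Lev_subst FB FC L_c L_a H).
have := hexagon_2FF F2comm Fx Fy (exp_relabel 2%N 3%N) (exp_relabel 1%N 3%N) exp_D1
  Lp1 Lp2 Lp3 HG.
have Cinv : chom ncfil F (fun f : freeA 3 => pr (relabel [:: 1%N; 3%N; 2%N] f)).
  exact (chom_comp (chom_relabel 3 3 [:: 1%N; 3%N; 2%N]) Cp).
(* Modulo 2FF the square of [p] vanishes, so [1 - p] is inverse to [1 + p]. *)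
have inv : pr (@relabel 3 3 [:: 1%N; 3%N; 2%N] (Phi_of lam)^-1)
    = 1 - pr (Lam lam (t 1 3) (t 2 3)).
  have [F2p p0] : C F (- pr (Lam lam (t 1 3) (t 2 3))) := LevT_C Ce Lp2.
  have := congr1 (fun f : freeA 3 => pr (@relabel 3 3 [:: 1%N; 3%N; 2%N] f))
    (proj2 (nc_mulVf (Phi_of_nil lam))).
  rewrite (chomM Cinv) (chom1 Cinv) -/a.
  rewrite (pr_chom_Phi_of _ (chom_relabel 3 3 [:: 1%N; 3%N; 2%N]) (erefl _) (erefl _)).
  rewrite !relabel_t //= (t_sym 3 3 2).
  set p := pr (Lam _ _ _) in F2p p0 *; set q := pr (relabel _ _) => pq.
  suff : q = 1 - p by [].
  have -> : q = (1 - p) * ((1 + p) * q) + ((- p) * (- p)) * q by non_commutative_ring.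
  by rewrite pq p0 // mul0r addr0 mulr1.
have p3E : pr (@relabel 3 3 [:: 3%N; 1%N; 2%N] (Phi_of lam))
    = 1 + pr (Lam lam (t 1 3) (t 1 2)).
  apply: (pr_chom_Phi_of _ (chom_relabel 3 3 [:: 3%N; 1%N; 2%N])); by rewrite relabel_t.
have p1E : pr (Phi_of lam) = 1 + pr (Lam lam (t 1 2) (t 2 3)).
  exact: etrans (congr1 _ (Phi_ofE lam)) (chomD Cp _ _).
move=> ->; exact: esym (pr_mul5 _ _ p1E inv p3E).
Qed.

End Hexagons.

Lemma hexagons_Phi_of lam : symmetric2 lam -> lambda_equation lam ->
  pos_hexagon (Phi_of lam) /\ neg_hexagon (Phi_of lam).
Proof.
move=> sym /lambda_equationP lamE; split.
  apply: (hexagon_Phi_of_scaled _ is_exp_Rmat); first by [].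
  by rewrite !scale1r; apply: hexagon_series.
apply: (hexagon_Phi_of_scaled _ is_exp_Rmat_inv); first by [].
by rewrite !scaleN1r; apply: hexagon_series_opp.
Qed.

(** * A linear invariant modulo 2FF *)

Section FoxDerivative.
Variables (G : finType) (v : G -> fps2) (k : G -> rat).
Hypothesis Fv : forall x, fil2 1 (v x).
Notation ab := (abel v).
Let Cab := chom_abel Fv.

(* The Fox derivative that is [k x] on the letter [x], with the left factors
   augmented and the right ones abelianized. *)
Definition fox (f : ncseries G) : fps2 := \sum_x k x *: ab (shift x f).

Lemma fox_linear : linear fox.
Proof.
move=> c f g; rewrite /fox scaler_sumr -big_split /=; apply: eq_bigr => x _.
by rewrite shift_linear (chom_linear Cab) scalerDr !scalerA mulrC.
Qed.

Lemma foxD f g : fox (f + g) = fox f + fox g.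
Proof. by have := fox_linear 1 f g; rewrite !scale1r. Qed.

Lemma fox0 : fox 0 = 0.
Proof. by apply: (addrI (fox 0)); rewrite -foxD !addr0. Qed.

Lemma foxZ c f : fox (c *: f) = c *: fox f.
Proof. by have := fox_linear c f 0; rewrite fox0 !addr0. Qed.

Lemma foxN f : fox (- f) = - fox f.
Proof. by rewrite -scaleN1r foxZ scaleN1r. Qed.

Lemma foxB f g : fox (f - g) = fox f - fox g.
Proof. by rewrite foxD foxN. Qed.

Lemma foxM f g : fox (f * g) = f [::] *: fox g + fox f * ab g.
Proof.
rewrite /fox scaler_sumr mulr_suml -big_split /=; apply: eq_bigr => x _.
rewrite shift_mul (chomD Cab) (chomZ Cab) (chomM Cab) scalerDr !scalerA mulrC.
by congr (_ + _); rewrite scalerAl.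
Qed.

Lemma fox1 : fox 1 = 0.
Proof.
rewrite /fox big1 // => x _; have -> : shift x 1 = 0 :> ncseries G by apply: ncseriesP.
by rewrite (chom0 Cab) scaler0.
Qed.

Lemma fox_fil N f : ncfil N.+1 f -> fil2 N (fox f).
Proof. by move=> Ff; apply: fil_sum => x _; apply/filZ/(chom_fil Cab)/shift_fil. Qed.

Lemma fox_letter x : fox (letter x) = k x *: 1.
Proof.
rewrite /fox (bigD1 x) // big1 => [|y ne_yx].
  by apply: etrans (addr0 _) _; rewrite shift_letter eqxx scale1r (chom1 Cab).
by rewrite shift_letter [y == x](negPf ne_yx) scale0r (chom0 Cab) scaler0.
Qed.

Lemma abel_bracket (f g : ncseries G) : ab (bracket f g) = 0.
Proof. by rewrite (chom_bracket Cab) /bracket (mulrC (ab f)) (subrr (ab g * ab f)). Qed.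

Lemma fox_bracket (f g : ncseries G) : f [::] = 0 -> g [::] = 0 ->
  fox (bracket f g) = fox f * ab g - fox g * ab f.
Proof.
have E (V : lmodType rat) (l : rat) (x y z : V) : l = 0 -> z = l *: x + y -> z = y.
  by move=> -> ->; rewrite scale0r add0r.
move=> f0 g0; rewrite /bracket foxB.
by rewrite (E _ _ _ _ _ f0 (foxM f g)) (E _ _ _ _ _ g0 (foxM g f)).
Qed.

Lemma abel_nc_eval p X Y : ncfil 1 X -> ncfil 1 Y ->
  ab (nc_eval p X Y) = subst2 p (ab X) (ab Y).
Proof.
move=> FX FY; have [FX' FY'] := (chom_fil Cab FX, chom_fil Cab FY).
exact: Lev_uniq (chom_Lev Cab (Lev_nc_eval p FX FY)) (Lev_subst2 p FX' FY').
Qed.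

Lemma abel_nc_exp X : ncfil 1 X -> ab (nc_exp X) = exp2 (ab X).
Proof.
move=> FX; have FX' := chom_fil Cab FX.
exact: is_sum_uniq (chom_exp Cab (is_exp_nc_exp FX)) (is_exp_exp2 FX').
Qed.

Lemma nc_exp_nil (X : ncseries G) : nc_exp X [::] = 1.
Proof.
rewrite -[LHS]/(\sum_(n < 1) (X ^+ n) [::] / (n`!)%:R) big_ord1 expr0.
by rewrite fact0 divr1.
Qed.

(** Apply the derivative to [exp(X) X = X exp(X)]. The factor [ab X] is kept, since it may fail to
    be invertible. *)
Lemma fox_nc_exp X : ncfil 1 X ->
  fox (nc_exp X) * ab X = fox X * (exp2 (ab X) - 1).
Proof.
move=> FX; have X0 : X [::] = 0 by apply/ncfil1P.
have E : fox (nc_exp X * X) = fox (X * nc_exp X).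
  by rewrite (is_exp_comm _ (is_exp_nc_exp FX)).
move: E; rewrite !foxM X0 nc_exp_nil scale0r scale1r add0r (abel_nc_exp FX) => E.
have cancel (R : pzRingType) (x y z : R) : y + x = y * z -> x = y * (z - 1).
  by move=> xyz; rewrite mulrBr mulr1 -xyz addrAC subrr add0r.
exact: cancel E.
Qed.

(** By the product rule, [fox f = 0] passes to left multiples when [ab f = 0] and to right multiples
    when the constant term is zero; hence the three conditions together. *)
Lemma closed_ideal_fox : closed_ideal [set f : ncseries G | [/\ f [::] = 0, ab f = 0 & fox f = 0]]%classic.
Proof.
split=> /=.
- by rewrite (chom0 Cab) fox0.
- move=> f g [f0 fa ff] [g0 ga gf]; rewrite (chomD Cab) foxD fa ga ff gf !addr0.
  by split=> //; rewrite -[LHS]/(f [::] + g [::]) f0 g0 addr0.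
- move=> f g [g0 ga gf]; rewrite big_ord1 g0 mulr0 (chomM Cab) ga mulr0 foxM gf.
  by rewrite scaler0 ga mulr0 addr0.
- move=> f g [f0 fa ff]; rewrite big_ord1 f0 mul0r (chomM Cab) fa mul0r foxM ff.
  by rewrite f0 scale0r mul0r addr0.
move=> f If; split.
- by have [g /= [g0 _ _] fg] := If 0%N; rewrite fg.
- apply: (eqm_sep (F := fil2)) => N; have [g /= [_ ga _] fg] := If N.
  rewrite -ga; apply: (chom_eqm Cab); apply/eqm_ncP => w /ltnW; exact: fg.
- apply: (eqm_sep (F := fil2)) => N; have [g /= [_ _ gf] fg] := If N.
  rewrite -gf /eqm -foxB; apply: fox_fil; apply/eqm_ncP => w; rewrite ltnS; exact: fg.
Qed.

End FoxDerivative.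

Section FoxChord.
Definition chord_var (x : chord 3) : fps2 :=
  if (val x).2 == 2%N :> nat then varA
  else if (val x).1 == 2%N :> nat then varB else varC.
(** Like the variables, the weights of the three chords sum to zero, which makes the derivative of
    every four-term relation vanish. This choice gives [[a, b]] the derivative [b]. *)
Definition chord_weight (x : chord 3) : rat :=
  if (val x).2 == 2%N :> nat then 1
  else if (val x).1 == 2%N :> nat then 0 else -1.
Notation ab := (abel chord_var).
Notation tau := (fox chord_var chord_weight).

Lemma chord_var_fil x : fil2 1 (chord_var x).
Proof.
by rewrite /chord_var; case: ifP => _; [|case: ifP => _];
   [exact: fil2_varA|exact: fil2_varB|exact: fil2_varC].
Qed.
Let Fv := chord_var_fil.
Let Cab := chom_abel Fv.

Let chord_value i j : (0 < i)%N -> (i < j)%N -> (j <= 3)%N ->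
  ab (t i j) = (if j == 2%N then varA else if i == 2%N then varB else varC)
  /\ tau (t i j) = (if j == 2%N then 1 else if i == 2%N then 0 else -1) *: 1.
Proof.
move=> i0 ij j3; have [x -> [x1 x2]] := chord_letter i0 ij j3.
by rewrite (abel_letter Fv) (fox_letter _ Fv) /chord_var /chord_weight x1 x2.
Qed.

Lemma abel_t12 : ab (t 1 2) = varA. Proof. by case: (@chord_value 1 2). Qed.
Lemma abel_t23 : ab (t 2 3) = varB. Proof. by case: (@chord_value 2 3). Qed.
Lemma abel_t13 : ab (t 1 3) = varC. Proof. by case: (@chord_value 1 3). Qed.
Lemma fox_t12 : tau (t 1 2) = 1.
Proof. by have [_ ->] := @chord_value 1 2 isT isT isT; rewrite scale1r. Qed.
Lemma fox_t23 : tau (t 2 3) = 0.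
Proof. by have [_ ->] := @chord_value 2 3 isT isT isT; rewrite scale0r. Qed.
Lemma fox_t13 : tau (t 1 3) = -1.
Proof. by have [_ ->] := @chord_value 1 3 isT isT isT; rewrite scaleN1r. Qed.

Let t_nil i j : @t 3 i j [::] = 0.
Proof. by apply/ncfil1P/t_fil. Qed.

Let relation_sum (R : comNzRingType) (u1 u2 u3 w1 w2 w3 : R) :
  u1 + u2 + u3 = 0 -> w1 + w2 + w3 = 0 -> (w1 + w2) * u3 - w3 * (u1 + u2) = 0.
Proof.
by move=> /addr0_eq <- /addr0_eq <-; ring.
Qed.

Lemma strands3 i j k : strands 3 [:: i; j; k] ->
  (i, j, k) \in [:: (1, 2, 3); (1, 3, 2); (2, 1, 3); (2, 3, 1); (3, 1, 2); (3, 2, 1)]%N.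
Proof.
by case: i => [|[|[|[|i]]]]; case: j => [|[|[|[|j]]]]; case: k => [|[|[|[|k]]]];
   rewrite /strands /= ?andbF.
Qed.

(** On three strands the commutation relations of disjoint chords form an empty family. *)
Lemma strands3_4 i j k l : ~~ strands 3 [:: i; j; k; l].
Proof.
apply/negP => /andP[uniq_s all_s].
have sub : {subset [:: i; j; k; l] <= [:: 1; 2; 3]%N}.
  by move=> x /(allP all_s); case: x => [|[|[|[|x]]]].
by have := uniq_leq_size uniq_s sub.
Qed.

Lemma ideal2FF_fox f : f \in ideal2FF 3 -> [/\ f [::] = 0, ab f = 0 & tau f = 0].
Proof.
apply: ideal2FF_sub (closed_ideal_fox _ Fv) _ _.
have tau_bracket (X Y : freeA 3) : X [::] = 0 -> Y [::] = 0 ->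
    tau X * ab Y - tau Y * ab X = 0 ->
    [/\ bracket X Y [::] = 0, ab (bracket X Y) = 0 & tau (bracket X Y) = 0].
  move=> X0 Y0 E; rewrite (abel_bracket Fv) (fox_bracket _ Fv) //; split=> //.
  rewrite -[LHS]/((X * Y) [::] - (Y * X) [::]) !ncM_nil X0 Y0.
  by rewrite mul0r subrr.
have sumABC : varA + varB + varC = 0 by rewrite /varC subrr.
have sum_w : 1 + 0 + -1 = 0 :> fps2 by rewrite addr0 subrr.
move=> {}f [[[i [j [k [/strands3 sijk ->]]]]|[i [j [k [l [sijkl _]]]]]]|].
- apply: tau_bracket; rewrite ?t_nil //.
    by rewrite -[LHS]/(t i j [::] + t j k [::]) !t_nil addr0.
  rewrite (foxD _ Fv) (chomD Cab).
  have [T21 T31 T32] := And3 (t_sym 3 2 1) (t_sym 3 3 1) (t_sym 3 3 2).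
  have perm3 (a b c : fps2) : a + b + c = 0 ->
      [/\ a + c + b = 0, b + a + c = 0, b + c + a = 0, c + a + b = 0 & c + b + a = 0].
    by move=> E; split; rewrite -E; [rewrite addrAC|rewrite [b + a]addrC|
      rewrite addrC addrA|rewrite addrAC [c + b]addrC addrC addrA|
      rewrite addrC addrA addrAC addrC addrA].
  have [u1 u2 u3 u4 u5] := perm3 _ _ _ sumABC.
  have [w1 w2 w3 w4 w5] := perm3 _ _ _ sum_w.
  apply: relation_sum; move: sijk; rewrite !inE !xpair_eqE;
    do ![case/orP]; case/andP => /andP[/eqP-> /eqP->] /eqP->;
    rewrite ?T21 ?T31 ?T32 ?abel_t12 ?abel_t23 ?abel_t13 ?fox_t12 ?fox_t23 ?fox_t13 //.
- by have := strands3_4 i j k l; rewrite sijkl.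
case=> w [x [y [le_w ->]]].
have : (\prod_(c <- w) letter c : freeA 3) [::] = 0.
  by case: w le_w => // c w _; rewrite big_cons ncM_nil mul0r.
move: (\prod_(c <- w) letter c) => u u0.
suff : [/\ (u * bracket x y) [::] = 0, ab (u * bracket x y) = 0
          & tau (u * bracket x y) = 0] by [].
rewrite ncM_nil u0 mul0r (chomM Cab) (foxM _ Fv) u0 scale0r add0r.
by rewrite (abel_bracket Fv) !mulr0.
Qed.

Lemma prP_fox (f g : freeA 3) : pr f = pr g ->
  [/\ f [::] = g [::], ab f = ab g & tau f = tau g].
Proof.
move=> /prP/ideal2FF_fox; rewrite (chomB Cab) (foxB _ Fv) => -[fg0 fga fgt].
by split; apply: subr0_eq.
Qed.

(** In the terms with partial derivatives, a factor without constant term precedes a bracket whose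
    abelianization is zero, so they contribute nothing. *)
Lemma fox_Lam lam (X Y : freeA 3) : ncfil 1 X -> ncfil 1 Y ->
  tau (Lam lam X Y) = (tau X * ab Y - tau Y * ab X) * subst2 lam (ab X) (ab Y)
  /\ ab (Lam lam X Y) = 0.
Proof.
move=> FX FY; have [X0 Y0] : X [::] = 0 /\ Y [::] = 0 by split; apply/ncfil1P.
have E0 : ab (bracket X Y) = 0 := abel_bracket Fv X Y.
have Z (U : freeA 3) : U [::] = 0 -> forall V : freeA 3,
    tau (U * bracket X Y * V) = 0 /\ ab (U * bracket X Y * V) = 0.
  move=> U0 V; rewrite !(chomM Cab) E0 mulr0 mul0r; split=> //.
  rewrite !(foxM _ Fv) ncM_nil U0 mul0r scale0r add0r scale0r add0r E0.
  by rewrite mulr0 mul0r.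
rewrite /Lam !(foxB _ Fv) !(chomB Cab) !(proj1 (Z _ _ _)) // !(proj2 (Z _ _ _)) //.
rewrite !subr0 (chomM Cab) E0 mul0r; split=> //.
have b0 : bracket X Y [::] = 0.
  by rewrite -[LHS]/((X * Y) [::] - (Y * X) [::]) !ncM_nil X0 mul0r mulr0 subrr.
by rewrite (foxM _ Fv) b0 scale0r add0r (fox_bracket _ Fv) // (abel_nc_eval Fv).
Qed.

End FoxChord.

(** * From the hexagon to the equation *)

Section RelabelDescent.
Variable s : seq nat.
Hypothesis hs : s \in [:: [:: 1; 3; 2]; [:: 3; 1; 2]; [:: 3; 2; 1]]%N.
Notation h := (@relabel 3 3 s).

Let size_s : size s = 3.
Proof. by move: hs; rewrite !inE => /or3P[] /eqP->. Qed.

Let strands_nth i j k : strands 3 [:: i; j; k] ->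
  strands 3 [:: nth 0%N s i.-1; nth 0%N s j.-1; nth 0%N s k.-1].
Proof.
move=> /strands3; rewrite !inE !xpair_eqE; move: hs; rewrite !inE.
by case/or3P => /eqP-> ; do ![case/orP]; case/andP => /andP[/eqP-> /eqP->] /eqP->.
Qed.

Let relabel_chord i j : (0 < i <= 3)%N -> (0 < j <= 3)%N -> i != j ->
  h (t i j) = t (nth 0%N s i.-1) (nth 0%N s j.-1).
Proof.
move=> hi hj ne_ij; apply: relabel_t; rewrite ?size_s //.
  by case/andP: hi.
by case/andP: hj.
Qed.

(** This lets a congruence between [nc_exp phi] and [Phi_of lam] pass through the relabelings in
    unitarity and the hexagon. *)
Lemma relabel_ideal f : f \in ideal2FF 3 -> h f \in ideal2FF 3.
Proof.
have Ch : chom ncfil ncfil h := chom_relabel 3 3 s.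
have [I0 ID Il Ir Ic] := ideal2FF_closed 3.
apply: (@ideal2FF_sub 3 [set f | h f \in ideal2FF 3]%classic).
  split=> [|u v hu hv|u v hv|u v hu|u hu].
  - by rewrite /= (chom0 Ch).
  - by rewrite /= (chomD Ch); apply: ID.
  - by rewrite /= (chomM Ch); apply: Il.
  - by rewrite /= (chomM Ch); apply: Ir.
  apply: Ic => N; have [v hv uv] := hu N; exists (h v) => // w le_w.
  have uv' : eqm ncfil N.+1 u v by apply/eqm_ncP.
  have /eqm_ncP := chom_eqm Ch uv'; apply; exact: le_w.
move=> {}f [[[i [j [k [sijk ->]]]]|[i [j [k [l [sijkl _]]]]]]|].
- have hE (p q : nat) : p \in [:: i; j; k] -> q \in [:: i; j; k] -> p != q ->
      h (t p q) = t (nth 0%N s p.-1) (nth 0%N s q.-1).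
    case/andP: sijk => _ /allP all_s hp hq; apply: relabel_chord; exact: all_s.
  have [ij ik jk] : [/\ i != j, i != k & j != k].
    by move: sijk => /andP[/=]; rewrite !inE !negb_or => /andP[/andP[? ?] /andP[? _]].
  suff : h (bracket (t i j + t j k) (t i k)) \in ideal2FF 3 by [].
  have [mi mj mk] : [/\ i \in [:: i; j; k], j \in [:: i; j; k] & k \in [:: i; j; k]].
    by rewrite !inE !eqxx !orbT.
  rewrite (chom_bracket Ch) (chomD Ch) (hE i j) // (hE j k) // (hE i k) //.
  apply/pr_eq0/pr_rel; left.
  by do 3!eexists; split; first exact: (strands_nth sijk).
- by have := strands3_4 i j k l; rewrite sijkl.
case=> w [x [y [le_w ->]]].
have Fw : ncfil 2 (\prod_(c <- w) letter c : freeA 3).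
  apply: (fil_le le_w); elim: w {le_w} => [|c w IHw]; first exact: fil_all.
  by rewrite big_cons; apply: (@filM _ ncfil 1) => //; apply/ncfil1P.
move: (\prod_(c <- w) letter c) Fw => u Fu.
suff : h (u * (x * y - y * x)) \in ideal2FF 3 by [].
rewrite (chomM Ch) (chomB Ch) !(chomM Ch); apply/pr_eq0.
(* The image of the word is not matched with another word: it still has order two, which is what
   [chordQ_comm] asks for. *)
have Fhu : qfil 3 2 (pr (h u)) by apply/(chom_fil (chom_pr 3))/(chom_fil Ch).
have Cp := chom_pr 3.
rewrite (chomM Cp) (chomB Cp) !(chomM Cp) mulrBr (chordQ_comm _ _ Fhu).
by rewrite subrr.
Qed.

Lemma relabel_pr f g : pr f = pr g -> pr (h f) = pr (h g).
Proof.
move=> /prP/relabel_ideal; rewrite (chomB (chom_relabel 3 3 s)) => fg.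
exact/prP.
Qed.

End RelabelDescent.

Section HexagonToEquation.
Notation ab := (abel chord_var).
Notation tau := (fox chord_var chord_weight).
Let Fv := chord_var_fil.
Let Cab := chom_abel Fv.
Let Ft i j : ncfil 1 (@t 3 i j). Proof. exact: t_fil. Qed.
Let FA := fil2_varA.
Let FB := fil2_varB.
Let FC := fil2_varC.

Lemma fox_Lam_t12_t23 lam : tau (Lam lam (t 1 2) (t 2 3)) = varB * lam.
Proof.
rewrite (proj1 (fox_Lam _ _ _)) // fox_t12 fox_t23 abel_t12 abel_t23 mul0r subr0.
by rewrite mul1r subst2_id.
Qed.

Let relabel_Phi s X Y lam : @relabel 3 3 s (t 1 2) = X -> @relabel 3 3 s (t 2 3) = Y ->
  @relabel 3 3 s (Phi_of lam) = 1 + Lam lam X Y.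
Proof.
have Ch := chom_relabel 3 3 s => <- <-.
by rewrite Phi_ofE (chomD Ch) (chom1 Ch) (chom_Lam _ Ch).
Qed.

Let fox_1Lam lam (X Y : freeA 3) : ncfil 1 X -> ncfil 1 Y ->
  [/\ (1 + Lam lam X Y) [::] = 1, ab (1 + Lam lam X Y) = 1
    & tau (1 + Lam lam X Y) = (tau X * ab Y - tau Y * ab X) * subst2 lam (ab X) (ab Y)].
Proof.
move=> FX FY; have [tL aL] := fox_Lam lam FX FY.
rewrite (chomD Cab) (chom1 Cab) aL addr0 (foxD _ Fv) (fox1 _ Fv) add0r tL; split=> //.
have /(_ [::] isT) L0 : ncfil 1 (Lam lam X Y).
  apply: fil_le (leqnSn 1) _.
  by do 2?apply: filB; apply: filMr; do ?apply: filMl; apply: bracket_fil.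
by rewrite -[LHS]/(1 + Lam lam X Y [::]) L0 addr0.
Qed.

Let coef2_swap f i j : subst2 f varB varA i j = f j i.
Proof.
suff -> : subst2 f varB varA = mk2 (fun i j => f j i) by [].
apply: Lev_uniq (Lev_subst2 f FB FA) _ => N; apply/eqm2P => k l lt_kl.
have := @Lev_id f N => /eqm2P/(_ l k); rewrite addnC => /(_ lt_kl) E.
rewrite mk2E E !coef2_sum; apply: eq_bigr => i' _.
rewrite !coef2_sum; apply: eq_bigr => j' _; rewrite !monom_mul.
have -> : varB ^+ i' * varA ^+ j' = varA ^+ j' * varB ^+ i' by rewrite mulrC.
by rewrite !coef2Z !coef2_monom andbC.
Qed.

Let unitarity_value (A : comAlgType rat) (k : rat) (u v y a b s1 s2 : A) :
  k = 1 -> y = 1 -> u = (0 * a - 1 * b) * s2 -> v = (1 * b - 0 * a) * s1 ->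
  k *: u + v * y = 0 -> b * s1 - b * s2 = 0.
Proof.
move=> -> -> -> ->; rewrite scale1r mulr1 !mul0r !mul1r sub0r subr0 mulNr.
by rewrite addrC.
Qed.

(** The derivatives of the two factors add up to [b lam(a, b) - b lam(b, a) = 0], and [b]
    cancels. *)
Lemma symmetric_of_unitarity lam : unitarity (Phi_of lam) -> symmetric2 lam.
Proof.
move=> /eq2FFP/prP_fox[_ _]; rewrite (foxM _ Fv) (fox1 _ Fv).
rewrite (@relabel_Phi _ (t 2 3) (t 1 2)) ?relabel_t // Phi_ofE.
have [n1 a1 t1] := fox_1Lam lam (Ft 1%N 2%N) (Ft 2%N 3%N).
have [n2 a2 t2] := fox_1Lam lam (Ft 2%N 3%N) (Ft 1%N 2%N).
rewrite fox_t12 fox_t23 abel_t12 abel_t23 in t1 t2.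
move=> /(unitarity_value n1 a2 t2 t1); rewrite subst2_id => /subr0_eq.
move=> /(mulfI varB_neq0) E i j.
by rewrite [in LHS]E coef2_swap.
Qed.

Let is_exp_values X R : ncfil 1 X -> is_exp ncfil X R ->
  [/\ R [::] = 1, ab R = exp2 (ab X) & tau R * ab X = tau X * (exp2 (ab X) - 1)].
Proof.
move=> FX XR; have -> : R = nc_exp X by apply: is_sum_uniq XR (is_exp_nc_exp FX).
split; [exact: nc_exp_nil|exact: (abel_nc_exp Fv)|exact: (fox_nc_exp _ Fv)].
Qed.

Let inverse_values (P S : freeA 3) : P [::] = 1 -> ab P = 1 -> P * S = 1 ->
  [/\ S [::] = 1, ab S = 1 & tau S = - tau P].
Proof.
move=> P0 Pa PS; have S0 : S [::] = 1.
  by have := congr1 (fun f : freeA 3 => f [::]) PS; rewrite ncM_nil P0 mul1r.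
have Sa : ab S = 1 by have := congr1 ab PS; rewrite (chomM Cab) Pa mul1r (chom1 Cab).
have := congr1 tau PS; rewrite (foxM _ Fv) P0 Sa scale1r mulr1 (fox1 _ Fv).
by split=> //; apply/eqP; rewrite -addr_eq0; apply/eqP.
Qed.

Let fox_product5 (f1 f2 f3 f4 f5 : freeA 3) :
  f1 [::] = 1 -> f2 [::] = 1 -> f3 [::] = 1 -> f4 [::] = 1 -> ab f3 = 1 -> ab f5 = 1 ->
  tau (f1 * f2 * f3 * f4 * f5)
  = tau f5 + (tau f4 + (tau f3 + (tau f2 + tau f1 * ab f2)) * ab f4).
Proof.
move=> n1 n2 n3 n4 a3 a5.
have step (f g : freeA 3) : f [::] = 1 -> tau (f * g) = tau g + tau f * ab g.
  by move=> f1'; rewrite (foxM _ Fv) f1' scale1r.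
have nilM (f g : freeA 3) : f [::] = 1 -> g [::] = 1 -> (f * g) [::] = 1.
  by move=> f1' g1'; rewrite ncM_nil f1' g1' mulr1.
have n12 := nilM _ _ n1 n2; have n123 := nilM _ _ n12 n3.
have n1234 := nilM _ _ n123 n4.
rewrite (step _ f5 n1234) (step _ f4 n123) (step _ f3 n12) (step _ f2 n1).
by rewrite a3 a5 !mulr1.
Qed.

Let bracket_value_cb (K : comNzRingType) (b c s : K) :
  - ((-1 * b - 0 * c) * s) = b * s.
Proof. by ring. Qed.

Let bracket_value_ca (K : comNzRingType) (a b s : K) :
  (-1 * a - 1 * (- (a + b))) * s = b * s.
Proof. by ring. Qed.

Let addr_cancel (K : zmodType) (u v : K) : u + v = 0 -> u = - v.
Proof. by move=> uv; apply/eqP; rewrite -addr_eq0 uv. Qed.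

Let rewrite_summands (K : comNzRingType) (d x5 x4 x3 x2 x1 a2 a4 y5 y3 y2 y1 b2 b4 : K) :
  x5 = y5 -> x3 = y3 -> x2 = y2 -> x1 = y1 -> a2 = b2 -> a4 = b4 ->
  d = x5 + (x4 + (x3 + (x2 + x1 * a2)) * a4) ->
  d = y5 + (x4 + (y3 + (y2 + y1 * b2)) * b4).
Proof. by move=> -> -> -> -> -> ->. Qed.

(** The derivatives [tC] of the factor on strands 1 and 3 and [tD] of the left-hand side are known
    only after multiplication by [C] and [C + B]. Multiplying the differentiated hexagon by
    [EA * A * C] clears both, as [A = - (C + B)]. *)
Let hexagon_elimination (K : comNzRingType) (A B C lam l2 l3 EA EB EC eNB tC tD : K) :
  A = - (C + B) -> EA * EC = eNB -> EA * EB * EC = 1 ->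
  tC * C = -1 * (EC - 1) -> tD * (C + B) = -1 * (EB * EC - 1) ->
  tD = B * l3 + (tC + (B * l2 + (0 + B * lam * EB)) * EC) ->
  A * B * C * (lam + eNB * l2 + EA * l3) = C + A * eNB + B * EA.
Proof.
move=> AE <- H1 HC HD HtD.
transitivity (EA * (A * C * (tD - tC))).
  rewrite HtD; transitivity (A * B * C * (EA * EB * EC * lam + EA * EC * l2 + EA * l3)).
    by rewrite H1 mul1r.
  by ring.
have -> : A * C * (tD - tC) = - (C * (tD * (C + B))) - A * (tC * C) by rewrite AE; ring.
rewrite HD HC.
transitivity (C * (EA * EB * EC) - (A + C) * EA + A * (EA * EC)); first by ring.
by rewrite H1 AE; ring.
Qed.

Lemma hexagon_to_equation lam : symmetric2 lam -> pos_hexagon (Phi_of lam) ->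
  cleared_equation lam.
Proof.
move=> sym /eq2FFP/prP_fox[_ _].
have exp_relabel i j : is_exp ncfil (t i j) (@relabel 2 3 [:: i; j] Rmat).
  have Cr := chom_relabel 2 3 [:: i; j].
  by have := chom_exp Cr is_exp_Rmat; rewrite (chomZ Cr) scale1r relabel_t.
have exp_D1 : is_exp ncfil (t 1 3 + t 2 3) (D1 Rmat).
  have Cc := chom_cable 2 3 [:: [:: 1%N; 2%N]; [:: 3%N]].
  have := chom_exp Cc is_exp_Rmat.
  by rewrite (chomZ Cc) scale1r cable_t //= !big_cons !big_nil !addr0.
have [n0 a0 t0] := fox_1Lam lam (Ft 1%N 2%N) (Ft 2%N 3%N).
have [n1 a1 t1] := is_exp_values (Ft 2%N 3%N) (exp_relabel 2%N 3%N).
have [n3 a3 t3] := is_exp_values (Ft 1%N 3%N) (exp_relabel 1%N 3%N).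
have [_ _ tD] := is_exp_values (filD (Ft 1%N 3%N) (Ft 2%N 3%N)) exp_D1.
have [n4 a4 t4] := fox_1Lam lam (Ft 1%N 3%N) (Ft 1%N 2%N).
have [n2' a2' t2'] := fox_1Lam lam (Ft 1%N 3%N) (Ft 2%N 3%N).
have Cr := chom_relabel 3 3 [:: 1%N; 3%N; 2%N].
have PS : (1 + Lam lam (t 1 3) (t 2 3)) * @relabel 3 3 [:: 1%N; 3%N; 2%N] (Phi_of lam)^-1 = 1.
  rewrite -(@relabel_Phi [:: 1%N; 3%N; 2%N]) ?relabel_t //.
  by rewrite -(chomM Cr) (proj2 (nc_mulVf (Phi_of_nil lam))) (chom1 Cr).
have [n2 a2 t2] := inverse_values n2' a2' PS.
rewrite (@relabel_Phi [:: 3%N; 1%N; 2%N] (t 1 3) (t 1 2)) ?relabel_t //.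
have Fo := fox_product5 n0 n1 n2 n3 a2 a4.
rewrite {1}Phi_ofE => E; have {E Fo} E := etrans E Fo.
have t0' : tau (1 + Lam lam (t 1 2) (t 2 3)) = varB * lam.
  by rewrite t0 fox_t12 fox_t23 abel_t12 abel_t23 mul0r subr0 mul1r subst2_id.
have t2'' : tau (@relabel 3 3 [:: 1%N; 3%N; 2%N] (Phi_of lam)^-1)
    = varB * subst2 lam varC varB.
  rewrite t2 t2' fox_t13 fox_t23 abel_t13 abel_t23.
  exact: bracket_value_cb.
have t4' : tau (1 + Lam lam (t 1 3) (t 1 2)) = varB * subst2 lam varC varA.
  rewrite t4 fox_t13 fox_t12 abel_t13 abel_t12.
  exact: bracket_value_ca.
rewrite abel_t23 in a1; rewrite abel_t13 in a3.
have t1' : tau (@relabel 2 3 [:: 2%N; 3%N] Rmat) = 0.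
  apply: (mulIf varB_neq0); move: t1; rewrite fox_t23 abel_t23 => ->.
  by rewrite !mul0r.
rewrite fox_t13 abel_t13 in t3.
have tD' : tau (D1 Rmat) * (varC + varB) = -1 * (exp2 (varC + varB) - 1).
  move: tD; rewrite (chomD Cab) (foxD _ Fv) fox_t13 fox_t23 abel_t13 abel_t23.
  by rewrite addr0.
have EBC : exp2 (varC + varB) = exp2 varB * exp2 varC.
  by rewrite (addrC varC varB); exact: exp2D FB FC.
rewrite EBC in tD'.
have sumABC : varA + varB + varC = 0 by rewrite /varC subrr.
have EAC : exp2 varA * exp2 varC = exp2 (- varB).
  rewrite -(exp2D FA FC); congr exp2.
  by apply: addr_cancel; rewrite -sumABC (addrAC varA varB varC).
have EABC : exp2 varA * exp2 varB * exp2 varC = 1.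
  by rewrite -(exp2D FA FB) -(exp2D (filD FA FB) FC) sumABC exp2_0.
have AE : varA = - (varC + varB).
  by apply: addr_cancel; rewrite -sumABC (addrC varC varB) (addrA varA).
have E' := rewrite_summands t4' t2'' t1' t0' a1 a3 E.
have := hexagon_elimination AE EAC EABC t3 tD' E'.
by rewrite (symmetric2_subst2 sym FC FB) (symmetric2_subst2 sym FC FA).
Qed.

End HexagonToEquation.

(** * Lie series modulo 2FF *)

(** Division by [b], discarding the part free of [b]; in particular the constant that [fox] produces
    from the linear terms of a Lie series disappears. *)
Definition divB (f : fps2) : fps2 := mk2 (fun i j => f i j.+1).

Lemma divB_linear : linear divB.
Proof. by move=> c f g; apply: fps2P. Qed.

Lemma divB_fil N f : fil2 N.+1 f -> fil2 N (divB f).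
Proof. by move=> fN i j lt_ij; rewrite /divB mk2E fN // addnS ltnS. Qed.

Lemma divB_varB f : divB (varB * f) = f.
Proof. by apply: fps2P => i j; rewrite /divB mk2E coef2_varBM. Qed.

Lemma divB_const c : divB (c *: 1) = 0.
Proof. by apply: fps2P => i j; rewrite /divB mk2E coef2Z coef2_1 andbF mulr0. Qed.

Lemma linear_zero (R : pzRingType) (U V : lmodType R) (h : U -> V) :
  linear h -> h 0 = 0.
Proof.
by move=> lh; have := lh (-1) 0 0; rewrite scaler0 addr0 scaleN1r addNr.
Qed.

Lemma linear_sub3 (R : pzRingType) (V : lmodType R) k (x y z x1 y1 z1 x2 y2 z2 : V) :
  x = k *: x1 + x2 -> y = k *: y1 + y2 -> z = k *: z1 + z2 ->
  x - y - z = k *: (x1 - y1 - z1) + (x2 - y2 - z2).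
Proof.
by move=> -> -> ->; rewrite !scalerBr !opprD (addrACA (_ *: _)) (addrACA (_ - _)).
Qed.

Section LieSeries.
Notation F := (qfil 3).
Notation tau := (fox chord_var chord_weight).
Let Fv := chord_var_fil.
Let a : chordQ 3 := pr (t 1 2).
Let b : chordQ 3 := pr (t 2 3).
Let c : chordQ 3 := pr (t 1 3).
Let e := bracket a b.
Let F2comm := @chordQ_comm 3.
Let Ft i j : ncfil 1 (@t 3 i j). Proof. exact: t_fil. Qed.
Let Fpr i j : F 1 (pr (t i j)). Proof. exact: (chom_fil (chom_pr 3) (Ft i j)). Qed.
Let Fa : F 1 a := Fpr 1%N 2%N.
Let Fb : F 1 b := Fpr 2%N 3%N.
Let Ce : C F e. Proof. exact: (C_bracket F2comm Fa Fb). Qed.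
Notation L := (Lev F (T a) (T b) e).
Let LLam lam : L lam (pr (Lam lam (t 1 2) (t 2 3))).
Proof. exact: Lev_Lam. Qed.

Definition linear_part (f : freeA 3) : freeA 3 := \sum_x f [:: x] *: letter x.
(** The candidate series depends linearly and continuously on [f], so that the condition
    [lie_defect f = 0] passes to limits. *)
Definition lam_part (f : freeA 3) : freeA 3 := Lam (divB (tau f)) (t 1 2) (t 2 3).
Definition lie_defect f := pr f - pr (linear_part f) - pr (lam_part f).

Lemma linear_part_linear : linear linear_part.
Proof.
move=> k f g; rewrite /linear_part scaler_sumr -big_split /=.
by apply: eq_bigr => x _; rewrite scalerDl scalerA.
Qed.

Lemma linear_part_fil2 f : ncfil 2 f -> linear_part f = 0.
Proof. by move=> f2; rewrite /linear_part big1 // => x _; rewrite f2 // scale0r. Qed.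

Lemma pr_lam_part_linear : linear (fun f => pr (lam_part f)).
Proof.
move=> k f g; apply: Lev_uniq (LLam _) _; rewrite (fox_linear _ Fv) divB_linear.
exact: (LevD (LevZ k (LLam _)) (LLam _)).
Qed.

Lemma lie_defect_linear : linear lie_defect.
Proof.
have Cp := chom_linear (chom_pr 3) => k f g.
apply: (linear_sub3 (Cp k f g) _ (pr_lam_part_linear k f g)).
exact: etrans (congr1 _ (linear_part_linear k f g)) (Cp k _ _).
Qed.

(** [fox] and [divB] lose one degree each. *)
Lemma lie_defect_fil N f : ncfil N.+2 f -> F N (lie_defect f).
Proof.
move=> fN.
rewrite /lie_defect linear_part_fil2; last by apply: fil_le fN.
rewrite (chom0 (chom_pr 3)) subr0; apply: filB.
  by apply: (chom_fil (chom_pr 3)); apply: fil_le fN; apply: ltnW.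
apply: (Lev_fil (raising_T Fa) (raising_T Fb) (LLam _)).
exact: (divB_fil (fox_fil _ Fv fN)).
Qed.

Definition has_series (z : chordQ 3) := exists lam, L lam z.

Lemma has_seriesD z z' : has_series z -> has_series z' -> has_series (z + z').
Proof. by case=> f fz [g gz]; exists (f + g); exact: (LevD fz gz). Qed.
Lemma has_seriesZ k z : has_series z -> has_series (k *: z).
Proof. by case=> f fz; exists (k *: f); exact: (LevZ k fz). Qed.
Lemma has_seriesN z : has_series z -> has_series (- z).
Proof. by case=> f fz; exists (- f); exact: (LevN fz). Qed.
Lemma has_series_sum I (r : seq I) (P : pred I) (M : I -> chordQ 3) :
  (forall i, P i -> has_series (M i)) -> has_series (\sum_(i <- r | P i) M i).
Proof.
move=> SM; elim/big_ind: _ => //; last exact: has_seriesD.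
by exists 0; apply: Lev0.
Qed.

Lemma letter_chord3 (x : chord 3) :
  [\/ letter x = t 1 2, letter x = t 2 3 | letter x = t 1 3].
Proof.
rewrite -t_letter; have /andP[] := valP x.
case: (val x).1 (val x).2 => [[|[|[|[|i]]]] hi] [[|[|[|[|j]]]] hj] //= _ _.
- by constructor 1.
- by constructor 3.
- by constructor 2.
Qed.

Let four_abc : four_term a b c.
Proof. exact: prt_four_term. Qed.

Let T_sum f z : L f z -> T (a + b + c) z = 0.
Proof.
have [r1 r2 r3] := four_abc => fz.
apply: (LevT_central F2comm Fa Fb _ _ _ fz).
- by do 2?apply: filD; exact: Fpr.
- by rewrite -addrA addrC bracketDl r2 /bracket subrr addr0.
- by rewrite addrAC [a + c]addrC bracketDl r3 /bracket subrr addr0.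
Qed.

Lemma has_series_T (x : chord 3) z : has_series z -> has_series (T (pr (letter x)) z).
Proof.
case=> f fz; have SA : has_series (T a z).
  by exists (varA * f); exact: (LevT_varA Fa Fb fz).
have SB : has_series (T b z).
  by exists (varB * f); exact: (LevT_varB F2comm Fa Fb Ce fz).
have [->|->|->] := letter_chord3 x => //; rewrite -/c.
have -> : T c z = - (T a z + T b z).
  apply/eqP; rewrite -addr_eq0 addrC -!TDl; apply/eqP; exact: T_sum fz.
exact: has_seriesN (has_seriesD SA SB).
Qed.

Lemma has_series_letters (x y : chord 3) :
  has_series (bracket (pr (letter x)) (pr (letter y))).
Proof.
have [bc ca] := four_termP four_abc.
have Se : has_series e by exists 1; exact: Lev1.
have S0 (z : chordQ 3) : has_series (bracket z z).
  by exists 0; rewrite /bracket subrr; exact: Lev0.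
have [->|->|->] := letter_chord3 x; have [->|->|->] := letter_chord3 y;
  rewrite -/a -/b -/c ?bc ?ca //.
- by rewrite bracketC ca; exact: has_seriesN.
- by rewrite bracketC; exact: has_seriesN.
- by rewrite bracketC bc; exact: has_seriesN.
Qed.

Let bracket_suml I (r : seq I) (M : I -> chordQ 3) (z : chordQ 3) :
  bracket (\sum_(i <- r) M i) z = \sum_(i <- r) bracket (M i) z.
Proof. by rewrite /bracket mulr_suml mulr_sumr -sumrB. Qed.

Let pr_linear_part f : pr (linear_part f) = \sum_x f [:: x] *: pr (letter x).
Proof.
rewrite /linear_part (chom_sum (chom_pr 3)); apply: eq_bigr => x _.
exact: (chomZ (chom_pr 3)).
Qed.

Let bracketZ k l (u v : chordQ 3) : bracket (k *: u) (l *: v) = (k * l) *: bracket u v.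
Proof.
by rewrite /bracket -!scalerAl -!scalerAr !scalerA scalerBr [l * k]mulrC.
Qed.

Lemma has_series_bracket_linear f g :
  has_series (bracket (pr (linear_part f)) (pr (linear_part g))).
Proof.
rewrite !pr_linear_part bracket_suml; apply: has_series_sum => x _.
rewrite bracketC bracket_suml -sumrN; apply: has_series_sum => y _.
rewrite -bracketC bracketZ; apply: has_seriesZ; exact: has_series_letters.
Qed.

Lemma has_series_T_linear f z : has_series z ->
  has_series (T (pr (linear_part f)) z).
Proof.
move=> Sz; rewrite pr_linear_part T_bracket bracketC bracket_suml -sumrN.
apply: has_series_sum => x _; rewrite -bracketC -[z]scale1r bracketZ mul1r.
by apply: has_seriesZ; exact: has_series_T.
Qed.

Let bracketDD (A : algType rat) (p z q y : A) :
  bracket (p + z) (q + y) = bracket p q + (- T p y + T q z) + bracket z y.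
Proof. by rewrite /T /bracket; non_commutative_ring. Qed.

Let bracket_C (z y : chordQ 3) : C F z -> C F y -> bracket z y = 0.
Proof. by move=> [Fz z0] [Fy y0]; rewrite /bracket (y0 _ Fz) (z0 _ Fy) subrr. Qed.

Definition lie_series : set (freeA 3) :=
  [set f : freeA 3 | f [::] = 0 /\ lie_defect f = 0]%classic.

Let lie_seriesE f : lie_defect f = 0 <-> pr f = pr (linear_part f) + pr (lam_part f).
Proof.
rewrite /lie_defect -addrA -opprD; split=> [|->]; last exact: subrr.
exact: subr0_eq.
Qed.

(** Split both entries into linear part and series. Two series have zero bracket, and a mixed
    bracket is, up to sign, a combination of chords acting on a series. *)
Lemma has_series_bracket f g : lie_series f -> lie_series g ->
  has_series (bracket (pr f) (pr g)).
Proof.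
move=> [f0 /lie_seriesE->] [g0 /lie_seriesE->].
have Cz h : C F (pr (lam_part h)) := LevT_C Ce (LLam _).
rewrite bracketDD (bracket_C (Cz f) (Cz g)) addr0.
apply: has_seriesD; first exact: has_series_bracket_linear.
apply: has_seriesD; first apply: has_seriesN.
  by apply: has_series_T_linear; exists (divB (tau g)); exact: LLam.
by apply: has_series_T_linear; exists (divB (tau f)); exact: LLam.
Qed.

Lemma lie_series_closed : closed_lie_subalgebra lie_series.
Proof.
have D0 := linear_zero lie_defect_linear; split.
- by split.
- move=> f g [f0 fd] [g0 gd]; split; first by rewrite -[LHS]/(f [::] + g [::]) f0 g0 addr0.
  by rewrite -[f]scale1r lie_defect_linear fd gd scaler0 addr0.
- move=> k f [f0 fd]; split; first by rewrite -[LHS]/(k * f [::]) f0 mulr0.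
  by rewrite -[k *: f]addr0 lie_defect_linear fd D0 scaler0 addr0.
- move=> f g Jf Jg; have [lam fg] := has_series_bracket Jf Jg.
  have [f0 g0] := (proj1 Jf, proj1 Jg).
  have F2 : ncfil 2 (bracket f g) by apply: bracket_fil; apply/ncfil1P.
  split; first exact: F2.
  apply/lie_seriesE; rewrite (linear_part_fil2 F2) (chom0 (chom_pr 3)) add0r.
  have E : pr (bracket f g) = pr (Lam lam (t 1 2) (t 2 3)).
    by rewrite (chom_bracket (chom_pr 3)); exact: Lev_uniq fg (LLam lam).
  (* The derivative depends only on the class modulo 2FF and equals [b lam] there, so [lam_part]
     computes the very [lam] just obtained. *)
  rewrite E /lam_part; have [_ _ ->] := prP_fox E.
  by rewrite fox_Lam_t12_t23 divB_varB.
- move=> f lim; split; first by have [g [g0 _] ->] := lim 0%N.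
  apply: (eqm_sep (F := F)) => N; apply/eqm0.
  have [g [_ gd] fg] := lim N.+1.
  have fgN : ncfil N.+2 (f - g) by apply/eqm_ncP => w; rewrite ltnS; apply: fg.
  have := lie_defect_fil fgN; rewrite addrC -scaleN1r lie_defect_linear gd.
  by rewrite scaler0 add0r.
Qed.

Lemma lie_series_letter x : lie_series (letter x).
Proof.
split=> //; apply/lie_seriesE.
have -> : linear_part (letter x) = letter x.
  rewrite /linear_part (bigD1 x) // big1 => [|y ne_yx].
    by apply: etrans (addr0 _) _; rewrite /= eqxx scale1r.
  by rewrite /= eqseq_cons (negPf ne_yx) scale0r.
rewrite /lam_part (fox_letter _ Fv) divB_const.
have -> : pr (Lam 0 (t 1 2) (t 2 3)) = 0 :> chordQ 3.
  by apply: Lev_uniq (LLam 0) _; exact: Lev0.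
by rewrite addr0.
Qed.

Lemma eqA_pr (f g : freeA 3) : eqA f g -> pr f = pr g.
Proof.
move=> fg; apply/eq2FFP => J [cJ JS]; apply: fg; split=> // h rh.
by apply: JS; left.
Qed.

Lemma pr_hatL (phi : freeA 3) : in_hatL phi -> ncfil 2 phi ->
  exists lam, pr phi = pr (Lam lam (t 1 2) (t 2 3)).
Proof.
case=> y Jy /eqA_pr py phi2; exists (divB (tau y)).
have [y0 /lie_seriesE yE] : lie_series y.
  by apply: Jy; split; [exact: lie_series_closed|move=> _ [x _ <-]; exact: lie_series_letter].
(* [phi] has order two and the ideal starts in degree two, so [y] has no linear part either. *)
have y2 : ncfil 2 y.
  have /prP/ideal2FF_fil py2 := py.
  by rewrite -[y](subKr phi); apply: filB.
by rewrite py yE (linear_part_fil2 y2) (chom0 (chom_pr 3)) add0r.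
Qed.

Lemma pr_nc_exp (phi : freeA 3) lam : ncfil 2 phi -> pr phi = pr (Lam lam (t 1 2) (t 2 3)) ->
  pr (nc_exp phi) = pr (Phi_of lam).
Proof.
move=> phi2 E; rewrite Phi_ofE (chomD (chom_pr 3)) (chom1 (chom_pr 3)) -E.
have [p2 p0] : C F (pr phi) by rewrite E; exact: (LevT_C Ce (LLam lam)).
have /is_exp_nc_exp Hexp : ncfil 1 phi by apply: fil_le phi2.
apply: is_sum_uniq (chom_exp (chom_pr 3) Hexp) _ => -[|[|N]]; first exact: fil_all.
  by rewrite big_ord1 fact0 invr1 scale1r expr0 /eqm addrAC subrr add0r; apply: fil_le p2.
apply: eqm_eq; rewrite 2!big_ord_recl big1 => [|n _].
  by rewrite /= fact0 invr1 !scale1r expr0 expr1 addr0.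
by rewrite /= exprS exprS mulrA p0 // mul0r scaler0.
Qed.

End LieSeries.

(** * Transport of unitarity and the hexagon along congruence modulo 2FF *)

Section Transfer.
Variables P S : freeA 3.
Hypotheses (P1 : P [::] = 1) (S1 : S [::] = 1) (PS : pr P = pr S).
Let Cp := chom_pr 3.

(** The inverses are those of series; their images are inverse to the same class. *)
Lemma pr_inv_congr : pr P^-1 = pr S^-1.
Proof.
have EP : pr P^-1 * pr P = 1.
  by rewrite -(chomM Cp) (proj1 (nc_mulVf P1)) (chom1 Cp).
have ES : pr S * pr S^-1 = 1.
  by rewrite -(chomM Cp) (proj2 (nc_mulVf S1)) (chom1 Cp).
by rewrite -[LHS]mulr1 -ES -PS mulrA EP mul1r.
Qed.

Lemma unitarity_congr : unitarity P -> unitarity S.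
Proof.
move=> /eq2FFP uP; apply/eq2FFP; rewrite -uP (chomM Cp P) (chomM Cp S) PS.
by rewrite (@relabel_pr [:: 3; 2; 1]%N _ P S).
Qed.

Lemma hexagon_congr X : hexagon X P -> hexagon X S.
Proof.
move=> /eq2FFP hP; apply/eq2FFP; rewrite hP.
rewrite !(chomM Cp) PS (@relabel_pr [:: 3; 1; 2]%N _ P S) //.
by rewrite (@relabel_pr [:: 1; 3; 2]%N _ P^-1 S^-1) //; apply: pr_inv_congr.
Qed.

End Transfer.

Theorem mainTheorem3 :
  (forall lam : fps2, symmetric2 lam -> lambda_equation lam ->
     [/\ pos_hexagon (Phi_of lam), neg_hexagon (Phi_of lam)
       & pentagon (Phi_of lam)])
  /\
  (forall phi : freeA 3,
     in_hatL phi ->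
     (forall w, (size w < 2)%N -> phi w = 0%R) ->
     let Phi := nc_exp phi in
     unitarity Phi -> pos_hexagon Phi -> neg_hexagon Phi -> pentagon Phi ->
     exists lam : fps2,
       [/\ symmetric2 lam, lambda_equation lam & eq2FF Phi (Phi_of lam)]).
Proof.
split=> [lam sym lamE|phi Lphi phi2 Phi uP hP _ _].
  have [pos neg] := hexagons_Phi_of sym lamE.
  by split=> //; apply: pentagon_Phi_of.
have [lam /(pr_nc_exp phi2) E] := pr_hatL Lphi phi2.
have [P1 S1] := (nc_exp_nil phi, Phi_of_nil lam).
have sym : symmetric2 lam := symmetric_of_unitarity (unitarity_congr E uP).
exists lam; split=> //; last exact/eq2FFP.
by apply/lambda_equationP; exact: (hexagon_to_equation sym (hexagon_congr P1 S1 E hP)).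
Qed.
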